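(* Let $F$ be a totally real number field with ring of integers $\mathcal{O}$ and different $\mathfrak{d}$. Let $\mathfrak{m},\mathfrak{n}$ be integral ideals of $\mathcal{O}$ with $\mathfrak{m}\subseteq4\mathcal{O}$ and $\mathfrak{n}\ne\mathcal{O}$. Let $\gamma=\begin{pmatrix}a&b\\c&d\end{pmatrix}\in\Gamma_0(\mathfrak{m}\mathfrak{n}^2)$, let $w\in2\mathfrak{d}^{-1}\mathfrak{n}^{-1}$, and let $r,t_r\in\mathcal{O}$ satisfy $t_r\equiv d^2r\pmod{\mathfrak{n}}$. Put $\beta_r=rw$, $\beta_{t_r}=t_rw$ and $$\gamma_r:=u(\beta_r)\,\gamma\,u(\beta_{t_r})^{-1},\qquad\text{where } u(\beta)=\begin{pmatrix}1&\beta\\0&1\end{pmatrix}.$$ Then $\gamma_r\in\Gamma_0(\mathfrak{m}\mathfrak{n}^2)\subseteq\Gamma_0(4\mathcal{O})$, and for all $z\in\mathcal{H}^{\mathbf{a}}$, $$h(\gamma,z)=h(\gamma_r,\,z+\beta_{t_r}).$$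
   Context: $\mathbf{a}$ is the set of archimedean places (real embeddings) of $F$, $\mathcal{H}$ the complex upper half plane, and $\mathrm{SL}_2(F)$ acts on $\mathcal{H}^{\mathbf{a}}$ componentwise by Möbius transformations through the real embeddings; $\beta\in F$ is added to $z\in\mathcal{H}^{\mathbf{a}}$ componentwise via the embeddings. For an integral ideal $\mathfrak{c}$ with $4\mathcal{O}\mid\mathfrak{c}$, $$\Gamma_0(\mathfrak{c})=\left\{\begin{pmatrix}a&b\\c&d\end{pmatrix}\in\mathrm{SL}_2(F):a,d\in\mathcal{O},\ b\in2\mathfrak{d}^{-1},\ c\in2^{-1}\mathfrak{c}\mathfrak{d}\right\}.$$ The theta series is $\theta(z)=\sum_{\xi\in\mathcal{O}}\exp\bigl(\pi i\sum_{v\in\mathbf{a}}\xi_v^2z_v\bigr)$, $z\in\mathcal{H}^{\mathbf{a}}$, where $\xi_v=v(\xi)$, and for $\gamma\in\Gamma_0(4\mathcal{O})$ the factor of automorphy is $h(\gamma,z)=\theta(\gamma z)/\theta(z)$ (a nowhere vanishing holomorphic function of $z$). *)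

(* Defs.v *)
From HB Require Import structures.
From mathcomp Require Import all_boot all_order all_algebra all_field.
From mathcomp Require Import complex.
From mathcomp Require Import all_classical all_reals all_analysis.
From mathcomp Require summability.

Set Implicit Arguments.
Unset Strict Implicit.
Unset Printing Implicit Defensive.

Import Order.TTheory GRing.Theory Num.Theory.
Import numFieldNormedType.Exports.

Local Open Scope ring_scope.
Local Open Scope complex_scope.
Local Open Scope classical_set_scope.

Section Ideals.
Variable F : fieldExtType rat.

Definition ring_of_integers : set F :=
  [set x | integralOver (intr : int -> F) x].

(* As usual in arithmetic, an integral ideal is nonzero.  Closure under
   subtraction follows from the last clause, since -1 is an integer. *)
Definition integral_ideal (I : set F) : Prop :=
  [/\ I `<=` ring_of_integers,
      (exists2 x, I x & x != 0),
      (forall x y, I x -> I y -> I (x + y)) &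
      (forall k x, ring_of_integers k -> I x -> I (k * x))].

Definition ideal_scale (k : F) (I : set F) : set F := [set k * x | x in I].

Definition ideal_mul (I J : set F) : set F :=
  [set x | exists2 s : seq (F * F),
    (forall p, p \in s -> I p.1 /\ J p.2) & x = \sum_(p <- s) p.1 * p.2].

Definition ideal_inv (I : set F) : set F :=
  [set x | forall y, I y -> ring_of_integers (x * y)].

(* Trace of F over Q: the trace of multiplication by x, a Q-linear map. *)
Definition field_trace (x : F) : rat :=
  \tr (passmx.mxof (vbasis {:F}) (vbasis {:F}) (amull x)).

(* The inverse of the different; the different is its inverse. *)
Definition codifferent : set F :=
  [set x | forall y, ring_of_integers y -> field_trace (x * y) \is a Num.int].

Definition different : set F := ideal_inv codifferent.

Definition Gamma0 (c : set F) : set 'M[F]_2 :=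
  [set g | [/\ \det g = 1,
      ring_of_integers (g 0 0) /\ ring_of_integers (g 1 1),
      ideal_scale 2 codifferent (g 0 1) &
      ideal_scale 2^-1 (ideal_mul c different) (g 1 0)]].

Definition unipotent (b : F) : 'M[F]_2 := 1%:M + b *: delta_mx 0 1.

End Ideals.

Arguments ring_of_integers F : clear implicits.
Arguments codifferent F : clear implicits.
Arguments different F : clear implicits.

Section Theta.
Variables (F : fieldExtType rat) (R : realType).

Definition totally_real : Prop :=
  forall (f : {rmorphism F -> R[i]}) (x : F), complex.Im (f x) = 0.

Definition place : Type := {rmorphism F -> R}.
HB.instance Definition _ := gen_eqMixin place.
HB.instance Definition _ := gen_choiceMixin place.

(* C^a with the product topology; R[i]^o is C with its usual topology. *)
Definition Ca : Type := {ptws place -> R[i]^o}.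

Definition upper_half : set Ca := [set z : Ca | forall v, 0 < complex.Im (z v)].

Definition moebius (g : 'M[F]_2) (z : Ca) : Ca := fun v : place =>
  ((v (g 0 0))%:C * z v + (v (g 0 1))%:C) /
  ((v (g 1 0))%:C * z v + (v (g 1 1))%:C).

Definition translate (z : Ca) (b : F) : Ca := fun v : place =>
  z v + (v b)%:C.

Definition cexp (z : R[i]) : R[i] :=
  (expR (complex.Re z))%:C * (cos (complex.Im z) +i* sin (complex.Im z)).

(* Unordered sum over the integers: the limit along the finite subsets.  The
   inner sum is a sum over a set, which is the true sum because F has only
   finitely many real embeddings. *)
Definition theta (z : Ca) : R[i]^o :=
  summability.sum (fun xi : ring_of_integers F => cexp ((0 +i* pi) *
    \sum_(v \in [set: place]) (v (val xi) ^+ 2)%:C * z v) : R[i]^o).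

(* theta may vanish somewhere on the upper half space when F <> Q, whereas
   the automorphy factor theta (g z) / theta z is holomorphic everywhere.  At a
   zero of theta the quotient is therefore read as its extension by
   continuity, not as the value 0 of a division by 0. *)
Definition automorphy_factor (g : 'M[F]_2) (z : Ca) : R[i]^o :=
  if theta z != 0 then theta (moebius g z) / theta z
  else lim ((fun u : Ca => theta (moebius g u) / theta u : R[i]^o) @
            within [set u | upper_half u /\ theta u != 0] (nbhs z)).

End Theta.

(* Main.v *)
From HB Require Import structures.
Require Import Defs.
From mathcomp Require Import all_boot all_order all_algebra all_field.
From mathcomp Require Import complex.
From mathcomp Require Import all_classical all_reals all_analysis.
From mathcomp Require Import finmap ring lra zify.
From mathcomp Require summability.

Import Order.TTheory GRing.Theory Num.Theory.
Import numFieldNormedType.Exports.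

Local Open Scope ring_scope.
Local Open Scope classical_set_scope.

Set Implicit Arguments.
Unset Strict Implicit.
Unset Printing Implicit Defensive.

(** Let theta(tau, l) be the sum over xi in O of
    exp(pi i sum_v (xi_v^2 tau_v + 2 xi_v l_v)), so that theta(tau) is its value
    at l = 0. Fix z and g = (a b; c d), put j = 1 / (c z + d), and compare two
    functions of l in C^a:

      theta(z, l)   and   exp(- pi i sum_v c_v j_v l_v^2) theta(g z, j l).

    Both are holomorphic and invariant under translation by the codifferent,
    and both acquire the same factor when l is replaced by l + mu z with mu in O.
    The Fourier coefficients of such a function are determined by one of them,
    so the second is J times the first, with the same J for all l
    (quasi_periodic_unique, theta_transform_proportional). At l = 0 this says
    theta(g z) = J theta(z). The usual proof evaluates J; here only its
    independence of l matters.

    Write w = 2 w'. The function xi |-> exp(pi i Tr(t w xi^2)) on O has period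
    n, so it is a finite combination of the characters xi |-> exp(2 pi i Tr(s xi))
    with s n contained in the codifferent, and theta(z + t w) is the same
    combination of the values theta(z, s). For these s the level of g gives
    c s in O and c s^2 in twice the codifferent, which makes the second function
    at l = s equal to theta(g z, a s). Summing the proportionality relations at
    the points s produces on the left the theta series at g z with weights
    exp(pi i Tr(t w a^2 xi^2)). Since a d = 1 + b c and t = d^2 r modulo n, these
    weights are exp(pi i Tr(r w xi^2)). Hence

      theta(g z + r w) = J theta(z + t w)

    (theta_shift_transform), and g z + r w = g_r (z + t w).

    So J is the value of both automorphy factors wherever theta does not vanish.
    At a zero of theta they are limits. There J is read off at a point l = p of F
    with theta(z, p) nonzero, which exists by theta_torsion_neq0; as a function
    of z it is then a quotient of continuous functions (Jfactor_cvg), so both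
    limits are J(z). The limits are taken along a proper filter because zeros of
    theta have no interior: s |-> theta(z + i s) is a Dirichlet series that tends
    to 1 at infinity, and by Taylor expansion it would vanish identically if it
    vanished on an interval (dsum_vanish, theta_nonzero_dense). *)

(** * Places of a totally real number field *)
Section PrimitiveElement.
Variable F : fieldExtType rat.

Lemma number_field_pchar : [pchar F] =i pred0.
Proof. by move=> p; rewrite GRing.pchar_lalg; exact: Num.Theory.pchar_num. Qed.

Lemma number_field_dim_gt0 : (0 < \dim {:F})%N.
Proof.
rewrite lt0n dimv_eq0 -subv0; apply/negP => /subvP /(_ 1 (memvf _)).
by rewrite memv0 oner_eq0.
Qed.

Lemma number_field_primitive_element : exists x : F, <<1; x>>%VS = {:F}%VS.
Proof.
have sepF : separable 1 {:F}.
  by apply/separableP => y _; exact: pcharf0_separable number_field_pchar _.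
exists (separable_generator 1%AS {:F}%AS).
by rewrite -(eq_adjoin_separable_generator sepF) ?subvf.
Qed.

(** The field is presented as Q[X]/(p) with p the minimal polynomial of a
    primitive element: polynomial identities in x become divisibility by p, so
    embeddings into any field correspond to roots of p there. *)
Lemma number_field_presentation : exists (x : F) (p : {poly rat}),
  [/\ p \is monic, size p = (\dim {:F}).+1, separable_poly p,
      (forall q, root (map_poly (in_alg F) q) x = (p %| q)) &
      forall y, exists q, y = (map_poly (in_alg F) q).[x] ].
Proof.
have [x xF] := number_field_primitive_element.
have /polyOver1P[p pE] := minPolyOver 1%AS x.
have dvdE q : root (map_poly (in_alg F) q) x = (p %| q).
  rewrite -(dvdp_map (in_alg F)) -pE; apply/idP/idP => [|dvq].
    by apply: minPoly_dvdp; rewrite alg_polyOver.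
  by rewrite root_factor_theorem (dvdp_trans _ dvq) // -root_factor_theorem root_minPoly.
exists x, p; split=> //.
- by rewrite -(map_monic (in_alg F)) -pE monic_minPoly.
- rewrite -(size_map_poly (in_alg F)) -pE size_minPoly -xF dim_Fadjoin.
  by rewrite dimv1 muln1.
- rewrite -(separable_map (in_alg F)) -pE.
  by exact: pcharf0_separable number_field_pchar _.
- by move=> y; apply/Fadjoin1_polyP; rewrite xF memvf.
Qed.

End PrimitiveElement.

Section Embeddings.
Variables (F : fieldExtType rat) (x : F) (p : {poly rat}).
Hypothesis dvd_p : forall q, root (map_poly (in_alg F) q) x = (p %| q).
Hypothesis gen_x : forall y, exists q, y = (map_poly (in_alg F) q).[x].

(** Evaluating at z a polynomial that represents y does not depend on the
    chosen representative, because two of them differ by a multiple of p. *)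
Lemma embedding_of_root (K : numFieldType) (z : K) :
  root (map_poly ratr p) z -> exists f : {rmorphism F -> K}, f x = z.
Proof.
move=> pz; have [q qE] := choice gen_x.
pose f y := (map_poly ratr (q y)).[z].
have fE q1 : f (map_poly (in_alg F) q1).[x] = (map_poly ratr q1).[z].
  apply/eqP; rewrite /f -subr_eq0 -hornerN -hornerD -rmorphB /= -/(root _ z).
  have: p %| q (map_poly (in_alg F) q1).[x] - q1.
    by rewrite -dvd_p /root rmorphB /= hornerD hornerN -qE subrr.
  move=> /dvdpP[r ->]; rewrite rmorphM /= rootM pz orbT.
  by [].
have fB : zmod_morphism f.
  move=> a b; rewrite (qE a) (qE b) -hornerN -hornerD -rmorphB /= !fE.
  by rewrite rmorphB /= hornerD hornerN.
have fM : monoid_morphism f.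
  split.
    have -> : 1 = (map_poly (in_alg F) 1).[x] by rewrite rmorph1 hornerC.
    by rewrite fE rmorph1 hornerC.
  move=> a b; rewrite (qE a) (qE b) -hornerM -rmorphM /= !fE.
  by rewrite rmorphM /= hornerM.
pose m1 := GRing.isZmodMorphism.Build F K f fB.
pose m2 := GRing.isMonoidMorphism.Build F K f fM.
pose g : {rmorphism F -> K} := HB.pack f m1 m2.
exists g; rewrite /g /=.
have {1}-> : x = (map_poly (in_alg F) 'X).[x] by rewrite map_polyX hornerX.
by rewrite fE map_polyX hornerX.
Qed.

Lemma rmorph_ext (K : numFieldType) (f g : {rmorphism F -> K}) :
  f =1 g -> f = g.
Proof.
case: f g => f [f1 f2] [g [g1 g2]] /= /funext fg; subst g.
congr (GRing.RMorphism.Pack _); congr GRing.RMorphism.Class.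
  by case: f1 g1 => ? [?]; congr (GRing.isNmodMorphism.Axioms_ _); apply: Prop_irrelevance.
by case: f2 g2 => ? [?]; congr (GRing.isMonoidMorphism.Axioms_ _); apply: Prop_irrelevance.
Qed.

Lemma rmorph_horner_rat (K : numFieldType) (f : {rmorphism F -> K}) q :
  f (map_poly (in_alg F) q).[x] = (map_poly ratr q).[f x].
Proof.
rewrite -horner_map -map_poly_comp; congr (_.[_]).
apply: eq_map_poly => a /=.
by rewrite -(fmorph_eq_rat (f \o in_alg F)).
Qed.

Lemma embedding_inj (K : numFieldType) (f g : {rmorphism F -> K}) :
  f x = g x -> f = g.
Proof.
move=> fg; apply: rmorph_ext => y; have [q ->] := gen_x y.
by rewrite !rmorph_horner_rat fg.
Qed.

Lemma embedding_root (K : numFieldType) (f : {rmorphism F -> K}) :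
  root (map_poly ratr p) (f x).
Proof.
have : root (map_poly (in_alg F) p) x by rewrite dvd_p.
by rewrite /root -rmorph_horner_rat => /eqP ->; rewrite rmorph0.
Qed.

End Embeddings.

Section Places.
Variables (F : fieldExtType rat) (R : realType).
Hypothesis F_real : totally_real F R.

(** The complex roots of p are simple and each gives a complex embedding; total
    reality makes the image real, so all embeddings descend to places. *)
Lemma places_enum (x : F) (p : {poly rat}) :
  p \is monic -> separable_poly p ->
  (forall q, root (map_poly (in_alg F) q) x = (p %| q)) ->
  (forall y, exists q, y = (map_poly (in_alg F) q).[x]) ->
  exists vs : 'I_(size p).-1 -> place F R,
   injective (fun i => vs i x) /\ forall v, exists i, v = vs i.
Proof.
move=> pm sep dvdp_ gen.
pose P := map_poly ratr p : {poly R[i]}.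
have Pm : P \is monic by rewrite map_monic.
have [rs Prs] := closed_field_poly_normal P.
rewrite (monicP Pm) scale1r in Prs.
have szrs : size rs = (size p).-1.
  by rewrite -(size_map_poly (ratr : {rmorphism rat -> R[i]})) -/P Prs size_prod_XsubC.
have urs : uniq rs.
  by rewrite -separable_prod_XsubC -Prs separable_map.
have rootE z : root P z = (z \in rs) by rewrite Prs root_prod_XsubC.
have vE (i : 'I_(size p).-1) : exists v : place F R, ((v x)%:C)%C = rs`_i.
  have : root P rs`_i by rewrite rootE mem_nth // szrs.
  move=> /(embedding_of_root dvdp_ gen)[f fx].
  have fRe y : f y = ((complex.Re (f y))%:C)%C by rewrite [LHS]complexE (F_real f y) mulr0 addr0.
  have rm := rmorphM f.
  pose g y := complex.Re (f y).
  have gB : zmod_morphism g by move=> a b; rewrite /g rmorphB raddfB.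
  have gM : monoid_morphism g.
    split; first by rewrite /g rmorph1.
    by move=> a b; apply: (@complexI R); rewrite rmorphM /= /g -!fRe rmorphM.
  pose m1 := GRing.isZmodMorphism.Build F R g gB.
  pose m2 := GRing.isMonoidMorphism.Build F R g gM.
  pose h : {rmorphism F -> R} := HB.pack g m1 m2.
  by exists h; rewrite -fx fRe.
have [vs vsE] := choice vE.
exists vs; split.
  move=> i j /= eq_ij; apply/val_inj/eqP.
  have eq_rs : rs`_i = rs`_j by rewrite -!vsE eq_ij.
  by move/eqP: eq_rs; rewrite nth_uniq ?szrs //.
move=> v; have : root P ((v x)%:C)%C.
  have -> : P = map_poly (real_complex R) (map_poly ratr p).
    rewrite -map_poly_comp; apply: eq_map_poly => a.
    exact: (esym (fmorph_eq_rat (real_complex R \o ratr) a)).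
  by rewrite -[X in root _ X]/(real_complex R (v x)) fmorph_root; apply: embedding_root.
rewrite rootE => vrs.
have ip : (index ((v x)%:C)%C rs < (size p).-1)%N by rewrite -szrs index_mem.
exists (Ordinal ip); apply: (embedding_inj gen).
by apply: (@complexI R); rewrite vsE /= nth_index.
Qed.
End Places.

(** * The trace form and algebraic integers *)
Section TraceForm.
Variables (F : fieldExtType rat) (R : realType).
Hypothesis F_real : totally_real F R.
Local Notation D := (\dim {:F}).

(** Linear independence of the places is the nonvanishing of the Vandermonde
    determinant of the conjugates of a primitive element. *)
Lemma places_independent : exists vs : 'I_D -> place F R,
  [/\ injective vs, (forall v, exists i, v = vs i) &
      forall c : 'rV[R]_D, (forall y, \sum_i c 0 i * vs i y = 0) -> c = 0].
Proof.
have [x [p [pm szp sep dvdp_ gen]]] := number_field_presentation F.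
have [] := places_enum F_real pm sep dvdp_ gen.
rewrite szp /= => vs [injx surj]; exists vs; split=> //.
  by move=> i j ij; apply: injx => /=; rewrite ij.
move=> c c0; pose a : 'rV[R]_D := \row_j vs j x.
have cV : c *m (Vandermonde D a)^T = 0.
  apply/rowP=> k; rewrite !mxE -[RHS](c0 (x ^+ k)); apply: eq_bigr => j _.
  by rewrite !mxE rmorphXn.
have uV : (Vandermonde D a)^T \in unitmx.
  rewrite unitmxE det_tr det_Vandermonde unitfE.
  apply/prodf_neq0 => i _; apply/prodf_neq0 => j ij; rewrite !mxE subr_eq0.
  by apply/eqP => /injx ji; rewrite ji ltnn in ij.
by rewrite -[c](mulmxK uV) cV mul0mx.
Qed.

Variable vs : 'I_D -> place F R.
Hypothesis vs_free :
  forall c : 'rV[R]_D, (forall y, \sum_i c 0 i * vs i y = 0) -> c = 0.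

Lemma placeZ (v : place F R) (a : rat) (y : F) : v (a *: y) = ratr a * v y.
Proof.
by rewrite -mulr_algl rmorphM -(fmorph_eq_rat (v \o in_alg F)).
Qed.

Definition place_matrix (b : D.-tuple F) : 'M[R]_D := \matrix_(i, j) vs i b`_j.

Lemma place_matrix_unit (b : D.-tuple F) : basis_of {:F} b -> place_matrix b \in unitmx.
Proof.
move=> bF; rewrite -row_free_unit; apply/row_freeP.
suff kV (u : 'rV_D) : u *m place_matrix b = 0 -> u = 0.
  have : row_free (place_matrix b).
    by rewrite -kermx_eq0; apply/rowV0P => u /sub_kermxP /kV.
  by move/row_freeP.
move=> u0; apply: vs_free => y; rewrite (coord_basis bF (memvf y)).
under eq_bigr => i _ do rewrite rmorph_sum mulr_sumr.
rewrite exchange_big big1 //= => j _.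
under eq_bigr => i _ do rewrite placeZ mulrCA.
rewrite -mulr_sumr; have /rowP/(_ j) := u0; rewrite !mxE.
under eq_bigr => i _ do rewrite mxE.
by move=> ->; rewrite mulr0.
Qed.

(** The matrix of the places on a basis diagonalizes multiplication by y, with
    the conjugates of y on the diagonal. *)
Lemma field_trace_places y : ratr (field_trace y) = \sum_i vs i y.
Proof.
set b := vbasis {:F}; have bF : basis_of {:F} b := vbasisP _.
pose M := passmx.mxof b b (amull y); pose V := place_matrix b.
have rowM (j : 'I_D) : y * b`_j = \sum_k M j k *: b`_k.
  have := passmx.mul_mxof b b (amull y) (delta_mx 0 j).
  rewrite passmx.vecof_delta lfunE /= -rowE => /(congr1 (passmx.vecof b)).
  rewrite passmx.rVofK // => <-.
  by rewrite /passmx.vecof; apply: eq_bigr => k _; rewrite mxE.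
have eqV : diag_mx (\row_i vs i y) *m V = V *m (map_mx ratr M)^T.
  apply/matrixP => i j; rewrite mul_diag_mx !mxE -rmorphM rowM rmorph_sum.
  by apply: eq_bigr => k _; rewrite placeZ !mxE mulrC.
have uV : V \in unitmx by apply: place_matrix_unit.
rewrite /field_trace -/M -(trace_map_mx (ratr : {rmorphism rat -> R})) -mxtrace_tr.
rewrite -[X in \tr X](mulKmx uV) -eqV mxtrace_mulC mulmxK // mxtrace_diag.
by apply: eq_bigr => i _; rewrite mxE.
Qed.

End TraceForm.

Lemma rat_integral_int (q : rat) : integralOver (intr : int -> rat) q -> q \is a Num.int.
Proof.
case=> p pm; rewrite -(fmorph_root (ratr : {rmorphism rat -> algC})) /= -map_poly_comp.
rewrite (eq_map_poly (g := (intr : int -> algC))); last first.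
  by move=> m /=; rewrite ratr_int.
move=> rt.
have : (ratr q : algC) \is a Num.int.
  apply: Cint_rat_Aint; first exact: Crat_rat.
  apply: root_monic_Aint rt _ _.
    exact: (monic_map (intr : {rmorphism int -> algC})).
  by apply/polyOverP => i; rewrite coef_map /= intr_int.
move=> /intrP[m]; rewrite -(ratr_int _ m) => /fmorph_inj ->; exact: intr_int.
Qed.

Section Integers.
Variables (F : fieldExtType rat) (R : realType).
Hypothesis F_real : totally_real F R.
Local Notation D := (\dim {:F}).
Local Notation O := (ring_of_integers F).

Lemma ringO0 : O 0. Proof. exact: (@mxpoly.integral0 int F intr). Qed.
Lemma ringO1 : O 1. Proof. exact: (@integral1 int F intr). Qed.
Lemma ringOD x y : O x -> O y -> O (x + y). Proof. exact: (@integral_add int F intr). Qed.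
Lemma ringOB x y : O x -> O y -> O (x - y). Proof. exact: (@integral_sub int F intr). Qed.
Lemma ringON x : O x -> O (- x). Proof. exact: (@integral_opp int F intr). Qed.
Lemma ringOM x y : O x -> O y -> O (x * y). Proof. exact: (@integral_mul int F intr). Qed.
Lemma ringO_int m : O m%:~R. Proof. exact: (@integral_id int F intr). Qed.
Lemma ringO_sum (I : Type) (r : seq I) (P : pred I) (f : I -> F) :
  (forall i, P i -> O (f i)) -> O (\sum_(i <- r | P i) f i).
Proof. by move=> h; elim/big_rec: _ => [|i x Pi]; [exact: ringO0|apply: ringOD; apply: h]. Qed.

(** If a clears the denominators of a monic q of degree n with q(y) = 0, then
    a y is a root of the monic polynomial with coefficients q_i a^(n-i). *)
Lemma integral_multiple (y : F) : exists2 a : int, a != 0 & O (a%:~R * y).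
Proof.
have [x [p [pm szp sep dvdp_ gen]]] := number_field_presentation F.
have [q qm rq] : exists2 q : {poly rat}, q \is monic & root (map_poly (in_alg F) q) y.
  have /polyOver1P[q qE] := minPolyOver 1%AS y.
  exists q; first by rewrite -(map_monic (in_alg F)) -qE monic_minPoly.
  by rewrite -qE root_minPoly.
have [q1 [a a0 qE]] := rat_poly_scale q.
exists a => //.
pose n := (size q).-1; pose A : F := a%:~R.
have AE : A = (a%:~R : rat)%:A by rewrite /A -(rmorph_int (in_alg F)).

have szq : size q = n.+1.
  by rewrite prednK // size_poly_gt0 monic_neq0.
pose P : {poly F} := \poly_(i < n.+1) ((q`_i)%:A * A ^+ (n - i)).
have Pn : P`_n = 1.
  rewrite coef_poly ltnSn subnn expr0 mulr1 -[n]/(n.+1.-1) -szq -lead_coefE (monicP qm).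
  by rewrite scale1r.
have szP : size P = n.+1.
  by rewrite size_poly_eq //; move: Pn; rewrite coef_poly ltnSn => ->; exact: oner_neq0.
apply: (@integral_root_monic int F intr _ P).
- by rewrite monicE lead_coefE szP /= Pn.
- move: rq; rewrite /root (@horner_coef_wide _ n.+1) ?size_map_poly ?szq // horner_poly => /eqP rq.
  apply/eqP; transitivity (A ^+ n * \sum_(i < n.+1) (map_poly (in_alg F) q)`_i * y ^+ i); last by rewrite rq mulr0.
  rewrite mulr_sumr; apply: eq_bigr => i _.
  rewrite [A ^+ n](_ : _ = A ^+ (n - i) * A ^+ i); last first.
    by rewrite -exprD subnK // -ltnS.
  rewrite coef_map /= exprMn -/A; ring.
- move=> c cP; have := nth_index 0 cP; move: (cP); rewrite -index_mem szP.
  move: (index c P) => i ilt <-; rewrite coef_poly ilt.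
  move: ilt; rewrite ltnS leq_eqVlt => /orP[/eqP ->|ilt].
    by move: Pn; rewrite coef_poly ltnSn => ->; exact: ringO1.
  rewrite -(subnSK ilt) exprS mulrA; apply: ringOM.
    rewrite qE coefZ coef_map /=.
    rewrite mulr_algl AE scalerA mulrAC mulVf ?intr_eq0 // mul1r.
    by rewrite -[_%:A]/(in_alg F _) rmorph_int; exact: ringO_int.
  elim: (n - i.+1)%N => [|k IH]; rewrite ?expr0 ?exprS; first exact: ringO1.
  by apply: ringOM => //; exact: ringO_int.
Qed.

(** The trace is the sum of the conjugates, which are integral over Z, and a
    rational number integral over Z is an integer. *)
Lemma field_trace_int y : O y -> field_trace y \is a Num.int.
Proof.
have [vs [_ _ vs_free]] := places_independent F_real.
move=> Oy; apply: rat_integral_int.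
have : integralOver (intr : int -> R) (ratr (field_trace y)).
  rewrite (field_trace_places vs_free).
  elim/big_rec: _ => [|i x _]; first exact: (@mxpoly.integral0 int R intr).
  apply: (@integral_add int R intr).
  have := @integral_rmorph _ _ _ (intr : int -> F) (vs i) y Oy.
  case=> p pm rt; exists p => //.
  by rewrite (eq_map_poly (g := vs i \o intr)) // => m /=; rewrite rmorph_int.
case=> p pm rt; exists p => //.
rewrite -(fmorph_root (ratr : {rmorphism rat -> R})) -map_poly_comp.
by rewrite (eq_map_poly (g := (intr : int -> R))) // => m /=; rewrite ratr_int.
Qed.

End Integers.

(** * Integral bases and the codifferent *)
Section TraceLinearity.
Variable F : fieldExtType rat.
Implicit Types x y : F.

Lemma field_trace_linear a x y : field_trace (a *: x + y) = a * field_trace x + field_trace y.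
Proof. by rewrite /field_trace amull_is_linear passmx.mxof_linear mxtraceD mxtraceZ. Qed.

Lemma field_traceD x y : field_trace (x + y) = field_trace x + field_trace y.
Proof. by rewrite -[x in LHS]scale1r field_trace_linear mul1r. Qed.

Lemma field_trace0 : field_trace (0 : F) = 0.
Proof. by apply: (addrI (field_trace (0 : F))); rewrite -field_traceD !addr0. Qed.

Lemma field_traceZ a x : field_trace (a *: x) = a * field_trace x.
Proof. by rewrite -[_ *: _]addr0 field_trace_linear field_trace0 addr0. Qed.

Lemma field_traceB x y : field_trace (x - y) = field_trace x - field_trace y.
Proof. by rewrite field_traceD -scaleN1r field_traceZ mulN1r. Qed.

Lemma field_trace_sum (I : Type) (r : seq I) (P : pred I) (f : I -> F) :
  field_trace (\sum_(i <- r | P i) f i) = \sum_(i <- r | P i) field_trace (f i).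
Proof. by rewrite (big_morph _ field_traceD field_trace0). Qed.

End TraceLinearity.

Section IntegralBasis.
Variables (F : fieldExtType rat) (R : realType).
Local Notation D := (\dim {:F}).
Local Notation O := (ring_of_integers F).
Variable vs : 'I_D -> place F R.
Hypothesis trace_int : forall y, O y -> field_trace y \is a Num.int.
Hypothesis vs_free :
  forall c : 'rV[R]_D, (forall y, \sum_i c 0 i * vs i y = 0) -> c = 0.

Let traceE y : ratr (field_trace y) = \sum_i vs i y := field_trace_places vs_free y.

Let V (b : 'I_D -> F) : 'M[R]_D := \matrix_(i, j) vs i (b j).
Let T (b : 'I_D -> F) : 'M[rat]_D := \matrix_(i, j) field_trace (b i * b j).

Let traceV b : map_mx ratr (T b) = (V b)^T *m V b.
Proof.
apply/matrixP => i j; rewrite !mxE traceE; apply: eq_bigr => k _.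
by rewrite !mxE rmorphM.
Qed.

Let detT b : ratr (\det (T b)) = \det (V b) ^+ 2.
Proof. by rewrite -det_map_mx traceV det_mulmx det_tr expr2. Qed.

(** The Gram matrix of the trace form factors through the matrix V of the
    places, whose determinant therefore detects bases. *)
Lemma trace_nondegenerate b y :
  \det (V b) != 0 -> (forall i, field_trace (y * b i) = 0) -> y = 0.
Proof.
move=> Vb y0; have uV : V b \in unitmx by rewrite unitmxE unitfE.
have : (\row_i vs i y) *m V b = 0.
  apply/rowP => i; rewrite !mxE; transitivity (ratr (field_trace (y * b i)) : R); last by rewrite y0 rmorph0.
  rewrite traceE.
  by apply: eq_bigr => k _; rewrite !mxE rmorphM.
move/(congr1 (mulmx^~ (invmx (V b)))); rewrite mulmxK // mul0mx => /rowP/(_ (Ordinal (number_field_dim_gt0 F))).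
by rewrite !mxE => /eqP; rewrite fmorph_eq0 => /eqP.
Qed.

Let coords b y : 'rV[rat]_D := (\row_i field_trace (y * b i)) *m invmx (T b).

Let coordsE b y : \det (V b) != 0 -> y = \sum_i coords b y 0 i *: b i.
Proof.
move=> Vb; apply/eqP; rewrite -subr_eq0; apply/eqP/(trace_nondegenerate Vb) => j.
have uT : T b \in unitmx.
  by rewrite unitmxE unitfE -(fmorph_eq0 (ratr : {rmorphism rat -> R})) /= detT expf_neq0.
have /rowP/(_ j) : coords b y *m T b = \row_i field_trace (y * b i) by rewrite mulmxKV.
rewrite !mxE mulrBl field_traceB => <-; apply/eqP; rewrite subr_eq0; apply/eqP.
rewrite mulr_suml field_trace_sum; apply: eq_bigr => i _.
by rewrite -scalerAl field_traceZ /T [X in _ * X]mxE.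
Qed.

Let detV_replace b i0 (u : 'rV[rat]_D) :
  \det (V (fun j => if j == i0 then \sum_i u 0 i *: b i else b j)) = ratr (u 0 i0) * \det (V b).
Proof.
set b' := fun j => _.
have -> : ratr (u 0 i0) * \det (V b) = (\adj (V b) *m (V b *m map_mx ratr u^T)) i0 0.
  by rewrite mulmxA mul_adj_mx mul_scalar_mx !mxE mulrC.
rewrite (expand_det_col _ i0) mxE; apply: eq_bigr => k _.
rewrite !mxE /b' eqxx mulrC; congr (_ * _).
  rewrite /cofactor; congr (_ * \det _); apply/matrixP => i j; rewrite !mxE.
  by rewrite eq_sym (negPf (neq_lift _ _)).
rewrite rmorph_sum; apply: eq_bigr => i _; by rewrite placeZ !mxE mulrC.
Qed.

(** Among the bases made of algebraic integers, one whose discriminant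
    det(V)^2, a natural number, is smallest must be an integral basis. The
    trace-dual basis then lies in the inverse different. *)
Lemma integral_basis_exists : exists e f : 'I_D -> F,
  [/\ (forall i, O (e i)), (forall i, codifferent F (f i)),
      (forall i j, field_trace (e i * f j) = (i == j)%:R),
      (forall y, y = \sum_i field_trace (y * f i) *: e i) &
      (forall y, y = \sum_i field_trace (y * e i) *: f i)].
Proof.
suff [e [Oe Ve e_int]] : exists e : 'I_D -> F, [/\ (forall i, O (e i)), \det (V e) != 0 &
    forall y, O y -> forall i, coords e y 0 i \is a Num.int].
  have uT : T e \in unitmx.
    by rewrite unitmxE unitfE -(fmorph_eq0 (ratr : {rmorphism rat -> R})) /= detT expf_neq0.
  pose f j := \sum_k invmx (T e) k j *: e k.
  have trf y i : field_trace (y * f i) = coords e y 0 i.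
    rewrite /f mulr_sumr field_trace_sum mxE; apply: eq_bigr => k _.
    by rewrite -scalerAr field_traceZ !mxE mulrC.
  have dual i j : field_trace (e i * f j) = (i == j)%:R.
    have /matrixP/(_ i j) := mulmxV uT; rewrite !mxE => <-.
    rewrite trf mxE; apply: eq_bigr => k _; by rewrite !mxE.
  exists e, f; split=> // [i y Oy|y|y].
  - by rewrite mulrC trf e_int.
  - rewrite {1}(coordsE y Ve); apply: eq_bigr => i _; by rewrite trf.
  - apply/eqP; rewrite -subr_eq0; apply/eqP/(trace_nondegenerate Ve) => j.
    rewrite mulrBl field_traceB mulr_suml field_trace_sum (bigD1 j) //=.
    rewrite -scalerAl field_traceZ [f j * _]mulrC dual eqxx mulr1 big1 ?addr0 ?subrr // => i ij.
    by rewrite -scalerAl field_traceZ [f i * _]mulrC dual eq_sym (negPf ij) mulr0.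
have [b0 [Ob0 Vb0]] : exists b : 'I_D -> F, (forall i, O (b i)) /\ \det (V b) != 0.
  have /choice[a aP] : forall j : 'I_D, exists a : int, a != 0 /\ O (a%:~R * (vbasis {:F})`_j).
    by move=> j; have [a a0 Oa] := integral_multiple ((vbasis {:F})`_j); exists a.
  exists (fun j => (a j)%:~R * (vbasis {:F})`_j); split=> [j|]; first by case: (aP j).
  have -> : V (fun j => (a j)%:~R * (vbasis {:F})`_j) =
      place_matrix vs (vbasis {:F}) *m diag_mx (\row_j (a j)%:~R).
    by apply/matrixP => i j; rewrite mul_mx_diag !mxE rmorphM rmorph_int mulrC.
  rewrite det_mulmx mulf_neq0 //.
    by rewrite -unitfE -unitmxE (place_matrix_unit vs_free) ?vbasisP.
  rewrite det_diag; apply/prodf_neq0 => j _; rewrite mxE intr_eq0; by case: (aP j).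
have detN b : (forall i, O (b i)) -> exists k : nat, \det (V b) ^+ 2 = k%:R.
  move=> Ob; have : \det (T b) \is a Num.int.
    apply: rpred_sum => s _; rewrite rpredM ?rpred_sign ?rpred_prod // => i _.
    by rewrite !mxE; apply: trace_int; apply: ringOM.
  move=> /intrP[m mE]; have := detT b; rewrite mE ratr_int => dE.
  have : 0 <= (m%:~R : R) by rewrite dE sqr_ge0.
  rewrite ler0z => m0; exists `|m|%N; by rewrite -dE natr_absz ger0_norm.
have [k] := detN _ Ob0.
elim/ltn_ind: k b0 Ob0 Vb0 => k IH b Ob Vb kE.
have [e_int|] := pselect (forall y, O y -> forall i, coords b y 0 i \is a Num.int).
  by exists b.
move=> /existsNP[y /not_implyP[Oy /existsNP[i0 /negP q_int]]].
(* Otherwise some integer y has a non-integral coordinate i0; replacing b i0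
   by the vector of fractional parts multiplies det V by a number in (0,1). *)
pose u : 'rV[rat]_D := \row_i (coords b y 0 i - (Num.floor (coords b y 0 i))%:~R).
pose b' j := if j == i0 then \sum_i u 0 i *: b i else b j.
have Ob' j : O (b' j).
  rewrite /b'; case: eqP => // _.
  rewrite (_ : \sum_i _ = y - \sum_i (Num.floor (coords b y 0 i))%:~R * b i).
    by apply: ringOB => //; apply: ringO_sum => i _; apply: ringOM => //; apply: ringO_int.
  rewrite {1}(coordsE y Vb) -sumrB; apply: eq_bigr => i _.
  by rewrite mxE scalerBl scaler_int mulrzl.
have u_gt0 : 0 < u 0 i0.
  rewrite mxE subr_gt0 lt_neqAle Num.Theory.floor_le ?andbT.
  by apply: contra q_int => /eqP <-; exact: intr_int.
have u_lt1 : u 0 i0 < 1.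
  by rewrite mxE ltrBlDl -intrD1 Num.Theory.floorD1_gt.
have Vb' : \det (V b') = ratr (u 0 i0) * \det (V b) by apply: detV_replace.
have Vb'0 : \det (V b') != 0.
  rewrite Vb' mulf_neq0 //.
  by rewrite (fmorph_eq0 (ratr : {rmorphism rat -> R})) (gt_eqF u_gt0).
have [k' k'E] := detN _ Ob'.
apply: (IH k' _ b') => //.
rewrite -(ltr_nat R) -k'E -kE Vb' exprMn gtr_pMl ?exprn_even_gt0 //.
rewrite exprn_ilt1 ?ler0q ?ltW //.
by rewrite -(rmorph1 (ratr : {rmorphism rat -> R})) ltr_rat.
Qed.

End IntegralBasis.

(** * The complex absolute value and exponential *)
Section ComplexAbs.
Variable R : realType.
Implicit Types z w : R[i].

(** The modulus as an element of R: the norm of R[i] takes values in R[i]. *)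
Definition cabs z : R := complex.Re `|z|.

Lemma cabsE z : `|z| = ((cabs z)%:C)%C.
Proof. by rewrite /cabs normc_def. Qed.

Lemma cabs_ge0 z : 0 <= cabs z.
Proof. by rewrite -lecR -cabsE normr_ge0. Qed.

Lemma cabs0 : cabs 0 = 0. Proof. by rewrite /cabs normr0. Qed.

Lemma cabs_eq0 z : (cabs z == 0) = (z == 0).
Proof. by rewrite -(inj_eq (@complexI R)) -cabsE normr_eq0. Qed.

Lemma cabs_gt0 z : (0 < cabs z) = (z != 0).
Proof. by rewrite lt_def cabs_ge0 andbT cabs_eq0. Qed.

Lemma cabs1 : cabs 1 = 1. Proof. by rewrite /cabs normr1. Qed.

Lemma cabsN z : cabs (- z) = cabs z. Proof. by rewrite /cabs normrN. Qed.

Lemma cabsM z w : cabs (z * w) = cabs z * cabs w.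
Proof. by apply: (@complexI R); rewrite -cabsE normrM !cabsE rmorphM. Qed.

Lemma cabsX z n : cabs (z ^+ n) = cabs z ^+ n.
Proof. by elim: n => [|n IH]; rewrite ?expr0 ?cabs1 // !exprS cabsM IH. Qed.

Lemma cabsV z : cabs z^-1 = (cabs z)^-1.
Proof. by apply: (@complexI R); rewrite -cabsE normfV !cabsE fmorphV. Qed.

Lemma cabsD z w : cabs (z + w) <= cabs z + cabs w.
Proof. by rewrite -lecR -cabsE rmorphD /= -!cabsE ler_normD. Qed.

Lemma cabsB z w : cabs (z - w) <= cabs z + cabs w.
Proof. by rewrite -(cabsN w); exact: cabsD. Qed.

Lemma cabsC z w : cabs (z - w) = cabs (w - z).
Proof. by rewrite -cabsN opprB. Qed.

Lemma cabs_tri u z w : cabs (z - w) <= cabs (z - u) + cabs (u - w).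
Proof. by have := cabsD (z - u) (u - w); rewrite addrA subrK. Qed.

Lemma cabs_sum (I : Type) (r : seq I) (P : pred I) (f : I -> R[i]) :
  cabs (\sum_(i <- r | P i) f i) <= \sum_(i <- r | P i) cabs (f i).
Proof.
elim/big_ind2: _ => [|a b c d h1 h2|//]; first by rewrite cabs0.
by apply: le_trans (cabsD _ _) _; apply: lerD.
Qed.

Lemma cabs_real (x : R) : cabs (x%:C)%C = `|x|.
Proof. by rewrite /cabs normc_def /= expr0n /= addr0 sqrtr_sqr. Qed.

Lemma cabs_nat n : cabs n%:R = n%:R.
Proof. by rewrite -(rmorph_nat (real_complex R)) cabs_real ger0_norm. Qed.

Lemma cabs_sqr z : cabs z ^+ 2 = complex.Re z ^+ 2 + complex.Im z ^+ 2.
Proof. by case: z => a b; rewrite /cabs normc_def /= sqr_sqrtr // addr_ge0 ?sqr_ge0. Qed.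

Lemma Re_le_cabs z : `|complex.Re z| <= cabs z.
Proof.
rewrite -[leRHS](ger0_norm (cabs_ge0 z)) -ler_sqr ?nnegrE // !real_normK ?num_real //.
by rewrite cabs_sqr lerDl sqr_ge0.
Qed.

Lemma Im_le_cabs z : `|complex.Im z| <= cabs z.
Proof.
rewrite -[leRHS](ger0_norm (cabs_ge0 z)) -ler_sqr ?nnegrE // !real_normK ?num_real //.
by rewrite cabs_sqr lerDr sqr_ge0.
Qed.

Lemma cabs_le_ReIm z : cabs z <= `|complex.Re z| + `|complex.Im z|.
Proof.
have -> : z = ((complex.Re z)%:C)%C + 'i * ((complex.Im z)%:C)%C by rewrite [LHS]complexE.
apply: le_trans (cabsD _ _) _.
rewrite cabsM !cabs_real.
have -> : cabs 'i = 1 by rewrite /cabs normCi.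
rewrite mul1r /=; case: z => a b; rewrite /= !(mul0r, mulr0, mul1r, subr0, addr0, add0r).
by [].
Qed.

Lemma cabs_lt_eq0 z : (forall e : R, 0 < e -> cabs z <= e) -> z = 0.
Proof.
move=> h; apply/eqP; rewrite -cabs_eq0 eq_le cabs_ge0 andbT.
by apply/ler_addgt0Pl => e e0; rewrite addr0 h.
Qed.

End ComplexAbs.

Section ComplexExp.
Variable R : realType.
Implicit Types (z w : R[i]) (x y a b : R).

Lemma cexpD z w : cexp (z + w) = cexp z * cexp w.
Proof.
case: z w => a b [c d]; rewrite /cexp /= expRD cosD sinD rmorphM /=.
rewrite mulrACA; congr (_ * _); simpc; congr (_ +i* _)%C; ring.
Qed.

Lemma cexp0 : cexp (0 : R[i]) = 1.
Proof. by rewrite /cexp /= expR0 cos0 sin0 mul1r. Qed.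

Lemma cexpN z : cexp z * cexp (- z) = 1.
Proof. by rewrite -cexpD subrr cexp0. Qed.

Lemma cabs_cexp z : cabs (cexp z) = expR (complex.Re z).
Proof.
rewrite /cexp cabsM cabs_real ger0_norm ?expR_ge0 //.
by rewrite /cabs normc_def /= cos2Dsin2 sqrtr1 mulr1.
Qed.

Lemma cexp_neq0 z : cexp z != 0.
Proof. by rewrite -cabs_gt0 cabs_cexp expR_gt0. Qed.

Lemma cexp_periodic (m : int) : cexp (0 +i* (2 * pi * m%:~R) : R[i])%C = 1.
Proof.
have h (n : nat) : cexp (0 +i* (2 * pi * n%:R) : R[i])%C = 1.
  rewrite /cexp /= expR0 mul1r.
  have -> : 2 * pi * n%:R = 0 + (pi *+ 2) *+ n :> R.
    by rewrite add0r -[RHS]mulr_natr -[pi *+ 2]mulr_natr; ring.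
  by rewrite (periodicn (@cosD2pi R)) (periodicn (@sinD2pi R)) cos0 sin0.
case: m => n; first exact: h.
rewrite NegzE mulrNz mulrN.
have := cexpN (0 +i* (2 * pi * n.+1%:R) : R[i])%C; rewrite h mul1r => <-.
by congr cexp; apply/eqP; rewrite eq_complex /= oppr0 !eqxx.
Qed.

Lemma sin_le_abs x : `|sin x| <= `|x|.
Proof.
wlog x0 : x / 0 <= x.
  move=> h; have [x0|x0] := leP 0 x; first exact: h.
  by rewrite -normrN -sinN -(normrN x); apply: h; rewrite oppr_ge0 ltW.
have [|c _] := @MVT_segment R sin cos 0 x x0.
  by apply: continuous_subspaceT; exact: continuous_sin.
rewrite sin0 !subr0 => ->; rewrite normrM -[leRHS]mul1r.
by apply: ler_wpM2r => //; exact: cos_max.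
Qed.

Lemma cos_sub1 x : `|cos x - 1| <= x ^+ 2 / 2.
Proof.
have -> : cos x - 1 = - (2 * sin (x / 2) ^+ 2).
  have {1}-> : x = (x / 2) *+ 2 by rewrite -mulr_natr -mulrA mulVf ?mulr1 // pnatr_eq0.
  by rewrite cos_mulr2n sin2cos2 -mulr_natr; ring.
rewrite normrN normrM normrX ger0_norm //.
have := sin_le_abs (x / 2).
rewrite -(@ler_pXn2r _ 2%N) ?nnegrE // [in leRHS]real_normK ?num_real // => h.
apply: le_trans (ler_wpM2l _ h) _ => //.
by rewrite le_eqVlt; apply/orP; left; apply/eqP; field.
Qed.

Lemma cos_sub1_abs x : `|cos x - 1| <= `|x|.
Proof.
have [h|h] := leP `|x| 2.
  apply: le_trans (cos_sub1 x) _; rewrite -[x ^+ 2]real_normK ?num_real //.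
  have := normr_ge0 x; nra.
apply: le_trans (ler_normB _ _) _; rewrite normr1; have := cos_max x; lra.
Qed.

Lemma sin_sub_abs x : `|sin x - x| <= x ^+ 2.
Proof.
wlog x0 : x / 0 <= x.
  move=> h; have [x0|x0] := leP 0 x; first exact: h.
  rewrite -normrN opprB addrC -[x in - sin x]opprK sinN opprK -sqrrN.
  by have := h (- x); rewrite opprK; apply; rewrite oppr_ge0 ltW.
have [|c cx] := @MVT_segment R (fun x => sin x - x) (fun x => cos x - 1) 0 x x0.
  by apply: continuous_subspaceT => y; apply: cvgB; [exact: continuous_sin|exact: cvg_id].
rewrite sin0 !subr0 => ->; rewrite normrM expr2 (ger0_norm x0).
apply: ler_wpM2r => //; apply: le_trans (cos_sub1_abs c) _.
by move: cx; rewrite in_itv /= => /andP[c0 cx]; rewrite ger0_norm.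
Qed.

Lemma expR_sub1 a : `|expR a - 1| <= `|a| * expR `|a|.
Proof.
have h1 := expR_ge1Dx a; have h2 := expR_ge1Dx (- a).
have e0 := expR_gt0 a; have := expRxMexpNx_1 a => h3.
have [a0|a0] := leP 0 a.
  rewrite (ger0_norm a0) ger0_norm; nra.
rewrite (ltr0_norm a0) ler0_norm; last by rewrite subr_le0 ltW // expR_lt1.
have := expR_ge1Dx (- a); nra.
Qed.

Lemma expR_sub1D a : `|expR a - 1 - a| <= a ^+ 2 * expR `|a|.
Proof.
have h1 := expR_ge1Dx a; have h2 := expR_ge1Dx (- a).
have e0 := expR_gt0 a; have := expRxMexpNx_1 a => h3.
rewrite ger0_norm; last lra.
have h4 : expR a - 1 - a <= a * (expR a - 1) by nra.
apply: le_trans h4 _.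
apply: le_trans (ler_norm _) _; rewrite normrM -[a ^+ 2]real_normK ?num_real // expr2 -mulrA.
by apply: ler_wpM2l => //; exact: expR_sub1.
Qed.

(** The two estimates below are the only differential information on the
    exponential that the theta series need: a first-order expansion with an
    explicit quadratic remainder. *)
Lemma cexp_sub1D z : cabs (cexp z - 1 - z) <= 3 * cabs z ^+ 2 * expR (cabs z).
Proof.
case: z => a b; set z := (a +i* b)%C.
have -> : cexp z - 1 - z =
  ((expR a - 1 - a + expR a * (cos b - 1)) +i* (expR a * (sin b - b) + (expR a - 1) * b))%C.
  by rewrite /cexp /z /=; simpc; congr (_ +i* _)%C; ring.
apply: le_trans (cabs_le_ReIm _) _ => /=.
have ea : expR a <= expR (cabs z) by rewrite ler_expR; apply: le_trans (ler_norm _) (Re_le_cabs z).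
have eA : expR `|a| <= expR (cabs z) by rewrite ler_expR; exact: (Re_le_cabs z).
have zE : cabs z ^+ 2 = a ^+ 2 + b ^+ 2 by rewrite cabs_sqr.
have a1 := expR_sub1D a; have a2 := expR_sub1 a.
have b1 := cos_sub1 b; have b2 := sin_sub_abs b.
have e0 := expR_gt0 a; have E0 := expR_gt0 (cabs z).
rewrite zE; set E := expR (cabs z) in ea eA E0 *.
have c1 : `|expR a - 1 - a| <= a ^+ 2 * E.
  by apply: le_trans a1 _; apply: ler_wpM2l => //; exact: sqr_ge0.
have c2 : `|expR a * (cos b - 1)| <= E * (b ^+ 2 / 2).
  by rewrite normrM (gtr0_norm e0); apply: ler_pM => //; exact: ltW.
have c3 : `|expR a * (sin b - b)| <= E * b ^+ 2.
  by rewrite normrM (gtr0_norm e0); apply: ler_pM => //; exact: ltW.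
have c4 : `|(expR a - 1) * b| <= `|a| * E * `|b|.
  rewrite normrM; apply: ler_wpM2r => //; apply: le_trans a2 _.
  by apply: ler_wpM2l.
have c5 : `|a| * `|b| <= (a ^+ 2 + b ^+ 2) / 2.
  rewrite -[a ^+ 2]real_normK ?num_real // -[b ^+ 2]real_normK ?num_real //.
  have := sqr_ge0 (`|a| - `|b|); rewrite sqrrB; lra.
have c6 : `|a| * E * `|b| <= (a ^+ 2 + b ^+ 2) / 2 * E.
  by rewrite mulrAC; apply: ler_wpM2r => //; exact: ltW.
apply: le_trans (lerD (ler_normD _ _) (ler_normD _ _)) _.
have := sqr_ge0 a; have := sqr_ge0 b; nra.
Qed.

Lemma cexp_sub1 z : cabs (cexp z - 1) <= cabs z * (1 + 3 * cabs z * expR (cabs z)).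
Proof.
have -> : cexp z - 1 = (cexp z - 1 - z) + z by rewrite subrK.
apply: le_trans (cabsD _ _) _.
apply: le_trans (lerD (cexp_sub1D z) (lexx _)) _.
by rewrite le_eqVlt; apply/orP; left; apply/eqP; ring.
Qed.

End ComplexExp.

(** * Unordered sums of complex numbers *)
Section UnorderedSums.
Variables (R : realType).

Definition has_sum (I : choiceType) (t : I -> R[i]) (s : R[i]) :=
  forall e : R, 0 < e -> exists A : {fset I}, forall B : {fset I},
    (A `<=` B)%fset -> cabs (\sum_(i <- B) t i - s) < e.

Definition abs_summable (I : choiceType) (t : I -> R[i]) :=
  exists K : R, forall B : {fset I}, \sum_(i <- B) cabs (t i) <= K.

(** Under has_sum the limit along finite subsets is unique, so this total
    operator computes the sum of every absolutely summable family. *)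
Definition tsum (I : choiceType) (t : I -> R[i]) : R[i] :=
  summability.sum (t : I -> R[i]^o).

Section Indexed.
Variable I : choiceType.
Implicit Types (t : I -> R[i]) (s : R[i]).

Lemma has_sumD t s t' s' : has_sum t s -> has_sum t' s' ->
  has_sum (fun i => t i + t' i) (s + s').
Proof.
move=> h h' e e0; have e2 : 0 < e / 2 by rewrite divr_gt0.
have [A hA] := h _ e2; have [A' hA'] := h' _ e2.
exists (A `|` A')%fset => B; rewrite fsubUset => /andP[/hA h1 /hA' h2].
rewrite big_split /= opprD addrACA; apply: le_lt_trans (cabsD _ _) _; lra.
Qed.

Lemma has_sumZ a t s : has_sum t s -> has_sum (fun i => a * t i) (a * s).
Proof.
move=> h e e0; have a1 : 0 < cabs a + 1 by rewrite ltr_wpDl ?cabs_ge0.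
have [A hA] := h _ (divr_gt0 e0 a1).
exists A => B /hA; rewrite -mulr_sumr -mulrBr cabsM ltr_pdivlMr // => h1.
have := cabs_ge0 a; have := cabs_ge0 (\sum_(i <- B) t i - s); nra.
Qed.

Lemma has_sum_bound t s (K : R) : has_sum t s ->
  (forall B : {fset I}, \sum_(i <- B) cabs (t i) <= K) -> cabs s <= K.
Proof.
move=> h hK; apply/ler_addgt0Pr => e e0; have [A hA] := h _ e0.
have := hA A (fsubset_refl _); have := cabsD (\sum_(i <- A) t i) (s - \sum_(i <- A) t i).
rewrite addrC subrK cabsC; have := cabs_sum (enum_fset A) predT t.
have := hK A => h1 h2 h3 h4; apply: le_trans h3 _; apply: lerD; last exact: ltW.
exact: le_trans h2 h1.
Qed.

Lemma real_sum_exists (M : I -> R) (K : R) : (forall i, 0 <= M i) ->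
  (forall B : {fset I}, \sum_(i <- B) M i <= K) ->
  exists S : R, forall e : R, 0 < e -> exists A : {fset I}, forall B : {fset I},
    (A `<=` B)%fset -> `|\sum_(i <- B) M i - S| < e.
Proof.
move=> M0 hK; pose E := [set x : R | exists B : {fset I}, x = \sum_(i <- B) M i].
have supE : has_sup E.
  split; first by exists (\sum_(i <- fset0) M i), fset0.
  by exists K => _ [B ->].
exists (sup E) => e e0; have [_ [A ->] hA] := sup_adherent e0 supE.
exists A => B AB; have hB : \sum_(i <- B) M i <= sup E.
  by apply: ub_le_sup; [exact: supE.2|exists B].
have : \sum_(i <- A) M i <= \sum_(i <- B) M i.
  rewrite (big_fsetID _ (mem A) B) /= -[X in X <= _]addr0; apply: lerD; last exact: sumr_ge0.
  have -> : [fset x | x in B & x \in A]%fset = A; last exact: lexx.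
  by apply/fsetP => x; rewrite !inE /= andbC; case: (boolP (x \in A)) => //= /(fsubsetP AB).
rewrite ler0_norm ?subr_le0 // => h; lra.
Qed.

(** Both f + M and M have nonnegative terms and bounded partial sums. *)
Lemma real_dominated_sum_exists (f M : I -> R) (K : R) : (forall i, `|f i| <= M i) ->
  (forall B : {fset I}, \sum_(i <- B) M i <= K) ->
  exists S : R, forall e : R, 0 < e -> exists A : {fset I}, forall B : {fset I},
    (A `<=` B)%fset -> `|\sum_(i <- B) f i - S| < e.
Proof.
move=> fM hK; have M0 i : 0 <= M i by apply: le_trans (fM i).
have f2 i : 0 <= f i + M i by have := fM i; rewrite ler_norml => /andP[]; lra.
have [S1 h1] := real_sum_exists M0 hK.
have hK2 (B : {fset I}) : \sum_(i <- B) (f i + M i) <= K + K.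
  rewrite big_split /=; apply: lerD => //.
  by apply: le_trans (hK B); apply: ler_sum => i _; apply: le_trans (fM i); exact: ler_norm.
have [S2 h2] := real_sum_exists f2 hK2.
exists (S2 - S1) => e e0; have e2 : 0 < e / 2 by rewrite divr_gt0.
have [A hA] := h1 _ e2; have [A' hA'] := h2 _ e2.
exists (A `|` A')%fset => B; rewrite fsubUset => /andP[/hA h3 /hA'].
rewrite big_split /= => h4.
have -> : \sum_(i <- B) f i - (S2 - S1) = (\sum_(i <- B) f i + \sum_(i <- B) M i - S2) -
   (\sum_(i <- B) M i - S1) by ring.
apply: le_lt_trans (ler_normB _ _) _; lra.
Qed.

Lemma has_sum_exists t : abs_summable t -> exists s, has_sum t s.
Proof.
move=> [K hK].
have [S1 h1] := real_dominated_sum_exists (fun i => Re_le_cabs (t i)) hK.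
have [S2 h2] := real_dominated_sum_exists (fun i => Im_le_cabs (t i)) hK.
exists (S1 +i* S2)%C => e e0; have e2 : 0 < e / 2 by rewrite divr_gt0.
have [A hA] := h1 _ e2; have [A' hA'] := h2 _ e2.
exists (A `|` A')%fset => B; rewrite fsubUset => /andP[/hA h3 /hA' h4].
apply: le_lt_trans (cabs_le_ReIm _) _; rewrite !raddfB !raddf_sum /=; lra.
Qed.

Lemma has_sum_tsum t s : has_sum t s -> tsum t = s.
Proof.
move=> h; rewrite /tsum /summability.sum.
have totF : ProperFilter (@summability.totally I) := summability.totally_filter.
apply: (@cvg_lim (R[i]^o : normedModType R[i])); first exact: norm_hausdorff.
apply/cvgrPdist_lt => e e0.
have eE : e = ((complex.Re e)%:C)%C by rewrite RRe_real // realE ltW.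
have e1 : 0 < complex.Re e by rewrite -ltcR -eE.
have [A hA] := h _ e1; exists A => // B /= /hA h1.
rewrite eE /summability.partial_sum -(big_seq_fsetE (+%R) B xpredT t) /=.
by rewrite cabsE ltcR cabsC.
Qed.

Lemma tsumP t : abs_summable t -> has_sum t (tsum t).
Proof. by move=> /has_sum_exists[s hs]; rewrite (has_sum_tsum hs). Qed.

Lemma tsum_bound t (K : R) : (forall B : {fset I}, \sum_(i <- B) cabs (t i) <= K) ->
  cabs (tsum t) <= K.
Proof.
move=> hK; have ts : abs_summable t by exists K.
exact: has_sum_bound (tsumP ts) hK.
Qed.

Lemma abs_summable_le t (M : I -> R) (K : R) : (forall i, cabs (t i) <= M i) ->
  (forall B : {fset I}, \sum_(i <- B) M i <= K) -> abs_summable t.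
Proof.
by move=> tM hK; exists K => B; apply: le_trans (hK B); apply: ler_sum => i _.
Qed.

Lemma tsum_bound_le t (M : I -> R) (K : R) : (forall i, cabs (t i) <= M i) ->
  (forall B : {fset I}, \sum_(i <- B) M i <= K) -> cabs (tsum t) <= K.
Proof.
by move=> tM hK; apply: tsum_bound => B; apply: le_trans (hK B); apply: ler_sum => i _.
Qed.

Lemma tsumD t t' : abs_summable t -> abs_summable t' ->
  tsum (fun i => t i + t' i) = tsum t + tsum t'.
Proof. by move=> h h'; apply: has_sum_tsum; apply: has_sumD; apply: tsumP. Qed.

Lemma tsumZ a t : abs_summable t -> tsum (fun i => a * t i) = a * tsum t.
Proof. by move=> h; apply: has_sum_tsum; apply: has_sumZ; apply: tsumP. Qed.

Lemma has_sum0 : has_sum (fun _ : I => 0) 0.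
Proof. by move=> e e0; exists fset0 => B _; rewrite big1 // subr0 cabs0. Qed.

Lemma tsum_fin (J : Type) (r : seq J) (P : pred J) (t : J -> I -> R[i]) :
  (forall j, abs_summable (t j)) ->
  tsum (fun i => \sum_(j <- r | P j) t j i) = \sum_(j <- r | P j) tsum (t j).
Proof.
move=> h; apply: has_sum_tsum; elim: r => [|j r IH].
  rewrite big_nil (_ : (fun _ => _) = fun=> 0); first exact: has_sum0.
  by apply: funext => i; rewrite big_nil.
rewrite big_cons (_ : (fun _ => _) =
   (fun i => (if P j then t j i else 0) + \sum_(j <- r | P j) t j i)); last first.
  by apply: funext => i; rewrite big_cons; case: ifP => //; rewrite add0r.
case: ifP => Pj; first by apply: has_sumD => //; exact: tsumP.
by rewrite -[X in has_sum _ X]add0r; apply: has_sumD => //; exact: has_sum0.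
Qed.

Lemma abs_summableZ a t : abs_summable t -> abs_summable (fun i => a * t i).
Proof.
move=> [K hK]; exists (cabs a * K) => B.
under eq_bigr => i _ do rewrite cabsM.
by rewrite -mulr_sumr ler_wpM2l ?cabs_ge0.
Qed.

Lemma abs_summableD t t' : abs_summable t -> abs_summable t' ->
  abs_summable (fun i => t i + t' i).
Proof.
move=> [K hK] [K' hK']; exists (K + K') => B.
apply: le_trans (lerD (hK B) (hK' B)); rewrite -big_split.
by apply: ler_sum => i _; exact: cabsD.
Qed.

End Indexed.

Lemma tsum_reindex (I J : choiceType) (f : I -> J) (g : J -> I) (t : J -> R[i]) :
  cancel f g -> cancel g f -> abs_summable t -> tsum (t \o f) = tsum t.
Proof.
move=> fK gK ts; apply: has_sum_tsum => e e0.
have [A hA] := tsumP ts e0.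
exists (g @` A)%fset => B AB.
have := hA (f @` B)%fset; rewrite big_imfset /=; last by move=> x y _ _ /(can_inj fK).
apply; apply/fsubsetP => x xA; apply/imfsetP; exists (g x) => //=.
by apply: (fsubsetP AB); apply/imfsetP; exists x.
Qed.

End UnorderedSums.

(** * Roots of unity and the Fejer kernel *)
Section Cis.
Variable R : realType.
Implicit Types (t x : R).

(** The character t |-> exp(2 pi i t) of R/Z. *)
Definition cis t : R[i] := cexp (0 +i* (2 * pi * t))%C.

Lemma cisE t : cis t = (cos (2 * pi * t) +i* sin (2 * pi * t))%C.
Proof. by rewrite /cis /cexp /= expR0 mul1r. Qed.

Lemma cisD t x : cis (t + x) = cis t * cis x.
Proof. by rewrite /cis -cexpD; congr cexp; simpc; congr (_ +i* _)%C; ring. Qed.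

Lemma cis0 : cis 0 = 1.
Proof. by rewrite cisE mulr0 cos0 sin0. Qed.

Lemma cabs_cis t : cabs (cis t) = 1.
Proof. by rewrite /cis cabs_cexp /= expR0. Qed.

Lemma cis_int (n : int) : cis n%:~R = 1.
Proof. exact: cexp_periodic. Qed.

Lemma cis_conj t : (cis (- t)) = (cis t)^*%C.
Proof. by rewrite !cisE mulrN cosN sinN. Qed.

Lemma cisDint t (n : int) : cis (t + n%:~R) = cis t.
Proof. by rewrite cisD cis_int mulr1. Qed.

Lemma cis_sum (I : Type) (r : seq I) (P : pred I) (f : I -> R) :
  cis (\sum_(i <- r | P i) f i) = \prod_(i <- r | P i) cis (f i).
Proof. by rewrite (big_morph _ cisD cis0). Qed.

Lemma cisMn t n : cis (t * n%:R) = cis t ^+ n.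
Proof.
elim: n => [|n IH]; first by rewrite mulr0 cis0 expr0.
by rewrite -addn1 natrD mulrDr mulr1 cisD IH addn1 exprSr.
Qed.

Lemma cabs_1Bcis t : cabs (1 - cis t) ^+ 2 = 2 - 2 * cos (2 * pi * t).
Proof.
rewrite cabs_sqr cisE /=; have := cos2Dsin2 (2 * pi * t).
set c := cos _; set s := sin _ => h; rewrite sub0r sqrrN.
have -> : s ^+ 2 = 1 - c ^+ 2 by rewrite -h; ring.
ring.
Qed.

(** |1 - exp(2 pi i t)| serves as the distance of t to the integers: it is
    periodic, and it is bounded below away from them. *)
Lemma cis_away_from_int (d : R) : 0 < d -> exists2 k : R, 0 < k &
  forall t, d <= `|t| -> `|t| <= 1 / 2 -> k <= cabs (1 - cis t) ^+ 2.
Proof.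
move=> d0; have [d2|d2] := leP d (1 / 2); last first.
  by exists 1 => // t h1 h2; have := le_trans h1 h2; rewrite leNgt d2.
have p0 := @pi_gt0 R.
have dpi : 2 * pi * d <= pi by nra.
have inI (u : R) : 0 <= u -> u <= 1 / 2 -> (2 * pi * u \in `[0, pi]%R).
  by move=> u0 u2; rewrite in_itv /=; apply/andP; split; nra.
have cos_lt (u u' : R) : 0 <= u -> u < u' -> u' <= 1 / 2 ->
    cos (2 * pi * u') < cos (2 * pi * u).
  move=> u0 uu' u'2; rewrite ltr_cos ?inI //.
  - by rewrite ltr_pM2l // mulr_gt0.
  - by rewrite (le_trans _ u'2) // ltW.
  - by rewrite (le_trans u0) // ltW.
exists (2 - 2 * cos (2 * pi * d)).
  by have := cos_lt 0 d (lexx 0) d0 d2; rewrite mulr0 cos0; lra.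
move=> t h1 h2; rewrite cabs_1Bcis.
have -> : cos (2 * pi * t) = cos (2 * pi * `|t|).
  by rewrite -[in LHS]cos_norm normrM ger0_norm // mulr_ge0 // ltW.
suff : cos (2 * pi * `|t|) <= cos (2 * pi * d) by lra.
have [->|ne] := eqVneq `|t| d; first exact: lexx.
by apply/ltW/cos_lt; rewrite ?(ltW d0) // lt_neqAle eq_sym ne.
Qed.

Lemma near_int t : exists n : int, `|t - n%:~R| <= 1 / 2.
Proof.
exists (Num.floor (t + 1 / 2)).
have h1 := Num.Theory.floor_le (t + 1 / 2); have := Num.Theory.floorD1_gt (t + 1 / 2).
rewrite intrD1 => h2; rewrite ler_norml; apply/andP; split; lra.
Qed.

Lemma cis_eq1 t : cis t = 1 -> exists n : int, t = n%:~R.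
Proof.
move=> t1; have [n hn] := near_int t; exists n; apply/eqP; rewrite -subr_eq0 -normr_le0 leNgt.
apply/negP => /cis_away_from_int[k k0 /(_ _ (lexx _) hn)].
by rewrite -mulrNz cisDint t1 subrr cabs0 expr0n /= leNgt k0.
Qed.

Lemma sum_cis_ord (N : nat) (k : int) : (`|k| < N.+1)%N -> k != 0 ->
  \sum_(j < N.+1) cis (k%:~R * (j%:R / N.+1%:R)) = 0.
Proof.
move=> kN k0; set w := cis (k%:~R / N.+1%:R).
have N0 : N.+1%:R != 0 :> R by rewrite pnatr_eq0.
have -> : \sum_(j < N.+1) cis (k%:~R * (j%:R / N.+1%:R)) = \sum_(j < N.+1) w ^+ j.
  by apply: eq_bigr => j _; rewrite -cisMn mulrCA mulrC.
have wN : w ^+ N.+1 = 1 by rewrite -cisMn mulfVK // cis_int.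
have w1 : w - 1 != 0.
  rewrite subr_eq0; apply/eqP => /cis_eq1[n /(congr1 ( *%R^~ N.+1%:R))].
  rewrite mulfVK // -[N.+1%:R]/(N.+1%:Z%:~R) -intrM => /eqP; rewrite eqr_int => /eqP kE.
  have : n != 0 by apply: contra k0 => /eqP n0; rewrite kE n0 mul0r.
  move: kN; rewrite kE abszM /= -[(`|n|)%N]prednK ?absz_gt0; last first.
    by apply: contra k0 => /eqP n0; rewrite kE n0 mul0r.
  by rewrite mulSn ltnNge leq_addr.
have := subrX1 w N.+1; rewrite wN subrr => /eqP; rewrite eq_sym mulf_eq0 (negPf w1) /=.
by move/eqP.
Qed.

End Cis.

Section Fejer.
Variable R : realType.

(** The Fejer kernel written as a square, so that positivity is immediate; its
    expansion fejerE is a trigonometric polynomial with frequencies below M. *)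
Definition fejer (M : nat) (t : R) : R := cabs (\sum_(a < M) cis (a%:R * t)) ^+ 2 / M%:R.

Lemma fejer_ge0 M t : 0 <= fejer M t.
Proof. by rewrite /fejer divr_ge0 // sqr_ge0. Qed.

Lemma fejerE M t : ((fejer M t)%:C)%C =
  M%:R^-1 * \sum_(p : 'I_M * 'I_M) cis ((p.1%:R - p.2%:R) * t).
Proof.
rewrite /fejer rmorphM /= fmorphV rmorph_nat mulrC; congr (_ * _).
rewrite rmorphXn /= -cabsE normCK -(pair_bigA _ (fun a b : 'I_M => cis ((a%:R - b%:R) * t))) /=.
rewrite mulr_suml; apply: eq_bigr => a _; rewrite rmorph_sum mulr_sumr.
apply: eq_bigr => b _; rewrite /= -[X in _ * X]cis_conj -cisD; congr cis; ring.
Qed.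

(** Grid means compute the constant Fourier coefficient exactly when the grid
    has at least M points, since all frequencies are then below its order. *)
Lemma fejer_mean (M N : nat) (x : R) : (0 < M)%N -> (M <= N.+1)%N ->
  N.+1%:R^-1 * \sum_(j < N.+1) fejer M (x - j%:R / N.+1%:R) = 1.
Proof.
move=> M0 MN; apply: (@complexI R); rewrite rmorphM /= rmorph_sum /=.
have N0 : N.+1%:R != 0 :> R[i] by rewrite pnatr_eq0.
have M0' : M%:R != 0 :> R[i] by rewrite pnatr_eq0 -lt0n.
under eq_bigr => j _ do rewrite fejerE.
rewrite -mulr_sumr exchange_big /=.
rewrite -(pair_bigA _ (fun a b : 'I_M => \sum_(j < N.+1) cis ((a%:R - b%:R) * (x - j%:R / N.+1%:R)))) /=.
have -> : \sum_(a < M) \sum_(b < M) \sum_(j < N.+1) cis ((a%:R - b%:R) * (x - j%:R / N.+1%:R)) =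
    \sum_(a < M) N.+1%:R.
  apply: eq_bigr => a _; rewrite (bigD1 a) //= [X in _ + X]big1 ?addr0 => [|b ba].
    under eq_bigr => j _ do rewrite subrr mul0r cis0.
    by rewrite sumr_const card_ord.
  have -> : \sum_(j < N.+1) cis ((a%:R - b%:R) * (x - j%:R / N.+1%:R)) =
     cis ((a%:R - b%:R) * x) * \sum_(j < N.+1) cis ((b%:Z - a%:Z)%:~R * (j%:R / N.+1%:R)).
    rewrite mulr_sumr; apply: eq_bigr => j _; rewrite -cisD intrB; congr cis.
    rewrite -![(Posz _)%:~R]/(_%:R); ring.
  rewrite sum_cis_ord ?mulr0 //.
    have := ltn_ord a; have := ltn_ord b; lia.
  by rewrite subr_eq0 eqz_nat; apply: contra ba => /eqP/val_inj ->.
rewrite sumr_const card_ord -[_ *+ M]mulr_natr fmorphV rmorph_nat; field.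
by apply/andP; split.
Qed.

(** The sum defining the kernel is geometric, so multiplication by
    |1 - exp(2 pi i t)|^2 leaves at most 4 / M: the kernel concentrates at the
    integers. *)
Lemma fejer_tail M t : (0 < M)%N -> fejer M t * cabs (1 - cis t) ^+ 2 <= 4 / M%:R.
Proof.
move=> M0; have M0' : 0 < M%:R :> R by rewrite ltr0n.
rewrite /fejer mulrAC ler_pM2r ?invr_gt0 // -exprMn -cabsM mulrC.
have -> : (1 - cis t) * \sum_(a < M) cis (a%:R * t) = 1 - cis (t * M%:R).
  have geom (w : R[i]) : 1 - w ^+ M = (1 - w) * \sum_(a < M) w ^+ a.
    by rewrite -opprB subrX1 -mulNr opprB.
  rewrite cisMn geom.
  by congr (_ * _); apply: eq_bigr => a _; rewrite mulrC cisMn.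
have h : cabs (1 - cis (t * M%:R)) <= 2.
  by apply: le_trans (cabsB _ _) _; rewrite cabs1 cabs_cis; lra.
have := cabs_ge0 (1 - cis (t * M%:R)); nra.
Qed.

End Fejer.

(** * Means over grids in the unit cube *)
Section GridMeans.
Variables (R : realType) (D : nat).
Local Notation C := R[i].
Implicit Types (x y : 'I_D -> R) (p q : 'I_D -> C) (N M : nat).

Definition shift (T : zmodType) (x : 'I_D -> T) (i : 'I_D) (s : T) : 'I_D -> T :=
  fun k => if k == i then x k + s else x k.

Definition cvec x : 'I_D -> C := fun k => ((x k)%:C)%C.

Definition gridpt N (j : {ffun 'I_D -> 'I_N.+1}) : 'I_D -> R :=
  fun k => (j k)%:R / N.+1%:R.

(** The mean over the points of the unit cube with coordinates j / (N+1): a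
    Riemann sum that stands in for the integral over the torus. *)
Definition gridmean (V : numFieldType) N (h : ('I_D -> R) -> V) : V :=
  (N.+1%:R^-1 ^+ D) * \sum_(j : {ffun 'I_D -> 'I_N.+1}) h (gridpt j).

Lemma gridmeanB (V : numFieldType) N (h h' : ('I_D -> R) -> V) :
  gridmean N (fun x => h x - h' x) = gridmean N h - gridmean N h'.
Proof. by rewrite /gridmean sumrB mulrBr. Qed.

Lemma gridmeanZ N (c : C) (h : ('I_D -> R) -> C) :
  gridmean N (fun x => c * h x) = c * gridmean N h.
Proof. by rewrite /gridmean -mulr_sumr mulrCA. Qed.

Lemma gridmean_sum (V : numFieldType) N (T : finType) (h : T -> ('I_D -> R) -> V) :
  gridmean N (fun x => \sum_t h t x) = \sum_t gridmean N (h t).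
Proof. by rewrite /gridmean exchange_big mulr_sumr. Qed.

Lemma gridwt_ge0 N : 0 <= (N.+1%:R^-1 : R) ^+ D.
Proof. by rewrite exprn_ge0 // invr_ge0. Qed.

Lemma gridmean_cabs N (h : ('I_D -> R) -> C) :
  cabs (gridmean N h) <= gridmean N (fun x => cabs (h x) : R).
Proof.
rewrite /gridmean cabsM cabsX cabsV cabs_nat; apply: ler_wpM2l; first exact: gridwt_ge0.
exact: cabs_sum.
Qed.

Lemma gridmean_le N (h h' : ('I_D -> R) -> R) :
  (forall x, (forall k, 0 <= x k <= 1) -> h x <= h' x) -> gridmean N h <= gridmean N h'.
Proof.
move=> hh; apply: ler_wpM2l; first exact: gridwt_ge0.
apply: ler_sum => j _; apply: hh => k; rewrite /gridpt divr_ge0 //=.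
by rewrite ler_pdivrMr ?ltr0n // mul1r ler_nat ltnW.
Qed.

Lemma gridmean_cst (V : numFieldType) N (v : V) : gridmean N (fun=> v) = v.
Proof.
rewrite /gridmean sumr_const card_ffun !card_ord -[v *+ _]mulr_natl mulrA natrX exprVn mulVf ?mul1r //.
Qed.

Lemma gridmean_prod N (f : 'I_D -> R -> R) :
  gridmean N (fun x => \prod_k f k (x k) : R) =
  \prod_k (N.+1%:R^-1 * \sum_(l < N.+1) f k (l%:R / N.+1%:R)).
Proof.
rewrite big_split /= prodr_const card_ord; congr (_ * _).
rewrite (bigA_distr_bigA (fun k (l : 'I_N.+1) => f k (l%:R / N.+1%:R))).
by apply: eq_bigr => j _; apply: eq_bigr => k _.
Qed.

(** A step of the grid permutes its points cyclically; the point that leaves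
    the cube comes back because h has period 1. *)
Lemma gridmean_shift (V : numFieldType) N (h : ('I_D -> R) -> V) i :
  (forall x, h (shift x i 1) = h x) ->
  gridmean N (fun x => h (shift x i N.+1%:R^-1)) = gridmean N h.
Proof.
move=> hper; rewrite /gridmean; congr (_ * _).
pose nx (j : {ffun 'I_D -> 'I_N.+1}) := [ffun k => if k == i then ordS (j k) else j k].
have nx_inj : injective nx.
  move=> j j' /ffunP e; apply/ffunP => k; have := e k; rewrite !ffunE.
  by case: ifP => // _ /ordS_inj.
rewrite [RHS](reindex_inj nx_inj) /=; apply: eq_bigr => j _.
have [jl|jN] := ltnP (j i).+1 N.+1.
  congr h; apply/funext => k; rewrite /shift /gridpt /nx ffunE; case: eqP => // ->.
  by rewrite /= modn_small // -[(j i).+1%:R]natr1 mulrDl mul1r.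
rewrite -[RHS]hper; congr h; apply/funext => k; rewrite /shift /gridpt /nx ffunE; case: eqP => // ->.
have jiN : j i = N :> nat by apply/eqP; rewrite eqn_leq -ltnS ltn_ord -ltnS jN.
rewrite /= jiN modnn mul0r add0r -[X in _ + X]mul1r -mulrDl natr1 mulfV //.
Qed.

End GridMeans.

Section FejerGrid.
Variables (R : realType) (D : nat).
Local Notation C := R[i].

Definition fejerD M (t : 'I_D -> R) : R := \prod_k fejer M (t k).

Lemma fejerD_ge0 M t : 0 <= fejerD M t.
Proof. by apply: prodr_ge0 => k _; exact: fejer_ge0. Qed.

Lemma fejerD_mean M N (x : 'I_D -> R) : (0 < M)%N -> (M <= N.+1)%N ->
  gridmean N (fun y => fejerD M (fun k => x k - y k) : R) = 1.
Proof.
move=> M0 MN; rewrite (gridmean_prod N (fun k u => fejer M (x k - u))).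
by apply: big1 => k _; rewrite fejer_mean.
Qed.

Lemma fejerD_tail M N (x : 'I_D -> R) i : (0 < M)%N -> (M <= N.+1)%N ->
  gridmean N (fun y => fejerD M (fun k => x k - y k) * cabs (1 - cis (x i - y i)) ^+ 2 : R)
   <= 4 / M%:R.
Proof.
move=> M0 MN.
pose f k u := if k == i then fejer M (x k - u) * cabs (1 - cis (x k - u)) ^+ 2 else fejer M (x k - u).
have -> : (fun y => fejerD M (fun k => x k - y k) * cabs (1 - cis (x i - y i)) ^+ 2 : R) =
   (fun y => \prod_k f k (y k) : R).
  apply/funext => y; rewrite /fejerD (bigD1 i) //= [RHS](bigD1 i) //= [f i (y i)]/f eqxx.
  rewrite mulrAC; congr (_ * _); apply: eq_bigr => k ki; by rewrite /f (negPf ki).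
rewrite gridmean_prod (bigD1 i) //= [X in _ * X]big1 ?mulr1 => [|k ki].
  rewrite /f eqxx; rewrite -[leRHS]mul1r -[X in _ <= X * _](@mulVf _ N.+1%:R) ?pnatr_eq0 //.
  rewrite -mulrA; apply: ler_wpM2l; first by rewrite invr_ge0.
  apply: le_trans (ler_sum _ (fun l _ => fejer_tail _ M0)) _.
  by rewrite sumr_const card_ord -[leLHS]mulr_natl lexx.
by rewrite /f (negPf ki) fejer_mean.
Qed.

Definition freq M (p : {ffun 'I_D -> 'I_M * 'I_M}) : 'I_D -> int :=
  fun k => (p k).1%:Z - (p k).2%:Z.

Definition dotz (m : 'I_D -> int) (x : 'I_D -> R) : R := \sum_k (m k)%:~R * x k.

Lemma fejerD_expand M (x y : 'I_D -> R) :
  ((fejerD M (fun k => x k - y k))%:C)%C =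
  M%:R^-1 ^+ D * \sum_(p : {ffun 'I_D -> 'I_M * 'I_M})
     cis (dotz (freq p) x) * cis (- dotz (freq p) y).
Proof.
rewrite /fejerD rmorph_prod /=.
under eq_bigr => k _ do rewrite fejerE.
rewrite big_split /= prodr_const card_ord; congr (_ * _).
rewrite (bigA_distr_bigA (fun k (p : 'I_M * 'I_M) => cis ((p.1%:R - p.2%:R) * (x k - y k)))).
apply: eq_bigr => p _; rewrite -cisD /dotz -sumrB cis_sum; apply: eq_bigr => k _.
by rewrite /freq intrB -mulrBr.
Qed.

End FejerGrid.

(** * Periodic holomorphic functions of several variables *)
Section QuasiPeriodic.
Variables (R : realType) (D : nat).
Local Notation C := R[i].
Implicit Types (x y : 'I_D -> R) (p q : 'I_D -> C) (N M : nat) (G : ('I_D -> C) -> C).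

(** A quantitative form of separate holomorphy: on every polydisc of radius K,
    a bound and a complex first-order expansion in each variable with uniform
    quadratic remainder. *)
Definition locally_holomorphic G := forall K : R, exists2 B : R, 0 <= B &
  forall q, (forall k, cabs (q k) <= K) -> cabs (G q) <= B /\
    forall i, exists2 L : C, cabs L <= B &
      forall s, cabs s <= 1 -> cabs (G (shift q i s) - G q - s * L) <= B * cabs s ^+ 2.

Definition int_periodic G := forall q i, G (shift q i 1) = G q.

(** Changing the coordinates of p into those of q one at a time reduces
    estimates in several variables to one variable. *)
Lemma coordinate_path (H : ('I_D -> C) -> C) (e : R) p q :
  (forall (n : 'I_D), cabs (H (fun k => if (k < n.+1)%N then q k else p k) -
                           H (fun k => if (k < n)%N then q k else p k)) <= e) ->
  cabs (H q - H p) <= e *+ D.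
Proof.
move=> h.
suff hn n : (n <= D)%N -> cabs (H (fun k => if (k < n)%N then q k else p k) - H p) <= e *+ n.
  have := hn D (leqnn _); rewrite (_ : (fun k => _) = q) //.
  by apply/funext => k; rewrite ltn_ord.
elim: n => [_|n IH nD].
  by rewrite (_ : (fun k => _) = p) ?subrr ?cabs0 // mulr0n.
apply: le_trans (cabs_tri (H (fun k => if (k < n)%N then q k else p k)) _ _) _.
rewrite mulrS; apply: lerD; first exact: (h (Ordinal nD)).
exact: IH (ltnW nD).
Qed.

Lemma path_step p q (n : 'I_D) :
  (fun k : 'I_D => if (k < n.+1)%N then q k else p k) =
  shift (fun k : 'I_D => if (k < n)%N then q k else p k) n (q n - p n).
Proof.
apply/funext => k; rewrite /shift ltnS leq_eqVlt; have [->|kn] := eqVneq k n.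
  by rewrite eqxx ltnn /= addrC subrK.
by rewrite val_eqE (negPf kn).
Qed.

Lemma int_periodicE G : int_periodic G -> forall q (m : 'I_D -> int),
  G (fun k => q k + (m k)%:~R) = G q.
Proof.
move=> per q m.
have per1 i (a : int) q' : G (shift q' i a%:~R) = G q'.
  have pn (n : nat) q1 : G (shift q1 i n%:R) = G q1.
    elim: n => [|n IH]; first by congr G; apply/funext => k; rewrite /shift addr0; case: ifP.
    rewrite -IH -(per (shift q1 i n%:R) i); congr G; apply/funext => k; rewrite /shift.
    by case: (k == i) => //; rewrite -natr1 addrA.
  case: a => n; first exact: pn.
  rewrite -(pn n.+1 (shift q' i _)); congr G; apply/funext => k; rewrite /shift.
  by case: (k == i) => //; rewrite NegzE mulrNz; exact: subrK.
apply/eqP; rewrite -subr_eq0; apply/eqP/cabs_lt_eq0 => e e0.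
apply: le_trans (_ : 0 *+ D <= e); last by rewrite mul0rn ltW.
apply: coordinate_path => n; rewrite path_step.
rewrite (_ : q n + (m n)%:~R - q n = (m n)%:~R); last by rewrite addrC addKr.
by rewrite per1 subrr cabs0.
Qed.

Lemma holomorphic_step G (K : R) : locally_holomorphic G -> exists2 B : R, 0 <= B &
  forall q i s, (forall k, cabs (q k) <= K) -> cabs s <= 1 ->
    cabs (G (shift q i s) - G q) <= B * cabs s.
Proof.
move=> hol; have [B B0 hB] := hol K; exists (B + B); first by rewrite addr_ge0.
move=> q i s qK s1; have [_ /(_ i)[L LB hL]] := hB q qK.
have := hL s s1; have := cabs_ge0 s => s0 h.
rewrite -(subrK (s * L) (_ - _)); apply: le_trans (cabsD _ _) _; rewrite cabsM.
have : cabs s * cabs L <= cabs s * B by apply: ler_wpM2l.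
have : B * cabs s ^+ 2 <= B * cabs s by rewrite expr2 ler_wpM2l // ler_piMr.
lra.
Qed.

Lemma holomorphic_lipschitz G (K : R) : locally_holomorphic G -> exists2 B : R, 0 <= B &
  forall p q (d : R), (forall k, cabs (p k) <= K) -> (forall k, cabs (q k) <= K) ->
    (forall k, cabs (q k - p k) <= d) -> d <= 1 -> cabs (G q - G p) <= B * d.
Proof.
move=> hol; have [B B0 hB] := holomorphic_step K hol.
exists (B *+ D); first by rewrite mulrn_wge0.
move=> p q d pK qK pq d1; rewrite mulrnAl; apply: coordinate_path => n.
rewrite path_step; apply: le_trans (hB _ _ _ _ _) _.
- by move=> k; case: ifP.
- exact: le_trans (pq n) d1.
- by apply: ler_wpM2l.
Qed.

(** The mean over the grid of step 1/(N+1), as a function of a complex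
    translation, is constant up to O(1/N): one grid step in a complex direction
    is, to second order, a multiple of one grid step in a real direction, which
    does not change the mean. This replaces a shift of contour. *)
Lemma gridmean_complex_shift1 G (K : R) : locally_holomorphic G -> int_periodic G ->
  exists2 B : R, 0 <= B & forall N p i c, (forall k, cabs (p k) <= K) -> cabs c <= K ->
    K <= N.+1%:R ->
    cabs (gridmean N (fun x => G (fun k => cvec x k + shift p i c k)) -
          gridmean N (fun x => G (fun k => cvec x k + p k))) <= B / N.+1%:R.
Proof.
move=> hol per; have [B B0 hB] := hol (1 + K + K).
have [K0|K0] := leP 0 K; last first.
  exists 0 => // N p i c pK cK; have := cabs_ge0 c; have := le_lt_trans cK K0; lra.
exists (B * (K ^+ 2 + K)); first by rewrite mulr_ge0 // addr_ge0 // sqr_ge0.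
move=> N p i c pK cK KN; set n1 : R := N.+1%:R; have n0 : 0 < n1 by rewrite ltr0n.
pose H (l : nat) := gridmean N (fun x => G (fun k => cvec x k + shift p i (c * (l%:R / N.+1%:R)) k)).
have HN : H N.+1 = gridmean N (fun x => G (fun k => cvec x k + shift p i c k)).
  by rewrite /H mulfV ?mulr1 // pnatr_eq0.
have H0 : H 0%N = gridmean N (fun x => G (fun k => cvec x k + p k)).
  rewrite /H mul0r mulr0; congr gridmean; apply/funext => x; congr G; apply/funext => k.
  by rewrite /shift addr0; case: ifP.
have cN0 : (N.+1%:R : C) != 0 by rewrite pnatr_eq0.
have n1E : cabs (N.+1%:R : C)^-1 = n1^-1 by rewrite cabsV cabs_nat.
have step l : (l < N.+1)%N -> cabs (H l.+1 - H l) <= B * (K ^+ 2 + K) / n1 ^+ 2.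
  move=> lN; pose q x k := cvec x k + shift p i (c * (l%:R / N.+1%:R)) k.
  have qK x : (forall k, 0 <= x k <= 1) -> forall k, cabs (q x k) <= 1 + K + K.
    move=> x01 k; have /andP[x0 x1] := x01 k; rewrite /q -addrA.
    apply: le_trans (cabsD _ _) _; rewrite cabs_real ger0_norm //; apply: lerD => //.
    rewrite /shift; case: ifP => _; last first.
      by apply: le_trans (pK k) _; rewrite lerDl.
    apply: le_trans (cabsD _ _) _; apply: lerD => //.
    rewrite !cabsM cabs_nat n1E; apply: le_trans (_ : K * 1 <= K); last by rewrite mulr1.
    apply: ler_pM; [exact: cabs_ge0|by rewrite divr_ge0 // ltW|exact: cK|].
    by rewrite ler_pdivrMr // mul1r ler_nat ltnW.
  have real_step : gridmean N (fun x => G (shift (q x) i N.+1%:R^-1)) = gridmean N (fun x => G (q x)).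
    rewrite -[RHS](@gridmean_shift _ _ _ _ _ i).
      congr gridmean; apply/funext => x; congr G; apply/funext => k; rewrite /q /shift /cvec.
      by case: (k == i) => //; rewrite rmorphD /= fmorphV rmorph_nat addrAC.
    move=> x; rewrite -(per (q x) i); congr G; apply/funext => k; rewrite /q /shift /cvec.
    by case: (k == i) => //; rewrite rmorphD /= addrAC.
  have -> : H l.+1 - H l = gridmean N (fun x => G (shift (q x) i (c / N.+1%:R)) - G (q x) -
      c * (G (shift (q x) i N.+1%:R^-1) - G (q x))).
    rewrite gridmeanB gridmeanZ !gridmeanB real_step subrr mulr0 subr0; congr (_ - _).
    congr gridmean; apply/funext => x; congr G; apply/funext => k; rewrite /q /shift.
    case: (k == i) => //; rewrite -natr1 mulrDl mulrDr mul1r !addrA //.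
  apply: le_trans (gridmean_cabs _ _) _.
  rewrite -[leRHS](@gridmean_cst R D R N); apply: gridmean_le => x /qK/hB[_ /(_ i)[L LB hL]].
  have nV1 : n1^-1 <= 1 by rewrite invf_le1 // ler1n.
  have h1 : cabs (c / N.+1%:R) <= 1.
    by rewrite cabsM n1E ler_pdivrMr // mul1r (le_trans cK).
  have h2 : cabs (N.+1%:R^-1 : C) <= 1 by rewrite n1E.
  have := hL _ h1; have := hL _ h2; rewrite cabsM n1E => a1 a2.
  set u := G (shift (q x) i (c / N.+1%:R)) in a2 *.
  set v := G (shift (q x) i N.+1%:R^-1) in a1 *.
  have -> : u - G (q x) - c * (v - G (q x)) =
     (u - G (q x) - c / N.+1%:R * L) - c * (v - G (q x) - N.+1%:R^-1 * L) by ring.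
  apply: le_trans (cabsB _ _) _; rewrite [in X in _ + X]cabsM.
  have c0 := cabs_ge0 c.
  have b1 : cabs c * cabs (v - G (q x) - N.+1%:R^-1 * L) <= K * (B * n1^-1 ^+ 2).
    by apply: ler_pM => //; exact: cabs_ge0.
  have b2 : B * (cabs c / n1) ^+ 2 <= B * (K / n1) ^+ 2.
    apply: ler_wpM2l => //; rewrite ler_pXn2r ?nnegrE ?divr_ge0 ?(ltW n0) //.
    by rewrite ler_pM2r // invr_gt0.
  apply: le_trans (lerD (le_trans a2 b2) b1) _.
  by rewrite le_eqVlt; apply/orP; left; apply/eqP; rewrite !exprMn exprVn; ring.
rewrite -HN -H0.
have tele l : (l <= N.+1)%N -> cabs (H l - H 0%N) <= (B * (K ^+ 2 + K) / n1 ^+ 2) *+ l.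
  elim: l => [_|l IH lN]; first by rewrite subrr cabs0 mulr0n.
  apply: le_trans (cabs_tri (H l) _ _) _; rewrite mulrS.
  by apply: lerD; [exact: step|exact: IH (ltnW lN)].
apply: le_trans (tele _ (leqnn _)) _; rewrite -mulr_natr -/n1.
by rewrite le_eqVlt; apply/orP; left; apply/eqP; field; rewrite gt_eqF.
Qed.

Lemma gridmean_complex_shift G p : locally_holomorphic G -> int_periodic G ->
  exists B : R, exists N0, forall N, (N0 <= N)%N ->
    cabs (gridmean N (fun x => G (fun k => cvec x k + p k)) -
          gridmean N (fun x => G (cvec x))) <= B / N.+1%:R.
Proof.
move=> hol per; pose K := \sum_k cabs (p k).
have pK k : cabs (p k) <= K.
  by rewrite /K (bigD1 k) //= lerDl sumr_ge0 // => i _; exact: cabs_ge0.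
have K0 : 0 <= K by apply: sumr_ge0 => k _; exact: cabs_ge0.
have [B B0 hB] := gridmean_complex_shift1 K hol per.
exists (B *+ D), (Num.truncn K) => N KN.
have {}KN : K <= N.+1%:R.
  have := truncnS_gt K => h; apply: le_trans (ltW h) _; by rewrite ler_nat ltnS.
pose H q := gridmean N (fun x => G (fun k => cvec x k + q k)).
have -> : gridmean N (fun x => G (cvec x)) = H (fun=> 0).
  by congr gridmean; apply/funext => x; congr G; apply/funext => k; rewrite addr0.
rewrite mulrnAl; apply: (@coordinate_path H) => n; rewrite path_step; apply: hB => //.
  by move=> k; case: ifP => // _; rewrite cabs0.
by rewrite subr0.
Qed.

End QuasiPeriodic.

(** * Uniqueness of quasi-periodic functions *)
Section Uniqueness.
Variables (R : realType) (D : nat).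
Local Notation C := R[i].
Implicit Types (x y : 'I_D -> R) (p q : 'I_D -> C) (N M : nat) (G : ('I_D -> C) -> C).

Lemma eventually_finType (T : finType) (P : T -> nat -> Prop) :
  (forall t, exists N0, forall N, (N0 <= N)%N -> P t N) ->
  exists N0, forall N, (N0 <= N)%N -> forall t, P t N.
Proof.
move=> /choice[f hf]; exists (\max_t f t) => N h t; apply: hf.
exact: leq_trans (leq_bigmax _) h.
Qed.

Lemma eventually_div (B e : R) : 0 < e ->
  exists N0, forall N, (N0 <= N)%N -> B / N.+1%:R <= e.
Proof.
move=> e0; exists (Num.truncn (B / e)) => N hN.
rewrite ler_pdivrMr ?ltr0n // mulrC -ler_pdivrMr //.
by apply: le_trans (ltW (truncnS_gt _)) _; rewrite ler_nat ltnS.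
Qed.

(** Near x modulo the integers, G varies by at most e; elsewhere the second
    term exceeds the bound of G. Measuring the distance by |1 - exp(2 pi i t)|
    makes both cases meet the same periodic expression. *)
Lemma periodic_modulus G x (e : R) : locally_holomorphic G -> int_periodic G -> 0 < e ->
  exists2 B : R, 0 <= B & forall y, (forall k, 0 <= y k <= 1) ->
    cabs (G (cvec y) - G (cvec x)) <= e + B * \sum_k cabs (1 - cis (x k - y k)) ^+ 2.
Proof.
move=> hol per e0; pose K := \sum_k `|x k| + 2.
have xK k : `|x k| <= \sum_k `|x k| by rewrite (bigD1 k) //= lerDl sumr_ge0.
have X0 : 0 <= \sum_k `|x k| by apply: sumr_ge0.
have [L L0 hL] := holomorphic_lipschitz K hol.
have [B B0 hB] := hol K.
pose d := Num.min 1 (e / (L + 1)).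
have L1 : 0 < L + 1 by rewrite ltr_wpDl.
have d0 : 0 < d by rewrite lt_min ltr01 divr_gt0.
have [k k0 hk] := cis_away_from_int d0.
exists ((B + B) / k); first by rewrite divr_ge0 ?addr_ge0 // ltW.
move=> y y01; have [m hm] := choice (fun k => near_int (x k - y k)).
pose S := \sum_k cabs (1 - cis (x k - y k)) ^+ 2.
have S0 : 0 <= S by apply: sumr_ge0 => i _; exact: sqr_ge0.
have xxK i : cabs (cvec x i) <= K.
  by rewrite cabs_real; apply: le_trans (xK i) _; rewrite lerDl.
have yK i : cabs (cvec y i) <= K.
  rewrite cabs_real; have /andP[y0 y1] := y01 i; rewrite ger0_norm // /K; lra.
have [far|near] := pselect (exists i, d < `|x i - y i - (m i)%:~R|).
  have [i hi] := far.
  have kS : k <= S.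
    have := hk _ (ltW hi) (hm i); rewrite -mulrNz cisDint => h.
    apply: le_trans h _; rewrite /S (bigD1 i) //= lerDl sumr_ge0 // => j _; exact: sqr_ge0.
  apply: le_trans (cabsB _ _) _.
  have h1 := (hB _ xxK).1; have h2 := (hB _ yK).1.
  apply: le_trans (lerD h2 h1) _.
  apply: le_trans (_ : (B + B) / k * S <= _); last by rewrite lerDr ltW.
  rewrite mulrAC ler_pdivlMr //; apply: ler_wpM2l => //; exact: addr_ge0.
have {}near i : `|x i - y i - (m i)%:~R| <= d.
  by rewrite leNgt; apply/negP => h; apply: near; exists i.
rewrite -(int_periodicE per (cvec y) m).
apply: le_trans (_ : e <= _); last first.
  by rewrite lerDl mulr_ge0 // divr_ge0 ?addr_ge0 // ltW.
have cE i : cvec y i + (m i)%:~R = ((y i + (m i)%:~R)%:C)%C.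
  by rewrite rmorphD /= rmorph_int.
have d1 : d <= 1 by rewrite ge_min lexx.
apply: le_trans (hL _ _ d _ _ _ _) _ => //.
- move=> i; rewrite cE cabs_real.
  have -> : y i + (m i)%:~R = x i - (x i - y i - (m i)%:~R) by ring.
  apply: le_trans (ler_normB _ _) _; rewrite /K; have := near i; have := xK i; lra.
- move=> i; rewrite cE /cvec -rmorphB /= cabs_real -normrN.
  by have -> : - (y i + (m i)%:~R - x i) = x i - y i - (m i)%:~R by ring.
- apply: le_trans (_ : L * (e / (L + 1)) <= e); first by rewrite ler_wpM2l // ge_min lexx orbT.
  rewrite mulrCA ger_pMr // ler_pdivrMr // mul1r; lra.
Qed.

Variables (E : ('I_D -> int) -> C) (Y : ('I_D -> int) -> 'I_D -> C).
Hypothesis E_neq0 : forall m, E m != 0.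

(** E is the constant part of the multiplier, common to all functions that
    are compared, and Y m the complex period attached to m. *)
Definition quasi_periodic G := forall m x,
  G (fun k => cvec x k + Y m k) = E m * cis (- dotz m x) * G (cvec x).

(** The Fejer mean at x of the Fourier series with coefficients 1/E. *)
Definition fejer_sum M x : C := M%:R^-1 ^+ D *
  \sum_(p : {ffun 'I_D -> 'I_M * 'I_M}) cis (dotz (freq p) x) * (E (freq p))^-1.

(** Translating the variable by Y m multiplies the integrand at frequency m by
    E m and turns it into G itself, and the mean hardly sees the translation:
    in the limit the coefficient at m is the one at 0 divided by E m. *)
Lemma fourier_ratio G m (e : R) : locally_holomorphic G -> int_periodic G -> quasi_periodic G ->
  0 < e -> exists N0, forall N, (N0 <= N)%N ->
    cabs (gridmean N (fun y => cis (- dotz m y) * G (cvec y)) -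
          gridmean N (fun y => G (cvec y)) / E m) <= e.
Proof.
move=> hol per quasi e0; have [B [N0 hB]] := gridmean_complex_shift (Y m) hol per.
have E0 : 0 < cabs (E m) by rewrite cabs_gt0.
have [N1 hN1] := eventually_div B (mulr_gt0 e0 E0).
exists (maxn N0 N1) => N; rewrite geq_max => /andP[/hB h1 /hN1 h2].
rewrite -(@ler_pM2r _ (cabs (E m))) // -cabsM mulrBl mulfVK //.
apply: le_trans h2; apply: le_trans h1; rewrite le_eqVlt; apply/orP; left; apply/eqP.
congr (cabs (_ - _)); rewrite mulrC -gridmeanZ; congr gridmean; apply/funext => y.
by rewrite quasi mulrA.
Qed.

(** By Fejer's theorem G(x) is approximated by Fejer means of its Fourier
    series, all of whose coefficients are multiples of the one at 0. *)
Lemma fejer_approximation G x (e : R) :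
  locally_holomorphic G -> int_periodic G -> quasi_periodic G -> 0 < e ->
  exists M0, forall M, (M0 < M)%N -> exists N0, forall N, (N0 <= N)%N ->
    cabs (G (cvec x) - gridmean N (fun y => G (cvec y)) * fejer_sum M x) <= e.
Proof.
move=> hol per quasi e0.
have e4 : 0 < e / 4 by rewrite divr_gt0.
have [B B0 hB] := periodic_modulus x hol per e4.
pose A := B * (4 *+ D); have A0 : 0 <= A by rewrite mulr_ge0 // mulrn_wge0.
have [M0 hM0] := eventually_div A e4.
exists M0 => M MM0; have Mgt0 : (0 < M)%N by apply: leq_trans MM0.
have AM : A / M%:R <= e / 4 by have := hM0 M.-1; rewrite prednK //; apply; rewrite -ltnS prednK.
pose T := {ffun 'I_D -> 'I_M * 'I_M}.
pose e' : R := e / 4 / (#|{: T}|%:R + 1).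
have T1 : 0 < #|{: T}|%:R + 1 :> R by rewrite ltr_wpDl.
have e'0 : 0 < e' by rewrite divr_gt0.
have [N1 hN1] := @eventually_finType T _ (fun t : T => fourier_ratio (freq t) hol per quasi e'0).
exists (maxn M N1) => N; rewrite geq_max => /andP[MN /hN1 hN].
pose W y := fejerD M (fun k => x k - y k).
have W0 y : 0 <= W y by exact: fejerD_ge0.
pose sigma := gridmean N (fun y => ((W y)%:C)%C * G (cvec y)).
have Wmean : gridmean N W = 1 by apply: fejerD_mean => //; exact: leq_trans MN _.
have cmean (h : ('I_D -> R) -> R) : gridmean N (fun y => ((h y)%:C)%C) = ((gridmean N h)%:C)%C.
  by rewrite /gridmean rmorphM rmorphXn /= fmorphV rmorph_nat rmorph_sum.
have s1 : cabs (G (cvec x) - sigma) <= e / 4 + e / 4.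
  have -> : G (cvec x) - sigma = gridmean N (fun y => ((W y)%:C)%C * (G (cvec x) - G (cvec y))).
    rewrite /sigma; transitivity (gridmean N (fun y => ((W y)%:C)%C) * G (cvec x) - sigma).
      by rewrite cmean Wmean mul1r.
    rewrite mulrC -gridmeanZ -gridmeanB; congr gridmean; apply/funext => y; ring.
  apply: le_trans (gridmean_cabs _ _) _.
  apply: le_trans (_ : gridmean N (fun y => e / 4 * W y + \sum_k B * (W y * cabs (1 - cis (x k - y k)) ^+ 2)) <= _).
    apply: gridmean_le => y y01; rewrite cabsM cabs_real ger0_norm // cabsC.
    apply: le_trans (ler_wpM2l (W0 y) (hB y y01)) _.
    rewrite mulrDr mulrC; apply: lerD => //.
    by rewrite mulrCA mulr_sumr mulr_sumr.
  have -> : gridmean N (fun y => e / 4 * W y + \sum_k B * (W y * cabs (1 - cis (x k - y k)) ^+ 2)) =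
     e / 4 * gridmean N W + \sum_k B * gridmean N (fun y => W y * cabs (1 - cis (x k - y k)) ^+ 2).
    rewrite /gridmean big_split /= mulrDr exchange_big /= -mulr_sumr mulrCA; congr (_ + _).
    rewrite mulr_sumr; apply: eq_bigr => k _; by rewrite -mulr_sumr mulrCA.
  rewrite Wmean mulr1; apply: lerD => //; apply: le_trans AM.
  rewrite /A -mulrA mulrnAl; rewrite -mulr_sumr; apply: ler_wpM2l => //.
  rewrite -[X in _ <= _ *+ X](card_ord D) -sumr_const; apply: ler_sum => k _.
  by apply: fejerD_tail => //; exact: leq_trans MN _.
have s2 : cabs (sigma - gridmean N (fun y => G (cvec y)) * fejer_sum M x) <= e / 4.
  have -> : sigma - gridmean N (fun y => G (cvec y)) * fejer_sum M x =
     M%:R^-1 ^+ D * \sum_(p : T) cis (dotz (freq p) x) *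
      (gridmean N (fun y => cis (- dotz (freq p) y) * G (cvec y)) -
          gridmean N (fun y => G (cvec y)) / E (freq p)).
    rewrite /fejer_sum mulrCA; under [in RHS]eq_bigr => p _ do rewrite mulrBr.
    rewrite sumrB mulrBr; congr (_ - _ * _); last first.
      rewrite mulr_sumr; apply: eq_bigr => p _; ring.
    rewrite /sigma; under eq_bigr => p _ do rewrite -gridmeanZ.
    rewrite -gridmean_sum -gridmeanZ; congr gridmean; apply/funext => y.
    rewrite fejerD_expand -mulrA mulr_suml; congr (_ * _); apply: eq_bigr => p _; ring.
  rewrite cabsM cabsX cabsV cabs_nat; apply: le_trans (_ : 1 * (e' * #|{: T}|%:R) <= _).
    apply: ler_pM; [by rewrite exprn_ge0 // invr_ge0|exact: cabs_ge0| |].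
      by rewrite exprn_ile1 ?invr_ge0 // invf_le1 ?ltr0n // ler1n.
    apply: le_trans (cabs_sum _ _ _) _; rewrite mulr_natr -sumr_const; apply: ler_sum => p _.
    by rewrite cabsM cabs_cis mul1r.
  rewrite mul1r /e' mulrAC ler_pdivrMr // ler_wpM2l ?(ltW e4) // lerDl //.
have := cabs_tri sigma (G (cvec x)) (gridmean N (fun y => G (cvec y)) * fejer_sum M x).
lra.
Qed.

(** Both functions are, up to any precision, their mean times the same Fejer
    sum, so the two products agree. In geometric terms a line bundle of this
    type on the torus has a one-dimensional space of sections. *)
Theorem quasi_periodic_unique G1 G2 x x' :
  locally_holomorphic G1 -> int_periodic G1 -> quasi_periodic G1 ->
  locally_holomorphic G2 -> int_periodic G2 -> quasi_periodic G2 ->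
  G1 (cvec x) * G2 (cvec x') = G1 (cvec x') * G2 (cvec x).
Proof.
move=> hol1 per1 qp1 hol2 per2 qp2.
pose K := cabs (G1 (cvec x)) + cabs (G2 (cvec x')) + cabs (G1 (cvec x')) + cabs (G2 (cvec x)) + 2.
have K0 : 0 < K by rewrite ltr_wpDl // !addr_ge0 ?cabs_ge0.
apply/eqP; rewrite -subr_eq0; apply/eqP/cabs_lt_eq0 => e e0.
pose d := Num.min 1 (e / K); have d0 : 0 < d by rewrite lt_min ltr01 divr_gt0.
have [M1 h1] := fejer_approximation x hol1 per1 qp1 d0.
have [M2 h2] := fejer_approximation x' hol2 per2 qp2 d0.
have [M3 h3] := fejer_approximation x' hol1 per1 qp1 d0.
have [M4 h4] := fejer_approximation x hol2 per2 qp2 d0.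
pose M := (maxn (maxn M1 M2) (maxn M3 M4)).+1.
have [MM1 MM2 MM3 MM4] : [/\ M1 < M, M2 < M, M3 < M & M4 < M]%N.
  by split; rewrite ltnS !leq_max leqnn ?orbT.
have [[N1 {}h1] [N2 {}h2]] := (h1 M MM1, h2 M MM2).
have [[N3 {}h3] [N4 {}h4]] := (h3 M MM3, h4 M MM4).
pose N := maxn (maxn N1 N2) (maxn N3 N4).
have [NN1 NN2 NN3 NN4] : [/\ N1 <= N, N2 <= N, N3 <= N & N4 <= N]%N.
  by split; rewrite !leq_max leqnn ?orbT.
move: (h1 N NN1) (h2 N NN2) (h3 N NN3) (h4 N NN4) => {h1 h2 h3 h4} h1 h2 h3 h4.
set a := G1 (cvec x) in h1 *; set b := G2 (cvec x') in h2 *.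
set a' := G1 (cvec x') in h3 *; set b' := G2 (cvec x) in h4 *.
move: h1 h2 h3 h4; set S := fejer_sum M x; set S' := fejer_sum M x'.
set J1 := gridmean N _; set J2 := gridmean N _ => h1 h2 h3 h4.
have d1 : d <= 1 by rewrite ge_min lexx.
have prod_close u v u' v' : cabs (u - u') <= d -> cabs (v - v') <= d ->
    cabs (u * v - u' * v') <= d * (cabs u + cabs v + 1).
  move=> hu hv; have -> : u * v - u' * v' = u * (v - v') + (u - u') * v - (u - u') * (v - v') by ring.
  apply: le_trans (cabsB _ _) _; apply: le_trans (lerD (cabsD _ _) (lexx _)) _; rewrite !cabsM.
  have := cabs_ge0 u; have := cabs_ge0 v; have := cabs_ge0 (u - u'); have := cabs_ge0 (v - v').
  nra.
have l1 := prod_close _ _ _ _ h1 h2; have l2 := prod_close _ _ _ _ h3 h4.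
have eqJ : J1 * S * (J2 * S') = J1 * S' * (J2 * S) by ring.
rewrite eqJ in l1; have := cabs_tri (J1 * S' * (J2 * S)) (a * b) (a' * b').
rewrite (cabsC (J1 * S' * (J2 * S))) => l3.
apply: le_trans l3 _; apply: le_trans (lerD l1 l2) _.
have -> : d * (cabs a + cabs b + 1) + d * (cabs a' + cabs b' + 1) = d * K by rewrite /K -/a -/b -/a' -/b'; ring.
by rewrite -ler_pdivlMr // ge_min lexx orbT.
Qed.

End Uniqueness.

(** * Theta series in coordinates *)

(** The coordinates used throughout: the places numbered by the dimension, an
    integral basis, and its trace-dual basis, which generates the inverse
    different over Z. *)
Record frame (F : fieldExtType rat) (R : realType) := Frame {
  fplace : 'I_(\dim {:F}) -> place F R;
  fbasis : 'I_(\dim {:F}) -> F;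
  fdual : 'I_(\dim {:F}) -> F;
  fplace_inj : injective fplace;
  fplace_surj : forall v, exists i, v = fplace i;
  fplace_trace : forall y, ratr (field_trace y) = \sum_i fplace i y;
  ftrace_int : forall y, ring_of_integers F y -> field_trace y \is a Num.int;
  fbasis_int : forall i, ring_of_integers F (fbasis i);
  fdual_codiff : forall i, codifferent F (fdual i);
  ftrace_dual : forall i j, field_trace (fbasis i * fdual j) = (i == j)%:R;
  fbasis_coord : forall y, y = \sum_i field_trace (y * fdual i) *: fbasis i;
  fdual_coord : forall y, y = \sum_i field_trace (y * fbasis i) *: fdual i
}.

Lemma frame_exists (F : fieldExtType rat) (R : realType) :
  totally_real F R -> inhabited (frame F R).
Proof.
move=> F_real; have [vs [vs_inj vs_surj vs_free]] := places_independent F_real.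
have [e [f [eO fC dual eE fE]]] := integral_basis_exists (field_trace_int F_real) vs_free.
exact: inhabits (Frame vs_inj vs_surj (field_trace_places vs_free)
  (field_trace_int F_real) eO fC dual eE fE).
Qed.

Section CoordinateTheta.
Variables (F : fieldExtType rat) (R : realType) (P : frame F R).
Local Notation D := (\dim {:F}).
Local Notation C := R[i].
Local Notation O := (ring_of_integers F).
Local Notation v := (fplace P).
Implicit Types (xi : O) (tau l u : 'I_D -> C) (k : C).

(** Algebraic integers as a type, to serve as the index set of the sums; addO
    and subO are inverse translations of that set. *)
Definition intO x (Ox : O x) : O := exist _ x (mem_set Ox).

Lemma intOP xi : O (val xi). Proof. exact: set_mem (valP xi). Qed.

Definition addO (nu xi : O) : O := intO (ringOD (intOP xi) (intOP nu)).
Definition subO (nu xi : O) : O := intO (ringOB (intOP xi) (intOP nu)).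

Lemma addOK nu : cancel (addO nu) (subO nu).
Proof. by move=> xi; apply: val_inj; rewrite /= addrK. Qed.
Lemma subOK nu : cancel (subO nu) (addO nu).
Proof. by move=> xi; apply: val_inj; rewrite /= subrK. Qed.

Definition norm1 xi : R := \sum_i `|v i (val xi)|.
Definition norm2 xi : R := \sum_i v i (val xi) ^+ 2.

Lemma norm1_ge0 xi : 0 <= norm1 xi.
Proof. by apply: sumr_ge0. Qed.

Lemma norm2_ge0 xi : 0 <= norm2 xi.
Proof. by apply: sumr_ge0 => i _; exact: sqr_ge0. Qed.

Lemma geometric_le (q : R) n : 0 <= q < 1 -> \sum_(a < n) q ^+ a <= (1 - q)^-1.
Proof.
move=> /andP[q0 q1]; have q1' : 0 < 1 - q by rewrite subr_gt0.
rewrite -[leRHS]mul1r ler_pdivlMr // mulrC -opprB mulNr -subrX1 opprB.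
by rewrite gerBl exprn_ge0.
Qed.

Lemma sum_fset_le (I : choiceType) (T : finType) (B : {fset I}) (h : I -> T) (H : T -> R) :
  (forall t, 0 <= H t) -> {in B &, injective h} -> \sum_(x <- B) H (h x) <= \sum_t H t.
Proof.
move=> H0 hinj; rewrite -(big_map h predT H) /=.
rewrite big_uniq /=; last by rewrite map_inj_in_uniq ?fset_uniq.
by rewrite [leRHS](bigID (mem (map h B))) /= lerDl sumr_ge0.
Qed.

(** Pairing with the dual basis bounds the integral coordinates of xi by a
    multiple of norm1 xi, so the sum is dominated by a product of D two-sided
    geometric series. *)
Lemma norm1_summable (A : R) : 0 < A -> exists K : R, forall B : {fset O},
  \sum_(xi <- B) expR (- (A * norm1 xi)) <= K.
Proof.
move=> A0.
have /choice[co coE] : forall xi, exists m : 'I_D -> int,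
    forall i, field_trace (val xi * fdual P i) = (m i)%:~R.
  move=> xi; have h i : exists m : int, field_trace (val xi * fdual P i) = m%:~R.
    by have /intrP[m mE] := fdual_codiff P i (intOP xi); exists m; rewrite mulrC.
  by have [m mE] := choice h; exists m.
have co_inj : injective co.
  move=> x y xy; apply: val_inj; rewrite (fbasis_coord P (val x)) (fbasis_coord P (val y)).
  by apply: eq_bigr => i _; rewrite !coE xy.
pose Q : R := 1 + \sum_i \sum_j `|v i (fdual P j)|.
have Q1 : 1 <= Q by rewrite lerDl sumr_ge0 // => i _; apply: sumr_ge0.
have co_le xi : \sum_j `|(co xi j)%:~R| <= Q * norm1 xi :> R.
  apply: le_trans (_ : \sum_j \sum_i `|v i (val xi)| * `|v i (fdual P j)| <= _).
    apply: ler_sum => j _; rewrite -(ratr_int R (co xi j)) -coE (fplace_trace P).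
    apply: le_trans (ler_norm_sum _ _ _) _; apply: ler_sum => i _.
    by rewrite rmorphM normrM.
  rewrite exchange_big /= /norm1 mulr_sumr; apply: ler_sum => i _.
  rewrite -mulr_sumr mulrC; apply: ler_wpM2r => //.
  rewrite /Q [X in _ + X](bigD1 i) //= addrCA lerDl addr_ge0 // sumr_ge0 // => k _.
  by apply: sumr_ge0.
pose q := expR (- (A / Q)); have Q0 : 0 < Q by rewrite (lt_le_trans ltr01).
have q01 : 0 <= q < 1 by rewrite expR_ge0 expR_lt1 oppr_lt0 divr_gt0.
exists ((2 * (1 - q)^-1) ^+ D) => B.
(* Inside the finite set B a lattice point is given by the signs and the
   absolute values of its coordinates. *)
pose M := (\max_(xi <- B) \max_j `|co xi j|)%N.
pose h xi : {ffun 'I_D -> bool * 'I_M.+1} := [ffun j => (co xi j < 0, inord `|co xi j|%N)].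
have coM xi j : xi \in B -> (`|co xi j| < M.+1)%N.
  move=> xB; rewrite ltnS; apply: leq_trans (@leq_bigmax _ (fun j => `|co xi j|%N) j) _.
  exact: (@leq_bigmax_seq _ (enum_fset B) xpredT (fun xi => \max_j `|co xi j|)%N xi xB isT).
pose H (g : {ffun 'I_D -> bool * 'I_M.+1}) : R := \prod_j q ^+ (g j).2.
have H0 g : 0 <= H g by apply: prodr_ge0 => j _; rewrite exprn_ge0 // expR_ge0.
apply: le_trans (_ : \sum_(xi <- B) H (h xi) <= _).
  rewrite big_seq [leRHS]big_seq; apply: ler_sum => xi xB.
  have -> : H (h xi) = expR (- (A / Q * \sum_j `|(co xi j)%:~R|)).
    rewrite /H mulr_sumr -sumrN expR_sum; apply: eq_bigr => j _.
    rewrite ffunE /= inordK ?coM // /q -expRM_natr mulNr; congr (expR (- (_ * _))).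
    by rewrite -intr_norm -natr_absz.
  rewrite ler_expR lerN2 -mulrA; apply: ler_wpM2l; first exact: ltW.
  by rewrite mulrC ler_pdivrMr // mulrC.
apply: le_trans (sum_fset_le H0 _) _.
  move=> x y xB yB /ffunP e; apply: co_inj; apply/funext => j.
  have := e j; rewrite !ffunE => -[s /(congr1 val)]; rewrite /= !inordK ?coM // => ab.
  by rewrite (intEsign (co x j)) (intEsign (co y j)) s ab.
rewrite /H -(bigA_distr_bigA (fun (j : 'I_D) (g : bool * 'I_M.+1) => q ^+ g.2)).
rewrite prodr_const card_ord; apply: lerXn2r.
- by rewrite nnegrE sumr_ge0 // => g _; rewrite exprn_ge0 // expR_ge0.
- by rewrite nnegrE mulr_ge0 // invr_ge0 subr_ge0 ltW //; case/andP: q01.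
rewrite -(pair_bigA _ (fun (s : bool) (a : 'I_M.+1) => q ^+ a)) /= big_bool /=.
by rewrite mulr_natl mulr2n; apply: lerD; exact: geometric_le.
Qed.

(** Completing the square in each coordinate: Gaussian decay absorbs any linear
    exponential growth. *)
Lemma quad_majorant (c K : R) : 0 < c -> exists2 M : R, 0 <= M &
  forall xi, expR (- (c * norm2 xi) + K * norm1 xi) <= M * expR (- norm1 xi).
Proof.
move=> c0; exists (expR (((K + 1) ^+ 2 / (4 * c)) *+ D)); first exact: expR_ge0.
move=> xi; rewrite -expRD ler_expR /norm2 /norm1 -[D in _ *+ D]card_ord -sumr_const.
rewrite !mulr_sumr -!sumrN -!big_split /=; apply: ler_sum => i _.
set a := v i _; have -> : a ^+ 2 = `|a| ^+ 2 by rewrite real_normK ?num_real.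
move: `|a| => b; rewrite -subr_ge0.
have -> : (K + 1) ^+ 2 / (4 * c) - b - (- (c * b ^+ 2) + K * b) = c * (b - (K + 1) / (2 * c)) ^+ 2.
  by field; rewrite gt_eqF.
by rewrite mulr_ge0 ?sqr_ge0 // ltW.
Qed.

End CoordinateTheta.

Section GenericTheta.
Variables (F : fieldExtType rat) (R : realType) (P : frame F R).
Local Notation D := (\dim {:F}).
Local Notation C := R[i].
Local Notation O := (ring_of_integers F).
Local Notation v := (fplace P).
Implicit Types (xi : O) (tau l u : 'I_D -> C) (k : C).

Definition ipi : C := (0 +i* pi)%C.

Definition emb (x : F) (i : 'I_D) : C := ((v i x)%:C)%C.

Lemma embD x y i : emb (x + y) i = emb x i + emb y i.
Proof. by rewrite /emb !rmorphD. Qed.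
Lemma embB x y i : emb (x - y) i = emb x i - emb y i.
Proof. by rewrite /emb !rmorphB. Qed.
Lemma embN x i : emb (- x) i = - emb x i.
Proof. by rewrite /emb !rmorphN. Qed.
Lemma embM x y i : emb (x * y) i = emb x i * emb y i.
Proof. by rewrite /emb !rmorphM. Qed.
Lemma emb1 i : emb 1 i = 1.
Proof. by rewrite /emb !rmorph1. Qed.
Lemma emb0 i : emb 0 i = 0.
Proof. by rewrite /emb !rmorph0. Qed.
Lemma cabs_emb x i : cabs (emb x i) = `|v i x|.
Proof. exact: cabs_real. Qed.
Lemma emb_sum (I : Type) (r : seq I) (Q : pred I) (g : I -> F) i :
  emb (\sum_(j <- r | Q j) g j) i = \sum_(j <- r | Q j) emb (g j) i.
Proof. by rewrite /emb !rmorph_sum. Qed.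
Lemma embZ (a : rat) x i : emb (a *: x) i = ratr a * emb x i.
Proof.
rewrite /emb placeZ rmorphM; congr (_ * _).
exact: (fmorph_eq_rat (real_complex R \o ratr)).
Qed.

(** The exponent, divided by pi i, of the general term of the theta series in
    the modular variable tau and the elliptic variable l; the constant k makes
    room for Gaussian factors in l. *)
Definition qexp tau l k xi : C :=
  \sum_i (emb (val xi) i ^+ 2 * tau i + 2 * emb (val xi) i * l i) + k.

Definition qterm tau l k xi : C := cexp (ipi * qexp tau l k xi).

Definition Th tau l k : C := tsum (qterm tau l k).

Lemma cabs_ipi (z : C) : cabs (ipi * z) = pi * cabs z.
Proof.
by rewrite cabsM; congr (_ * _); rewrite /ipi /cabs normc_def /= expr0n add0r sqrtr_sqr ger0_norm ?pi_ge0.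
Qed.

Lemma Re_ipi (z : C) : complex.Re (ipi * z) = - (pi * complex.Im z).
Proof. by case: z => a b; rewrite /ipi; simpc; rewrite /=. Qed.

Lemma Im_emb_sqr x i (z : C) : complex.Im (emb x i ^+ 2 * z) = v i x ^+ 2 * complex.Im z.
Proof.
have -> : emb x i ^+ 2 = ((v i x ^+ 2)%:C)%C by rewrite /emb rmorphXn.
by case: z => a b /=; ring.
Qed.

Lemma qterm_bound tau l k (y K : R) : 0 < y -> 0 <= K -> (forall i, y <= complex.Im (tau i)) ->
  (forall i, cabs (l i) <= K) -> cabs k <= K ->
  forall xi, cabs (qterm tau l k xi) <=
    expR (- (pi * y * norm2 P xi) + (2 * pi * K) * norm1 P xi) * expR (pi * K).
Proof.
move=> y0 K0 htau hl hk xi; rewrite /qterm cabs_cexp Re_ipi -expRD ler_expR /qexp.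
have p0 := @pi_gt0 R.
rewrite raddfD raddf_sum /=.
suff h1 : - \sum_i complex.Im (emb (val xi) i ^+ 2 * tau i + 2 * emb (val xi) i * l i) <=
    - (y * norm2 P xi) + 2 * K * norm1 P xi.
  have h2 : - complex.Im k <= K.
    by apply: le_trans (ler_norm _) _; rewrite normrN; apply: le_trans hk; exact: Im_le_cabs.
  rewrite -mulrN opprD mulrDr.
  have := ler_wpM2l (ltW p0) h1; have := ler_wpM2l (ltW p0) h2; lra.
rewrite -sumrN /norm2 /norm1 !mulr_sumr -sumrN -big_split; apply: ler_sum => i _ /=.
rewrite raddfD /= Im_emb_sqr opprD; apply: lerD.
  by rewrite lerN2 mulrC; apply: ler_wpM2l; rewrite ?sqr_ge0.
apply: le_trans (ler_norm _) _; rewrite normrN.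
apply: le_trans (Im_le_cabs _) _; rewrite !cabsM cabs_nat cabs_emb.
rewrite -mulrA [leRHS]mulrAC -mulrA; apply: ler_wpM2l => //; apply: ler_wpM2l => //.
Qed.

Lemma norm1_exp_summable (M : R) : 0 <= M -> exists S : R, forall B : {fset O},
  \sum_(xi <- B) M * expR (- norm1 P xi) <= S.
Proof.
move=> M0; have [K hK] := norm1_summable P ltr01; exists (M * K) => B.
rewrite -mulr_sumr; apply: ler_wpM2l => //; apply: le_trans (hK B).
by apply: ler_sum => xi _; rewrite mul1r.
Qed.

Lemma quad_exp_majorant (c K A : R) : 0 < c -> 0 <= A -> exists2 M : R, 0 <= M &
  forall xi, expR (- (c * norm2 P xi) + K * norm1 P xi) * A <= M * expR (- norm1 P xi).
Proof.
move=> c0 A0; have [M M0 hM] := quad_majorant P K c0; exists (M * A); first exact: mulr_ge0.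
by move=> xi; rewrite mulrAC; apply: ler_wpM2r.
Qed.

Lemma Im_lower_bound tau : (forall i, 0 < complex.Im (tau i)) ->
  exists2 y : R, 0 < y & forall i, y <= complex.Im (tau i).
Proof.
move=> htau; exists (\big[Num.min/1]_i complex.Im (tau i)).
  by elim/big_ind: _ => // a b a0 b0; rewrite lt_min a0.
by move=> i; apply: bigmin_le_cond.
Qed.

Lemma parameter_bound l k :
  exists2 K : R, 0 <= K & (forall i, cabs (l i) <= K) /\ cabs k <= K.
Proof.
have l0 : 0 <= \sum_i cabs (l i) by apply: sumr_ge0 => i _; exact: cabs_ge0.
exists (\sum_i cabs (l i) + cabs k); first by rewrite addr_ge0 ?cabs_ge0.
split=> [i|]; last by rewrite lerDr.
rewrite (bigD1 i) //= -addrA lerDl addr_ge0 ?cabs_ge0 // sumr_ge0 // => j _.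
exact: cabs_ge0.
Qed.

Lemma qterm_majorant tau l k : (forall i, 0 < complex.Im (tau i)) ->
  exists2 M : R, 0 <= M & forall xi, cabs (qterm tau l k xi) <= M * expR (- norm1 P xi).
Proof.
move=> htau.
have [y y0 hy] := Im_lower_bound htau.
have [K K0 [lK kK]] := parameter_bound l k.
have [M M0 hM] := quad_exp_majorant (2 * pi * K) (mulr_gt0 (@pi_gt0 R) y0) (expR_ge0 (pi * K)).
by exists M => // xi; apply: le_trans (hM xi); apply: qterm_bound.
Qed.

Lemma qterm_summable tau l k : (forall i, 0 < complex.Im (tau i)) -> abs_summable (qterm tau l k).
Proof.
move=> /(qterm_majorant l k)[M M0 hM]; have [S hS] := norm1_exp_summable M0.
exact: abs_summable_le hM hS.
Qed.

Lemma Th_cst tau l k k' : (forall i, 0 < complex.Im (tau i)) ->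
  Th tau l (k + k') = cexp (ipi * k) * Th tau l k'.
Proof.
move=> htau; rewrite /Th -tsumZ; last exact: qterm_summable.
congr tsum; apply/funext => xi; rewrite /qterm -cexpD; congr cexp; rewrite /qexp; ring.
Qed.

Lemma cexp_trace_even (y : F) : field_trace y \is a Num.int ->
  cexp (ipi * (2 * \sum_i emb y i)) = 1.
Proof.
move=> /intrP[m mE]; rewrite -[RHS](cexp_periodic R m); congr cexp.
have -> : \sum_i emb y i = ((m%:~R)%:C)%C.
  by rewrite /emb -rmorph_sum -(fplace_trace P) mE ratr_int.
rewrite /ipi -(rmorph_nat (real_complex R)) -rmorphM /=; simpc; congr (_ +i* _)%C.
ring.
Qed.

(** The terms change by exp(2 pi i Tr(lam xi)) = 1. *)
Lemma Th_codiff tau l k (lam : F) : (codifferent F lam) ->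
  Th tau (fun i => l i + emb lam i) k = Th tau l k.
Proof.
move=> hlam; rewrite /Th; congr tsum; apply/funext => xi; rewrite /qterm.
have -> : qexp tau (fun i => l i + emb lam i) k xi =
    qexp tau l k xi + 2 * \sum_i emb (lam * val xi) i.
  rewrite /qexp addrAC; congr (_ + _); rewrite mulr_sumr -big_split; apply: eq_bigr => i _ /=.
  rewrite embM; ring.
by rewrite mulrDr cexpD cexp_trace_even ?mulr1 //; apply: hlam; exact: intOP.
Qed.

(** Replacing the summation index xi by xi + nu. *)
Lemma Th_quasi tau l k (nu : F) : O nu -> (forall i, 0 < complex.Im (tau i)) ->
  Th tau (fun i => l i + emb nu i * tau i) k =
  cexp (- (ipi * \sum_i (emb nu i ^+ 2 * tau i + 2 * emb nu i * l i))) * Th tau l k.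
Proof.
move=> Onu htau; set Q := \sum_i _.
rewrite /Th -(tsum_reindex (addOK (intO Onu)) (subOK (intO Onu)) (qterm_summable l k htau)).
rewrite -tsumZ; last first.
  have [K hK] := qterm_summable l k htau; exists K => B.
  apply: le_trans (hK (addO (intO Onu) @` B)%fset).
  by rewrite big_imfset //= => x y _ _ /(can_inj (addOK _)).
congr tsum; apply/funext => xi; rewrite /qterm /= -cexpD; congr cexp.
rewrite -mulrN -mulrDr; congr (_ * _).
rewrite /qexp /Q addrA; congr (_ + _); rewrite [RHS]addrC -sumrB.
by apply: eq_bigr => i _; rewrite /= embD; ring.
Qed.

End GenericTheta.

(** * Regularity of theta series *)
Section ThetaRegularity.
Variables (F : fieldExtType rat) (R : realType) (P : frame F R).
Local Notation D := (\dim {:F}).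
Local Notation C := R[i].
Local Notation O := (ring_of_integers F).
Local Notation v := (fplace P).
Local Notation emb := (emb P).
Local Notation norm1 := (norm1 P).
Local Notation norm2 := (norm2 P).
Implicit Types (xi : O) (tau l u q : 'I_D -> C) (k s : C).

(** The Weierstrass test: the expansions can be summed term by term when their
    bounds and remainders have a common summable majorant. *)
Lemma holomorphic_tsum (I : choiceType) (t : I -> ('I_D -> C) -> C) :
  (forall K : R, exists2 Maj : I -> R,
     exists S : R, forall B : {fset I}, \sum_(a <- B) Maj a <= S &
     forall (a : I) q, (forall i, cabs (q i) <= K) -> cabs (t a q) <= Maj a /\
       forall i, exists2 L : C, cabs L <= Maj a & forall s, cabs s <= 1 ->
         cabs (t a (shift q i s) - t a q - s * L) <= Maj a * cabs s ^+ 2) ->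
  locally_holomorphic (fun q => tsum (fun a => t a q)).
Proof.
move=> h K; have [Maj [S hS] hM] := h K; have [Maj1 [S1 hS1] hM1] := h (`|K| + 1).
exists S; first by have := hS fset0; rewrite big_nil.
move=> q qK; split; first by apply: tsum_bound_le hS => a; exact: (hM a q qK).1.
move=> i.
have /choice[L hL] : forall a, exists L : C, cabs L <= Maj a /\ forall s, cabs s <= 1 ->
    cabs (t a (shift q i s) - t a q - s * L) <= Maj a * cabs s ^+ 2.
  by move=> a; have [L h1 h2] := (hM a q qK).2 i; exists L.
have Lsum : abs_summable L by apply: abs_summable_le hS => a; exact: (hL a).1.
have tsm : abs_summable (t^~ q) by apply: abs_summable_le hS => a; exact: (hM a q qK).1.
exists (tsum L); first by apply: tsum_bound_le hS => a; exact: (hL a).1.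
move=> s s1.
have tsm1 : abs_summable (t^~ (shift q i s)).
  apply: abs_summable_le hS1 => a; apply: (hM1 a _ _).1 => m; rewrite /shift.
  have qm : cabs (q m) <= `|K| by apply: le_trans (qK m) (ler_norm K).
  case: ifP => _; last by apply: le_trans qm _; rewrite lerDl.
  by apply: le_trans (cabsD _ _) _; apply: lerD.
have -> : tsum (t^~ (shift q i s)) - tsum (t^~ q) - s * tsum L =
    tsum (fun a => t a (shift q i s) - t a q - s * L a).
  transitivity (tsum (fun a => t a (shift q i s) + (-1 * t a q + - s * L a))).
    rewrite tsumD ?tsumD ?(tsumZ _ tsm) ?(tsumZ _ Lsum) //; try exact: abs_summableZ.
      by rewrite mulN1r mulNr addrA.
    by apply: abs_summableD; exact: abs_summableZ.
  by congr tsum; apply/funext => a; rewrite mulN1r mulNr addrA.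
apply: (@tsum_bound_le _ _ _ (fun a => Maj a * cabs s ^+ 2)) => [a|B].
  exact: (hL a).2 s s1.
by rewrite -mulr_suml; apply: ler_wpM2r; rewrite ?sqr_ge0.
Qed.

Lemma expR_dominates (x : R) : 0 <= x -> [/\ 1 <= expR x, x <= expR x & x ^+ 2 <= 2 * expR x].
Proof.
move=> x0; have h1 := expR_ge1Dx x; have := @expR_ge1Dxn R x 1 x0.
rewrite -[2`!]/2%N => h2; split; [lra|lra|lra].
Qed.

(** In the coordinates of the dual basis the codifferent becomes the lattice of
    integral vectors, so theta series have period 1 in each variable. *)
Definition dual_point q : 'I_D -> C := fun i => \sum_m q m * emb (fdual P m) i.

Lemma dual_point_shift q m s i :
  dual_point (shift q m s) i = dual_point q i + s * emb (fdual P m) i.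
Proof.
rewrite /dual_point (bigD1 m) //= [X in _ = X + _](bigD1 m) //= /shift eqxx mulrDl addrAC.
congr (_ + _ + _); apply: eq_bigr => j /negPf jm; by rewrite jm.
Qed.

(** Moving q by s in one coordinate multiplies a term by the exponential of a
    quadratic polynomial in s with coefficients at most linear in norm1 xi; all
    errors are absorbed by exp(3 A (norm1 xi + 1)) and then by Gaussian decay. *)
Lemma theta_holomorphic tau (j kap : 'I_D -> C) : (forall i, 0 < complex.Im (tau i)) ->
  locally_holomorphic (fun q => Th P tau (fun i => j i * dual_point q i)
     (- \sum_i kap i * dual_point q i ^+ 2)).
Proof.
move=> htau.
apply: (@holomorphic_tsum O (fun xi q => qterm P tau (fun i => j i * dual_point q i)
  (- \sum_i kap i * dual_point q i ^+ 2) xi)) => K.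
have [y y0 hy] := Im_lower_bound htau.
pose FB : R := \sum_m \sum_i cabs (emb (fdual P m) i).
have FB0 : 0 <= FB by apply: sumr_ge0 => m _; apply: sumr_ge0 => i _; exact: cabs_ge0.
have wFB m i : cabs (emb (fdual P m) i) <= FB.
  rewrite /FB (bigD1 m) //= (bigD1 i) //= -addrA lerDl addr_ge0 //.
    by apply: sumr_ge0 => ? _; exact: cabs_ge0.
  by apply: sumr_ge0 => ? _; apply: sumr_ge0 => ? _; exact: cabs_ge0.
pose J : R := \sum_i (cabs (j i) + cabs (kap i)).
have J0 : 0 <= J by apply: sumr_ge0 => i _; rewrite addr_ge0 ?cabs_ge0.
have jJ i : cabs (j i) <= J.
  rewrite /J (bigD1 i) //= -addrA lerDl addr_ge0 ?cabs_ge0 // sumr_ge0 // => m _.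
  by rewrite addr_ge0 ?cabs_ge0.
have kapJ : \sum_i cabs (kap i) <= J.
  by apply: ler_sum => i _; rewrite lerDr cabs_ge0.
pose K' := `|K| * FB; have K'0 : 0 <= K' by rewrite mulr_ge0.
have uK q i : (forall m, cabs (q m) <= K) -> cabs (dual_point q i) <= K'.
  move=> qK; apply: le_trans (cabs_sum _ _ _) _.
  apply: le_trans (_ : \sum_m `|K| * cabs (emb (fdual P m) i) <= _).
    apply: ler_sum => m _; rewrite cabsM; apply: ler_wpM2r; first exact: cabs_ge0.
    exact: le_trans (qK m) (ler_norm K).
  rewrite -mulr_sumr; apply: ler_wpM2l => //; apply: ler_sum => m _.
  by rewrite (bigD1 i) //= lerDl sumr_ge0 // => ? _; exact: cabs_ge0.
pose K1 := J * K' + J * K' ^+ 2.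
have K10 : 0 <= K1 by rewrite addr_ge0 // mulr_ge0 ?sqr_ge0.
have p0 := @pi_gt0 R.
pose A := pi * (2 * J * FB + 2 * J * K' * FB + J * FB ^+ 2).
have A0 : 0 <= A.
  by rewrite mulr_ge0 ?(ltW p0) // !addr_ge0 // !mulr_ge0 ?sqr_ge0.
have [M M0 hM] := quad_exp_majorant P (2 * pi * K1 + 3 * A) (mulr_gt0 p0 y0)
  (mulr_ge0 (expR_ge0 (pi * K1)) (mulr_ge0 (ler0n R 25) (expR_ge0 (3 * A)))).
exists (fun xi => M * expR (- norm1 xi)); first exact: norm1_exp_summable.
move=> xi q qK; set l := fun i => j i * dual_point q i; set k := - \sum_i _.
have lK i : cabs (l i) <= K1.
  apply: le_trans (_ : J * K' <= K1); last by rewrite lerDl mulr_ge0 ?sqr_ge0.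
  by rewrite cabsM; apply: ler_pM; rewrite ?cabs_ge0 ?jJ ?uK.
have kK : cabs k <= K1.
  apply: le_trans (_ : J * K' ^+ 2 <= K1); last by rewrite lerDr mulr_ge0.
  rewrite cabsN; apply: le_trans (cabs_sum _ _ _) _.
  apply: le_trans (_ : (\sum_i cabs (kap i)) * K' ^+ 2 <= _); last first.
    by apply: ler_wpM2r; rewrite ?sqr_ge0.
  rewrite mulr_suml; apply: ler_sum => i _; rewrite cabsM cabsX; apply: ler_wpM2l; first exact: cabs_ge0.
  by apply: lerXn2r; rewrite ?nnegrE ?cabs_ge0 ?uK.
have tb := qterm_bound P y0 K10 hy lK kK xi.
pose x := A * (norm1 xi + 1).
have n10 := norm1_ge0 P xi.
have x0 : 0 <= x by rewrite mulr_ge0 // addr_ge0.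
have [e1 e2 e3] := expR_dominates x0.
have exE : expR (3 * x) = expR x * (expR x * expR x).
  by rewrite -!expRD; congr expR; ring.
(* The remainders met below are at most 25 exp(3 x), since powers of x and the
   exponential of cabs d are bounded by powers of exp x. *)
have maj (z : R) : 0 <= z -> z <= 25 * expR (3 * x) ->
    cabs (qterm P tau l k xi) * z <= M * expR (- norm1 xi).
  move=> z0 hz; apply: le_trans (hM xi).
  apply: le_trans (ler_pM (cabs_ge0 _) z0 tb hz) _.
  have -> : 3 * x = 3 * A * norm1 xi + 3 * A by rewrite /x; ring.
  rewrite le_eqVlt; apply/orP; left; apply/eqP.
  have -> : (2 * pi * K1 + 3 * A) * norm1 xi = 2 * pi * K1 * norm1 xi + 3 * A * norm1 xi by ring.
  rewrite !expRD; ring.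
have E0 := expR_gt0 x; set E := expR x in e1 e2 e3 exE E0.
split.
  by rewrite -[cabs _]mulr1; apply: maj => //; rewrite exE; nra.
move=> m; pose w := emb (fdual P m).
pose a := \sum_i 2 * emb (val xi) i * (j i * w i) - \sum_i 2 * kap i * dual_point q i * w i.
pose b := - \sum_i kap i * w i ^+ 2.
have aA : pi * cabs a <= x.
  have h1 : cabs (\sum_i 2 * emb (val xi) i * (j i * w i)) <= 2 * J * FB * norm1 xi.
    apply: le_trans (cabs_sum _ _ _) _; rewrite /norm1 mulr_sumr; apply: ler_sum => i _.
    rewrite !cabsM cabs_nat cabs_emb.
    have h : cabs (j i) * cabs (w i) <= J * FB.
      by apply: ler_pM; rewrite ?cabs_ge0 ?jJ ?wFB.
    have := normr_ge0 (v i (val xi)); nra.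
  have h2 : cabs (\sum_i 2 * kap i * dual_point q i * w i) <= 2 * J * K' * FB.
    apply: le_trans (cabs_sum _ _ _) _.
    apply: le_trans (_ : \sum_i cabs (kap i) * (2 * K' * FB) <= _).
      apply: ler_sum => i _; rewrite !cabsM cabs_nat.
      have h : cabs (dual_point q i) * cabs (w i) <= K' * FB.
        by apply: ler_pM; rewrite ?cabs_ge0 ?wFB ?uK.
      have := cabs_ge0 (kap i); nra.
    rewrite -mulr_suml; have h : 0 <= 2 * K' * FB by rewrite !mulr_ge0.
    have := ler_wpM2r h kapJ; lra.
  have h3 : cabs a <= 2 * J * FB * norm1 xi + 2 * J * K' * FB.
    by apply: le_trans (cabsB _ _) _; apply: lerD.
  apply: le_trans (ler_wpM2l (ltW p0) h3) _; rewrite /x /A -[leRHS]mulrA; apply: ler_wpM2l; first exact: ltW.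
  have t1 : 0 <= J * FB by rewrite mulr_ge0.
  have t2 : 0 <= J * K' * FB by rewrite !mulr_ge0.
  have t3 : 0 <= J * FB ^+ 2 by rewrite mulr_ge0 ?sqr_ge0.
  nra.
have bA : pi * cabs b <= x.
  apply: le_trans (_ : A <= x); last by rewrite /x -[leLHS]mulr1 ler_wpM2l // lerDr.
  rewrite /A; apply: ler_wpM2l; first exact: ltW.
  apply: le_trans (_ : J * FB ^+ 2 <= _); last first.
    by rewrite lerDr addr_ge0 // !mulr_ge0.
  rewrite /b cabsN; apply: le_trans (cabs_sum _ _ _) _.
  apply: le_trans (_ : (\sum_i cabs (kap i)) * FB ^+ 2 <= _); last first.
    by apply: ler_wpM2r; rewrite ?sqr_ge0.
  rewrite mulr_suml; apply: ler_sum => i _; rewrite cabsM cabsX; apply: ler_wpM2l; first exact: cabs_ge0.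
  by apply: lerXn2r; rewrite ?nnegrE ?cabs_ge0 ?wFB.
exists (qterm P tau l k xi * (ipi R * a)).
  by rewrite cabsM; apply: maj; rewrite cabs_ipi; [rewrite mulr_ge0 ?cabs_ge0 ?ltW|rewrite exE; nra].
move=> s s1; set k' := - \sum_i _.
pose d := ipi R * (s * a + s ^+ 2 * b).
have -> : qterm P tau (fun i => j i * dual_point (shift q m s) i) k' xi =
    qterm P tau l k xi * cexp d.
  rewrite /qterm -cexpD -mulrDr; congr (cexp (_ * _)); rewrite /qexp.
  have -> : k' = k - (s * (\sum_i 2 * kap i * dual_point q i * w i) - s ^+ 2 * b).
    rewrite /k' /k /b mulrN opprK -opprD; congr (- _); rewrite !mulr_sumr -!big_split.
    by apply: eq_bigr => i _ /=; rewrite dual_point_shift -/w; ring.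
  rewrite /a mulrBr.
  have -> : \sum_i (emb (val xi) i ^+ 2 * tau i + 2 * emb (val xi) i * (j i * dual_point (shift q m s) i)) =
     \sum_i (emb (val xi) i ^+ 2 * tau i + 2 * emb (val xi) i * l i) +
     s * \sum_i 2 * emb (val xi) i * (j i * w i).
    rewrite mulr_sumr -big_split; apply: eq_bigr => i _ /=; rewrite dual_point_shift -/w /l; ring.
  ring.
have -> : qterm P tau l k xi * cexp d - qterm P tau l k xi - s * (qterm P tau l k xi * (ipi R * a)) =
   qterm P tau l k xi * (cexp d - 1 - d + ipi R * (s ^+ 2 * b)) by rewrite /d; ring.
rewrite cabsM; set S := cabs s.
have S0 : 0 <= S by exact: cabs_ge0.
have dS : cabs d <= S * (2 * x).
  rewrite /d cabs_ipi; apply: le_trans (ler_wpM2l (ltW p0) (cabsD _ _)) _.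
  rewrite !(cabsX, cabsM) -/S.
  have h : S ^+ 2 <= S by rewrite expr2 ler_piMr.
  have := ler_wpM2l S0 aA; have := ler_wpM2r (mulr_ge0 (ltW p0) (cabs_ge0 b)) h; have := ler_wpM2l S0 bA.
  lra.
have d2x : cabs d <= 2 * x by apply: le_trans dS _; rewrite ler_piMl // mulr_ge0.
have ed : expR (cabs d) <= E * E by rewrite /E -expRD ler_expR; apply: le_trans d2x _; lra.
have main : cabs (cexp d - 1 - d + ipi R * (s ^+ 2 * b)) <= 25 * expR (3 * x) * S ^+ 2.
  apply: le_trans (cabsD _ _) _; rewrite cabs_ipi cabsM cabsX -/S.
  apply: le_trans (lerD (cexp_sub1D d) (lexx _)) _.
  have h1 : 3 * cabs d ^+ 2 * expR (cabs d) <= 3 * (S * (2 * x)) ^+ 2 * (E * E).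
    have Sx0 : 0 <= S * (2 * x) := mulr_ge0 S0 (mulr_ge0 (ler0n R 2) x0).
    have dsq : cabs d ^+ 2 <= (S * (2 * x)) ^+ 2.
      by apply: lerXn2r; rewrite ?nnegrE ?cabs_ge0.
    apply: ler_pM; [by rewrite mulr_ge0 // sqr_ge0|exact: expR_ge0|exact: ler_wpM2l|exact: ed].
  have h2 : pi * (S ^+ 2 * cabs b) <= S ^+ 2 * x by rewrite mulrCA ler_wpM2l ?sqr_ge0.
  apply: le_trans (lerD h1 h2) _.
  have -> : 3 * (S * (2 * x)) ^+ 2 * (E * E) + S ^+ 2 * x = (12 * (x ^+ 2 * (E * E)) + x) * S ^+ 2 by ring.
  apply: ler_wpM2r; first exact: sqr_ge0.
  rewrite exE.
  have EE : 1 <= E * E by nra.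
  have := ler_wpM2r (mulr_ge0 (ltW E0) (ltW E0)) e3; nra.
apply: le_trans (ler_wpM2l (cabs_ge0 _) main) _; rewrite mulrA.
apply: ler_wpM2r; first exact: sqr_ge0.
by apply: maj => //; rewrite mulr_ge0 ?expR_ge0.
Qed.

(** The exponent moves by at most h X with X quadratic in xi; for h <= eta it
    costs a factor exp(2 eta X), which a part of the Gaussian decay absorbs. *)
Lemma theta_continuous tau0 l0 k0 : (forall i, 0 < complex.Im (tau0 i)) ->
  exists2 eta : R, 0 < eta & exists2 M : R, 0 <= M & forall tau l k (h : R), 0 <= h -> h <= eta ->
    (forall i, cabs (tau i - tau0 i) <= h) -> (forall i, cabs (l i - l0 i) <= h) ->
    cabs (k - k0) <= h -> cabs (Th P tau l k - Th P tau0 l0 k0) <= M * h.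
Proof.
move=> htau.
have [y y0 hy] := Im_lower_bound htau.
have [K K0 [lK kK]] := parameter_bound l0 k0.
pose eta := y / 4; have eta0 : 0 < eta by rewrite divr_gt0.
have p0 := @pi_gt0 R.
have c0 : 0 < pi * y - 2 * eta * pi by rewrite /eta; nra.
have [M M0 hM] := quad_exp_majorant P (2 * pi * K + 4 * eta * pi) c0
  (mulr_ge0 (expR_ge0 (pi * K)) (mulr_ge0 (ler0n R 7) (expR_ge0 (2 * eta * pi)))).
have [S hS] := norm1_exp_summable P M0.
have S0 : 0 <= S by have := hS fset0; rewrite big_nil.
exists eta => //; exists (S / eta); first by rewrite divr_ge0 // ltW.
move=> tau l k h h0 he ht hl hk.
have htau' i : 0 < complex.Im (tau i).
  have := Im_le_cabs (tau i - tau0 i); rewrite raddfB /= ler_norml => /andP[h1 _].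
  have := ht i; have := hy i; have : eta < y by rewrite /eta; lra.
  lra.
have sm := qterm_summable P l k htau'; have sm0 := qterm_summable P l0 k0 htau.
have -> : Th P tau l k - Th P tau0 l0 k0 =
    tsum (fun xi => qterm P tau l k xi + -1 * qterm P tau0 l0 k0 xi).
  by rewrite tsumD ?(tsumZ _ sm0) //; [rewrite mulN1r|exact: abs_summableZ].
apply: (@tsum_bound_le _ _ _ (fun xi => M * expR (- norm1 xi) * (h / eta))); last first.
  move=> B; rewrite -mulr_suml mulrAC -mulrA; apply: ler_wpM2r; last exact: hS.
  by rewrite divr_ge0 // ltW.
move=> xi; rewrite mulN1r.
pose X := pi * (norm2 xi + 2 * norm1 xi + 1).
have n10 := norm1_ge0 P xi; have n20 := norm2_ge0 P xi.
have X0 : 0 <= X by rewrite mulr_ge0 ?(ltW p0) // !addr_ge0 // mulr_ge0.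
pose d := ipi R * (qexp P tau l k xi - qexp P tau0 l0 k0 xi).
have dX : cabs d <= h * X.
  rewrite /d cabs_ipi /X mulrCA; apply: ler_wpM2l; first exact: ltW.
  have -> : qexp P tau l k xi - qexp P tau0 l0 k0 xi =
     \sum_i (emb (val xi) i ^+ 2 * (tau i - tau0 i) + 2 * emb (val xi) i * (l i - l0 i)) + (k - k0).
    rewrite /qexp opprD addrACA -sumrB; congr (_ + _); apply: eq_bigr => i _; ring.
  apply: le_trans (cabsD _ _) _; rewrite [leRHS]mulrDr mulr1; apply: lerD => //.
  apply: le_trans (cabs_sum _ _ _) _; rewrite /norm1 /norm2 mulr_sumr -big_split mulr_sumr.
  apply: ler_sum => i _ /=; apply: le_trans (cabsD _ _) _.
  rewrite !(cabsX, cabsM) cabs_nat !cabs_emb real_normK ?num_real // mulrDr.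
  have := ler_wpM2l (sqr_ge0 (v i (val xi))) (ht i).
  have := ler_wpM2l (normr_ge0 (v i (val xi))) (hl i); lra.
have -> : qterm P tau l k xi - qterm P tau0 l0 k0 xi = qterm P tau0 l0 k0 xi * (cexp d - 1).
  by rewrite mulrBr mulr1 /qterm -cexpD; congr (cexp _ - _); rewrite /d; ring.
rewrite cabsM.
pose x := eta * X; have x0 : 0 <= x by rewrite mulr_ge0 // ltW.
have [e1 e2 e3] := expR_dominates x0; have E0 := expR_gt0 x.
have hE : h * X = h / eta * x by rewrite /x mulrA divfK // gt_eqF.
have r0 : 0 <= h / eta by rewrite divr_ge0 // ltW.
have r1 : h / eta <= 1 by rewrite ler_pdivrMr // mul1r.
have dx : cabs d <= x by apply: le_trans dX _; rewrite hE ler_piMl.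
have ed : expR (cabs d) <= expR x by rewrite ler_expR.
have db : cabs (cexp d - 1) <= h / eta * (7 * expR (2 * x)).
  apply: le_trans (cexp_sub1 d) _.
  apply: le_trans (_ : h / eta * x * (1 + 3 * x * expR x) <= _).
    apply: ler_pM; rewrite ?cabs_ge0 //.
    - by rewrite addr_ge0 // !mulr_ge0 ?cabs_ge0 ?expR_ge0.
    - by rewrite -hE.
    - rewrite lerD2l; apply: ler_pM; rewrite ?expR_ge0 ?mulr_ge0 ?cabs_ge0 //.
      by rewrite ler_wpM2l.
  rewrite -mulrA; apply: ler_wpM2l => //.
  have -> : expR (2 * x) = expR x * expR x by rewrite -expRD; congr expR; ring.
  have := ler_wpM2r (ltW E0) e3; nra.
apply: le_trans (ler_pM (cabs_ge0 _) (cabs_ge0 _) (qterm_bound P y0 K0 hy lK kK xi) db) _.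
rewrite [leLHS]mulrCA mulrC; apply: ler_wpM2r => //; apply: le_trans (hM xi).
have -> : 2 * x = 2 * eta * pi * norm2 xi + 4 * eta * pi * norm1 xi + 2 * eta * pi by rewrite /x /X; ring.
have -> : - ((pi * y - 2 * eta * pi) * norm2 xi) + (2 * pi * K + 4 * eta * pi) * norm1 xi =
  - (pi * y * norm2 xi) + 2 * pi * K * norm1 xi + (2 * eta * pi * norm2 xi + 4 * eta * pi * norm1 xi) by ring.
by rewrite le_eqVlt; apply/orP; left; apply/eqP; rewrite !expRD; ring.
Qed.

End ThetaRegularity.

(** * The elliptic functional equation under a modular substitution *)
Section ThetaTransformation.
Variables (F : fieldExtType rat) (R : realType) (P : frame F R).
Local Notation D := (\dim {:F}).
Local Notation C := R[i].
Local Notation O := (ring_of_integers F).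
Local Notation emb := (emb P).
Implicit Types (tau u q z : 'I_D -> C) (x y : 'I_D -> R) (m : 'I_D -> int).

Definition place_sum (p : F) : C := \sum_i emb p i.

Lemma place_sumE p : place_sum p = ratr (field_trace p).
Proof.
rewrite /place_sum /emb -rmorph_sum -(fplace_trace P) /=.
exact: (fmorph_eq_rat (real_complex R \o ratr)).
Qed.

Lemma emb_nat n i : emb n%:R i = n%:R.
Proof. by rewrite /emb !rmorph_nat. Qed.

Lemma basis_dual_sum i i' :
  \sum_l emb (fbasis P l) i' * emb (fdual P l) i = (i == i')%:R.
Proof.
pose Ve : 'M[C]_D := \matrix_(i, l) emb (fbasis P l) i.
pose Vf : 'M[C]_D := \matrix_(i, l) emb (fdual P l) i.
have : Ve^T *m Vf = 1%:M.
  apply/matrixP => l l'; rewrite !mxE.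
  transitivity (place_sum (fbasis P l * fdual P l')).
    by apply: eq_bigr => k _; rewrite !mxE embM.
  by rewrite place_sumE ftrace_dual rmorph_nat.
move/mulmx1C/matrixP => /(_ i i'); rewrite !mxE => <-.
by apply: eq_bigr => l _; rewrite !mxE mulrC.
Qed.

Definition int_point m : F := \sum_l (m l)%:~R * fbasis P l.

Lemma int_point_int m : O (int_point m).
Proof. by apply: ringO_sum => l _; apply: ringOM; [exact: ringO_int|exact: fbasis_int]. Qed.

Lemma emb_int_point m i : emb (int_point m) i = \sum_l (m l)%:~R * emb (fbasis P l) i.
Proof.
rewrite emb_sum; apply: eq_bigr => l _; rewrite embM; congr (_ * _).
by rewrite /emb /= !rmorph_int.
Qed.

Lemma int_point_surj (xi : F) : O xi -> exists m, xi = int_point m.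
Proof.
move=> Oxi.
have /choice[m mE] : forall l, exists n : int, field_trace (xi * fdual P l) = n%:~R.
  by move=> l; have /intrP[n nE] := fdual_codiff P l Oxi; exists n; rewrite mulrC.
exists m; rewrite [LHS](fbasis_coord P); apply: eq_bigr => l _.
by rewrite mE scaler_int mulrzl.
Qed.

(** The coordinates in the dual basis of the vector z mu, for mu the algebraic
    integer with coordinates m. *)
Definition period_vector z m : 'I_D -> C :=
  fun l => \sum_i z i * emb (int_point m) i * emb (fbasis P l) i.

Lemma dual_point_period z m i : dual_point P (period_vector z m) i = z i * emb (int_point m) i.
Proof.
rewrite /dual_point /period_vector.
under eq_bigr => l _ do rewrite mulr_suml.
rewrite exchange_big (bigD1 i) //= [X in _ + X]big1 ?addr0 => [|i' ne].
  under eq_bigr => l _ do rewrite -mulrA.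
  by rewrite -mulr_sumr basis_dual_sum eqxx mulr1.
under eq_bigr => l _ do rewrite -mulrA.
by rewrite -mulr_sumr basis_dual_sum eq_sym (negPf ne) mulr0.
Qed.

Lemma dual_pointD q q' i : dual_point P (fun l => q l + q' l) i = dual_point P q i + dual_point P q' i.
Proof. by rewrite /dual_point -big_split; apply: eq_bigr => l _; rewrite mulrDl. Qed.

Lemma int_point_pairing m x : \sum_i emb (int_point m) i * dual_point P (cvec x) i = ((dotz m x)%:C)%C.
Proof.
rewrite /dotz rmorph_sum /=.
transitivity (\sum_l \sum_l' (m l)%:~R * cvec x l' * \sum_i emb (fbasis P l) i * emb (fdual P l') i).
  under eq_bigr => i _ do rewrite emb_int_point mulr_suml.
  rewrite exchange_big; apply: eq_bigr => l _ /=.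
  under eq_bigr => i _ do rewrite mulr_sumr.
  rewrite exchange_big; apply: eq_bigr => l' _ /=; rewrite mulr_sumr.
  by apply: eq_bigr => i _; ring.
apply: eq_bigr => l _; rewrite (bigD1 l) //= [X in _ + X]big1 ?addr0 => [|l' ne].
  have -> : \sum_i emb (fbasis P l) i * emb (fdual P l) i = 1.
    transitivity (place_sum (fbasis P l * fdual P l)); first by apply: eq_bigr => i _; rewrite embM.
    by rewrite place_sumE ftrace_dual eqxx rmorph1.
  by rewrite mulr1 /cvec rmorphM /= rmorph_int.
have -> : \sum_i emb (fbasis P l) i * emb (fdual P l') i = 0.
  transitivity (place_sum (fbasis P l * fdual P l')); first by apply: eq_bigr => i _; rewrite embM.
  by rewrite place_sumE ftrace_dual eq_sym (negPf ne) rmorph0.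
by rewrite mulr0.
Qed.

Definition coord_real (p : F) : 'I_D -> R := fun l => ratr (field_trace (p * fbasis P l)).

Lemma dual_point_coord p i : dual_point P (cvec (coord_real p)) i = emb p i.
Proof.
rewrite {2}(fdual_coord P p) emb_sum; apply: eq_bigr => l _; rewrite embZ /cvec /coord_real.
by congr (_ * _); exact: (fmorph_eq_rat (real_complex R \o ratr)).
Qed.

(** ** The two theta functions attached to an element of the theta group *)

Variables (a b c d : F) (z : 'I_D -> C).
Hypothesis det1 : a * d - b * c = 1.
Hypotheses (aO : O a) (dO : O d).
Hypothesis b_even : exists2 b', codifferent F b' & b = 2 * b'.
Hypothesis c_even : forall lam, codifferent F lam -> exists2 o, O o & c * lam = 2 * o.
Hypothesis zH : forall i, 0 < complex.Im (z i).

Definition den i : C := emb c i * z i + emb d i.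
(** The two identities jfacE and jfacZ below express 1 / (c z + d) and
    z / (c z + d) through 1 and g z, with the entries of g as coefficients: they
    turn periods of the first torus into periods of the second. *)
Definition jfac i : C := (den i)^-1.
Definition mob i : C := (emb a i * z i + emb b i) / den i.

Lemma det1_emb i : emb a i * emb d i - emb b i * emb c i = 1.
Proof. by rewrite -!embM -embB det1 emb1. Qed.

Lemma den_neq0 i : den i != 0.
Proof.
apply/eqP => den0; have := det1_emb i.
have [c0|cn] := eqVneq (emb c i) 0.
  move: den0; rewrite /den c0 mul0r add0r mulr0 subr0 => ->; rewrite mulr0 => /eqP.
  by rewrite eq_sym oner_eq0.
move=> _; have zE : z i = - emb d i / emb c i.
  by apply: (mulfI cn); rewrite mulrCA mulfV // mulr1; apply/eqP; rewrite -addr_eq0; apply/eqP.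
have := zH i; rewrite zE /emb -rmorphN -fmorphV -rmorphM /=.
by rewrite ltxx.
Qed.

Lemma jfacE i : jfac i = emb a i - emb c i * mob i.
Proof.
have dn := den_neq0 i; rewrite /jfac /mob; apply: (mulIf dn); rewrite mulVf // mulrBl.
rewrite mulrA mulfVK // -(det1_emb i) /den; ring.
Qed.

Lemma jfacZ i : jfac i * z i = emb d i * mob i - emb b i.
Proof.
have dn := den_neq0 i; rewrite /jfac /mob; apply: (mulIf dn); rewrite mulrAC mulVf // mul1r mulrBl.
rewrite mulrA mulfVK // /den.
transitivity ((emb a i * emb d i - emb b i * emb c i) * z i); last by ring.
by rewrite det1_emb mul1r.
Qed.

Lemma mob_upper i : 0 < complex.Im (mob i).
Proof.
have : mob i * den i = emb a i * z i + emb b i by rewrite /mob mulfVK // den_neq0.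
have : fplace P i a * fplace P i d - fplace P i b * fplace P i c = 1.
  by apply: (@complexI R); rewrite rmorphB !rmorphM rmorph1 /= -(det1_emb i).
have := zH i; rewrite /den /emb; case: (mob i) => p q; case: (z i) => X Y /=.
set A := fplace P i a; set B := fplace P i b; set G := fplace P i c; set E := fplace P i d.
move=> Y0 det /eqP; rewrite eq_complex /= => /andP[/eqP h1 /eqP h2].
have key : q * ((G * X + E) ^+ 2 + (G * Y) ^+ 2) = Y.
  transitivity (Y * (A * E - B * G)); last by rewrite det mulr1.
  transitivity ((G * X + E) * (A * Y) - (G * Y) * (A * X + B)); last by ring.
  have e1 : A * Y = p * (G * Y) + q * (G * X + E) by move: h2; lra.
  have e2 : A * X + B = p * (G * X + E) - q * (G * Y) by move: h1; lra.
  by rewrite e1 e2; ring.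
rewrite ltNge; apply/negP => q0.
have := mulr_le0_ge0 q0 (addr_ge0 (sqr_ge0 (G * X + E)) (sqr_ge0 (G * Y))).
by rewrite key leNgt Y0.
Qed.

(** The theta series at the transformed modular variable, with l divided by
    c z + d and the Gaussian factor exp(- pi i sum c l^2 / (c z + d)): the
    function that the transformation formula compares to theta at z. *)
Definition theta_transform (u : 'I_D -> C) : C :=
  Th P mob (fun i => jfac i * u i) (- \sum_i emb c i * jfac i * u i ^+ 2).

(** Since lam / (c z + d) = a lam - (c lam) (g z), a translation by lam is a
    translation by a lam after a quasi-period of the transformed series; the
    constant that it produces is exp(pi i Tr(a c lam^2)), which is 1. *)
Lemma theta_transform_shift u (lam y : F) : O (c * lam) -> a * c * lam ^+ 2 = 2 * y ->
  field_trace y \is a Num.int ->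
  theta_transform (fun i => u i + emb lam i) =
  Th P mob (fun i => jfac i * u i + emb (a * lam) i) (- \sum_i emb c i * jfac i * u i ^+ 2).
Proof.
move=> Onu yE ytr; rewrite /theta_transform.
have -> : (fun i => jfac i * (u i + emb lam i)) =
    (fun i => (jfac i * u i + emb (a * lam) i) + emb (- (c * lam)) i * mob i).
  by apply/funext => i; rewrite embN !embM mulrDr {2}jfacE; ring.
rewrite Th_quasi; [|exact: ringON|exact: mob_upper].
have split_cst : - \sum_i emb c i * jfac i * (u i + emb lam i) ^+ 2 =
    (- \sum_i emb c i * jfac i * (2 * u i * emb lam i + emb lam i ^+ 2)) +
    - \sum_i emb c i * jfac i * u i ^+ 2.
  rewrite -opprD -big_split; congr (- _); apply: eq_bigr => i _ /=; ring.
rewrite split_cst Th_cst; last exact: mob_upper.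
rewrite mulrA -cexpD -[RHS]mul1r; congr (_ * _); rewrite -[RHS](cexp_trace_even P ytr); congr cexp.
rewrite -mulrN -mulrDr; congr (_ * _); rewrite -!sumrN -big_split mulr_sumr; apply: eq_bigr => i _ /=.
have -> : 2 * emb y i = emb a i * emb c i * emb lam i ^+ 2.
  by rewrite -(emb_nat 2 i) -embM -yE expr2 !embM; ring.
have -> : emb (- (c * lam)) i = - (emb c i * emb lam i) by rewrite embN embM.
have -> : emb (a * lam) i = emb a i * emb lam i by rewrite embM.
have -> : emb c i * jfac i * (2 * u i * emb lam i + emb lam i ^+ 2) =
   2 * (jfac i * u i) * emb c i * emb lam i + emb c i * emb lam i ^+ 2 * (emb a i - emb c i * mob i).
  by rewrite -jfacE; ring.
ring.
Qed.

Lemma theta_transform_period u (lam : F) : codifferent F lam ->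
  theta_transform (fun i => u i + emb lam i) = theta_transform u.
Proof.
move=> hlam; have [nu Onu cE] := c_even hlam.
have Oc : O (c * lam).
  by rewrite cE; apply: ringOM => //; have := @ringO_int F 2.
rewrite (@theta_transform_shift u lam (a * nu * lam)) //; last 2 first.
- rewrite expr2 [a * c * _]mulrA -[a * c * lam]mulrA cE; ring.
- by rewrite mulrC; apply: hlam; exact: ringOM.
rewrite /theta_transform Th_codiff // => y Oy.
by rewrite mulrAC mulrC; apply: hlam; exact: ringOM.
Qed.

(** Here mu z / (c z + d) = (d mu) (g z) - b mu, where b mu is in the
    codifferent; the determinant identity makes the multiplier that of the
    theta series at z. *)
Lemma theta_transform_quasi u (mu : F) : O mu ->
  theta_transform (fun i => u i + emb mu i * z i) =
  cexp (- (ipi R * \sum_i (emb mu i ^+ 2 * z i + 2 * emb mu i * u i))) * theta_transform u.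
Proof.
move=> Omu; have [b' hb' bE] := b_even.
rewrite /theta_transform.
have -> : (fun i => jfac i * (u i + emb mu i * z i)) =
    (fun i => (jfac i * u i + emb (d * mu) i * mob i) + emb (- (b * mu)) i).
  apply/funext => i; rewrite embN !embM mulrDr mulrCA jfacZ; ring.
rewrite Th_codiff; last first.
  move=> y Oy; have := hb' (- (2 * mu * y)) _; rewrite bE.
  have -> : - (2 * b' * mu) * y = b' * - (2 * mu * y) by ring.
  apply; apply: ringON; apply: ringOM => //; apply: ringOM => //; exact: (@ringO_int F 2).
rewrite Th_quasi; [|exact: ringOM|exact: mob_upper].
have split_cst : - \sum_i emb c i * jfac i * (u i + emb mu i * z i) ^+ 2 =
    (- \sum_i emb c i * jfac i * (2 * u i * (emb mu i * z i) + (emb mu i * z i) ^+ 2)) +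
    - \sum_i emb c i * jfac i * u i ^+ 2.
  rewrite -opprD -big_split; congr (- _); apply: eq_bigr => i _ /=; ring.
rewrite split_cst Th_cst; last exact: mob_upper.
rewrite mulrA -cexpD; congr (_ * _).
have ytr : field_trace (b' * (d * mu * mu)) \is a Num.int.
  by apply: hb'; apply: ringOM => //; exact: ringOM.
have one := cexp_trace_even P ytr.
rewrite -[LHS]mulr1 -[X in _ * X = _]one -cexpD; congr cexp.
rewrite -!mulrN -!mulrDr; congr (_ * _); rewrite -!sumrN mulr_sumr -!big_split; apply: eq_bigr => i _ /=.
have -> : emb (d * mu) i = emb d i * emb mu i by rewrite embM.
have -> : 2 * emb (b' * (d * mu * mu)) i = emb b i * emb d i * emb mu i ^+ 2.
  rewrite bE !embM emb_nat; ring.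
have j2 : jfac i * den i = 1 by rewrite /jfac mulVf ?den_neq0.
have j3 : mob i * den i = emb a i * z i + emb b i by rewrite /mob mulfVK // den_neq0.
transitivity (- (2 * emb mu i * u i) * (jfac i * den i) - emb mu i ^+ 2 *
   (emb d i ^+ 2 * mob i + emb c i * z i * (jfac i * z i) - emb b i * emb d i)).
  by rewrite /den; ring.
rewrite j2 jfacZ.
have -> : emb d i ^+ 2 * mob i + emb c i * z i * (emb d i * mob i - emb b i) - emb b i * emb d i =
   emb d i * (mob i * den i) - emb b i * den i by rewrite /den; ring.
rewrite j3 /den.
transitivity (- (2 * emb mu i * u i) - emb mu i ^+ 2 *
   ((emb a i * emb d i - emb b i * emb c i) * z i)); first by ring.
by rewrite det1_emb; ring.
Qed.

(** Both theta functions are sections of the same line bundle over the torus,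
    whose space of sections is one-dimensional. *)
Theorem theta_transform_proportional (p p' : F) :
  Th P z (emb p) 0 * theta_transform (emb p') = Th P z (emb p') 0 * theta_transform (emb p).
Proof.
pose E m := cexp (- (ipi R * \sum_i emb (int_point m) i ^+ 2 * z i)).
pose G1 q := Th P z (fun i => 1 * dual_point P q i) (- \sum_i 0 * dual_point P q i ^+ 2).
pose G2 q := theta_transform (dual_point P q).
have G1E q : G1 q = Th P z (dual_point P q) 0.
  have e1 : (fun i => 1 * dual_point P q i) = dual_point P q.
    by apply/funext => i; rewrite mul1r.
  have e2 : - \sum_i 0 * dual_point P q i ^+ 2 = 0 by rewrite big1 ?oppr0 // => i _; rewrite mul0r.
  by rewrite /G1 e1 e2.
have shiftE q l s : dual_point P (shift q l s) = fun i => dual_point P q i + s * emb (fdual P l) i.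
  by apply/funext => i; rewrite dual_point_shift.
have periodE x m : dual_point P (fun l => cvec x l + period_vector z m l) =
    fun i => dual_point P (cvec x) i + emb (int_point m) i * z i.
  by apply/funext => i; rewrite dual_pointD dual_point_period [z i * _]mulrC.
have EcisE m x : cexp (- (ipi R * \sum_i (emb (int_point m) i ^+ 2 * z i +
      2 * emb (int_point m) i * dual_point P (cvec x) i))) = E m * cis (- dotz m x).
  rewrite /E /cis -cexpD; congr cexp; rewrite big_split mulrDr opprD; congr (_ + _).
  have -> : \sum_i 2 * emb (int_point m) i * dual_point P (cvec x) i = 2 * ((dotz m x)%:C)%C.
    by rewrite -int_point_pairing mulr_sumr; apply: eq_bigr => i _; rewrite mulrA.
  rewrite /ipi -(rmorph_nat (real_complex R)) -rmorphM /=.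
  apply/eqP; rewrite eq_complex /=; apply/andP; split; apply/eqP; ring.
have hol1 : locally_holomorphic G1 := @theta_holomorphic F R P z (fun=> 1) (fun=> 0) zH.
have hol2 : locally_holomorphic G2 :=
  @theta_holomorphic F R P mob jfac (fun i => emb c i * jfac i) mob_upper.
have per1 : int_periodic G1.
  move=> q l; rewrite !G1E shiftE.
  rewrite (_ : (fun i => _) = fun i => dual_point P q i + emb (fdual P l) i).
    by rewrite Th_codiff //; exact: fdual_codiff.
  by apply/funext => i; rewrite mul1r.
have per2 : int_periodic G2.
  move=> q l; rewrite /G2 shiftE.
  rewrite (_ : (fun i => _) = fun i => dual_point P q i + emb (fdual P l) i).
    by rewrite theta_transform_period //; exact: fdual_codiff.
  by apply/funext => i; rewrite mul1r.
have qp1 : quasi_periodic E (period_vector z) G1.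
  move=> m x; rewrite !G1E periodE Th_quasi //; last exact: int_point_int.
  by rewrite EcisE.
have qp2 : quasi_periodic E (period_vector z) G2.
  move=> m x; rewrite /G2 periodE theta_transform_quasi; last exact: int_point_int.
  by rewrite EcisE.
have E0 m : E m != 0 by exact: cexp_neq0.
have := quasi_periodic_unique E0 (coord_real p) (coord_real p') hol1 per1 qp1 hol2 per2 qp2.
rewrite !G1E /G2.
have -> : dual_point P (cvec (coord_real p)) = emb p by apply/funext => i; rewrite dual_point_coord.
by have -> : dual_point P (cvec (coord_real p')) = emb p' by apply/funext => i; rewrite dual_point_coord.
Qed.

End ThetaTransformation.

(** * Finite Fourier analysis and rational translations *)
Section FiniteFourier.
Variables (R : realType) (D N : nat).
Local Notation C := R[i].
Local Notation box := {ffun 'I_D -> 'I_N.+1}.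
Implicit Types (m k : 'I_D -> int) (g h : box).

Definition zbox g : 'I_D -> int := fun l => (g l)%:Z.

Definition box_periodic (phi : ('I_D -> int) -> C) :=
  forall m k, phi (fun l => m l + N.+1%:Z * k l) = phi m.

(** Reduction modulo N+1 turns a translation into a permutation of the box. *)
Lemma sum_box_shift phi m : box_periodic phi ->
  \sum_g phi (fun l => zbox g l + m l) = \sum_g phi (zbox g).
Proof.
move=> per; pose T g : box := [ffun l => inord `|(((g l)%:Z + m l) %% N.+1%:Z)%Z|%N].
have TE g l : zbox (T g) l = (((g l)%:Z + m l) %% N.+1%:Z)%Z.
  have h0 : 0 <= (((g l)%:Z + m l) %% N.+1%:Z)%Z by exact: modz_ge0.
  have h1 : (((g l)%:Z + m l) %% N.+1%:Z)%Z < N.+1%:Z by exact: ltz_pmod.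
  rewrite /zbox ffunE inordK; first by rewrite gez0_abs.
  by rewrite -ltz_nat gez0_abs.
have T_inj : injective T.
  move=> g g' e; apply/ffunP => l; apply: val_inj; apply/eqP.
  have := TE g l; rewrite e TE => /eqP; rewrite eqz_modDr !modz_nat eqz_nat !modn_small //.
  by rewrite eq_sym.
rewrite [RHS](reindex_inj T_inj) /=; apply: eq_bigr => g _.
rewrite -(per (zbox (T g)) (fun l => (((g l)%:Z + m l) %/ N.+1%:Z)%Z)); congr phi.
apply/funext => l; rewrite TE [LHS](divz_eq _ N.+1%:Z) addrC [X in _ + X]mulrC.
by [].
Qed.

Lemma dotzD m k (y : 'I_D -> R) : dotz (fun l => m l + k l) y = dotz m y + dotz k y.
Proof. by rewrite /dotz -big_split; apply: eq_bigr => l _; rewrite intrD mulrDl. Qed.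

Lemma dotzB m k (y : 'I_D -> R) : dotz (fun l => m l - k l) y = dotz m y - dotz k y.
Proof. by rewrite /dotz -sumrB; apply: eq_bigr => l _; rewrite intrB mulrBl. Qed.

Lemma dotz_grid m g : exists n : int, dotz (fun l => N.+1%:Z * m l) (gridpt R g) = n%:~R.
Proof.
exists (\sum_l m l * (g l)%:Z); rewrite rmorph_sum; apply: eq_bigr => l _ /=.
have N0 : N.+1%:R != 0 :> R by rewrite pnatr_eq0.
rewrite /gridpt !intrM -[(Posz N.+1)%:~R]/(N.+1%:R : R) -[(Posz (g l))%:~R]/((g l)%:R : R).
by rewrite [_ * (m l)%:~R]mulrC -mulrA; congr (_ * _); rewrite mulrCA mulfV // mulr1.
Qed.

Lemma cis_dotz_periodic g : box_periodic (fun m => cis (- dotz m (gridpt R g))).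
Proof.
move=> m k; rewrite dotzD; have [n ->] := dotz_grid k g.
by rewrite opprD -mulrNz cisDint.
Qed.

Definition fourier_coef (phi : ('I_D -> int) -> C) g : C :=
  N.+1%:R^-1 ^+ D * \sum_h phi (zbox h) * cis (- dotz (zbox h) (gridpt R g)).

(** A translation that fixes phi multiplies the coefficient at g by a root of
    unity, which must be 1 when the coefficient is nonzero. *)
Lemma fourier_coef_invariant phi g m : box_periodic phi ->
  (forall k, phi (fun l => k l + m l) = phi k) -> fourier_coef phi g != 0 ->
  exists n : int, dotz m (gridpt R g) = n%:~R.
Proof.
move=> per inv cn0; pose Fn k := phi k * cis (- dotz k (gridpt R g)).
have perF : box_periodic Fn.
  by move=> k k'; rewrite /Fn per cis_dotz_periodic.
have e : fourier_coef phi g = cis (- dotz m (gridpt R g)) * fourier_coef phi g.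
  rewrite /fourier_coef -[in LHS](sum_box_shift m perF) mulrCA; congr (_ * _).
  rewrite mulr_sumr; apply: eq_bigr => h _; rewrite /Fn inv dotzD opprD cisD; ring.
have c1 : cis (- dotz m (gridpt R g)) = 1 by apply: (mulIf cn0); rewrite mul1r -e.
have [n nE] := cis_eq1 c1; exists (- n); by rewrite mulrNz -nE opprK.
Qed.

Lemma sum_cis_box h : \sum_(g : box) cis (- dotz (zbox h) (gridpt R g)) =
  if h == [ffun=> ord0] then (N.+1%:R ^+ D : C) else 0.
Proof.
have -> : \sum_(g : box) cis (- dotz (zbox h) (gridpt R g)) =
   \prod_l \sum_(a < N.+1) cis ((- (h l)%:Z)%:~R * (a%:R / N.+1%:R)) :> C.
  rewrite bigA_distr_bigA; apply: eq_bigr => g _; rewrite /dotz -sumrN cis_sum.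
  by apply: eq_bigr => l _; rewrite mulrNz mulNr.
case: eqP => [->|/eqP hn].
  rewrite -[X in _ ^+ X]card_ord -prodr_const; apply: eq_bigr => l _.
  under eq_bigr => a _ do rewrite ffunE oppr0 mul0r cis0.
  by rewrite sumr_const card_ord.
have [l hl] : exists l, h l != ord0.
  apply/existsP; rewrite -negb_forall; apply: contra hn => /forallP hl.
  by apply/eqP/ffunP => l; rewrite ffunE; apply/eqP; exact: hl.
rewrite (bigD1 l) //= sum_cis_ord ?mul0r //; first by rewrite abszN /= ltn_ord.
by rewrite oppr_eq0 eqz_nat.
Qed.

Lemma fourier_inversion phi m : box_periodic phi ->
  phi m = \sum_g fourier_coef phi g * cis (dotz m (gridpt R g)).
Proof.
move=> per; pose Fn (k : 'I_D -> int) := phi k * \sum_(g : box) cis (dotz (fun l => m l - k l) (gridpt R g)).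
have perF : box_periodic Fn.
  move=> k k'; rewrite /Fn per; congr (_ * _); apply: eq_bigr => g _.
  by rewrite !dotzB !cisD (cis_dotz_periodic g k k').
transitivity (N.+1%:R^-1 ^+ D * \sum_h Fn (zbox h)); last first.
  rewrite /Fn /fourier_coef; under [RHS]eq_bigr => g _ do rewrite -mulrA mulr_suml.
  rewrite -mulr_sumr exchange_big; congr (_ * _); apply: eq_bigr => h _ /=.
  rewrite mulr_sumr; apply: eq_bigr => g _; rewrite dotzB cisD; ring.
rewrite -(sum_box_shift m perF) (bigD1 [ffun=> ord0]) //= [X in _ + X]big1 => [|h hn].
  rewrite addr0 /Fn (_ : (fun l => _) = m); last first.
    by apply/funext => l; rewrite /zbox ffunE add0r.
  have -> : (fun l => m l - (zbox [ffun=> ord0] l + m l)) = fun l => m l - m l.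
    by apply/funext => l; rewrite /zbox ffunE add0r.
  under eq_bigr => g _ do rewrite dotzB subrr cis0.
  rewrite sumr_const card_ffun !card_ord natrX exprVn mulrCA mulVf ?mulr1 //.
have -> : Fn (fun l => zbox h l + m l) = phi (fun l => zbox h l + m l) *
    \sum_(g : box) cis (- dotz (zbox h) (gridpt R g)).
  by congr (_ * _); apply: eq_bigr => g _; rewrite dotzB dotzD; congr cis; ring.
by rewrite sum_cis_box (negPf hn) mulr0.
Qed.

End FiniteFourier.

Section LevelTransformation.
Variables (F : fieldExtType rat) (R : realType) (P : frame F R).
Local Notation D := (\dim {:F}).
Local Notation C := R[i].
Local Notation O := (ring_of_integers F).
Local Notation emb := (emb P).
Implicit Types (m : 'I_D -> int) (z : 'I_D -> C).

Lemma cis_trace (y : F) : cis (ratr (field_trace y)) = cexp (ipi R * (2 * place_sum P y)).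
Proof.
rewrite place_sumE /cis; congr cexp.
have -> : ratr (field_trace y) = ((ratr (field_trace y) : R)%:C)%C :> C.
  exact: (esym (fmorph_eq_rat (real_complex R \o ratr) _)).
rewrite /ipi -(rmorph_nat (real_complex R)) -rmorphM /=.
by apply/eqP; rewrite eq_complex /=; apply/andP; split; apply/eqP; ring.
Qed.

Lemma int_pointD m m' : int_point P (fun l => m l + m' l) = int_point P m + int_point P m'.
Proof. by rewrite /int_point -big_split; apply: eq_bigr => l _; rewrite intrD mulrDl. Qed.

Lemma int_pointZ (N : int) m : int_point P (fun l => N * m l) = N%:~R * int_point P m.
Proof. by rewrite /int_point mulr_sumr; apply: eq_bigr => l _; rewrite intrM mulrA. Qed.

(** The point of the inverse different divided by N+1 that defines, through the
    trace, the character of frequency g on the algebraic integers. *)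
Definition torsion_point N (g : {ffun 'I_D -> 'I_N.+1}) : F :=
  \sum_l ((g l)%:R / N.+1%:R : rat) *: fdual P l.

Lemma torsion_point_trace N (g : {ffun 'I_D -> 'I_N.+1}) m :
  dotz m (gridpt R g) = ratr (field_trace (torsion_point g * int_point P m)).
Proof.
have -> : ratr (field_trace (torsion_point g * int_point P m)) =
    complex.Re (place_sum P (torsion_point g * int_point P m)).
  rewrite place_sumE -[ratr _ in RHS](fmorph_eq_rat (real_complex R \o ratr)) //=.
have -> : place_sum P (torsion_point g * int_point P m) =
    \sum_i emb (int_point P m) i * dual_point P (cvec (gridpt R g)) i.
  apply: eq_bigr => i _; rewrite embM mulrC; congr (_ * _).
  rewrite /torsion_point emb_sum /dual_point; apply: eq_bigr => l _; rewrite embZ; congr (_ * _).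
  by rewrite /cvec /gridpt rmorphM fmorphV /= !rmorph_nat rmorphM fmorphV /= !rmorph_nat.
by rewrite int_point_pairing.
Qed.

Lemma Th_twist z (s : F) :
  Th P z (emb s) 0 = tsum (fun xi : O => cexp (ipi R * (2 * place_sum P (s * val xi))) * qterm P z (fun=> 0) 0 xi).
Proof.
congr tsum; apply/funext => xi; rewrite /qterm -cexpD -mulrDr; congr (cexp (_ * _)).
rewrite /qexp /place_sum mulr_sumr addrA -big_split /=; congr (_ + _); apply: eq_bigr => i _.
rewrite embM; ring.
Qed.

(** Expanding phi into characters xi |-> exp(2 pi i Tr(s xi)) turns a theta
    series weighted by phi into a combination of theta values at the torsion
    points s. *)
Lemma theta_fourier N (phi : F -> C) tau (e : F) :
  box_periodic N (fun m => phi (int_point P m)) -> (forall i, 0 < complex.Im (tau i)) -> O e ->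
  \sum_(g : {ffun 'I_D -> 'I_N.+1}) fourier_coef (fun m => phi (int_point P m)) g *
    Th P tau (emb (e * torsion_point g)) 0 =
  tsum (fun xi : O => phi (e * val xi) * qterm P tau (fun=> 0) 0 xi).
Proof.
move=> per htau Oe; pose cf := fourier_coef (N := N) (fun m => phi (int_point P m)).
have phi_exp xi : O xi -> phi xi = \sum_g cf g * cexp (ipi R * (2 * place_sum P (torsion_point g * xi))).
  move=> /(int_point_surj P)[m ->]; rewrite [LHS](fourier_inversion m per).
  by apply: eq_bigr => g _; rewrite torsion_point_trace cis_trace.
have sm (g : {ffun 'I_D -> 'I_N.+1}) : abs_summable (fun xi : O =>
    cexp (ipi R * (2 * place_sum P (e * torsion_point g * val xi))) * qterm P tau (fun=> 0) 0 xi).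
  have [K hK] := qterm_summable P (emb (e * torsion_point g)) 0 htau; exists K => B.
  apply: le_trans (hK B); apply: ler_sum => xi _; rewrite le_eqVlt; apply/orP; left; apply/eqP.
  congr cabs; rewrite /qterm -cexpD -mulrDr; congr (cexp (_ * _)).
  rewrite /qexp /place_sum mulr_sumr addrA -big_split /=; congr (_ + _); apply: eq_bigr => i _.
  rewrite [emb (_ * val xi) i]embM; ring.
under eq_bigr => g _ do rewrite Th_twist -(tsumZ _ (sm g)).
rewrite -tsum_fin; last by move=> g; apply: abs_summableZ.
congr tsum; apply/funext => xi.
under eq_bigr => g _ do rewrite mulrA.
rewrite -mulr_suml; congr (_ * _); rewrite phi_exp; last by apply: ringOM => //; exact: intOP.
by apply: eq_bigr => g _; rewrite [e * _ * _]mulrAC [torsion_point g * _]mulrC mulrA.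
Qed.

Lemma Th_translate z (y : F) :
  Th P (fun i => z i + emb y i) (fun=> 0) 0 =
  tsum (fun xi : O => cexp (ipi R * place_sum P (y * val xi ^+ 2)) * qterm P z (fun=> 0) 0 xi).
Proof.
congr tsum; apply/funext => xi; rewrite /qterm -cexpD -mulrDr; congr (cexp (_ * _)).
rewrite /qexp /place_sum addrA -big_split /=; congr (_ + _); apply: eq_bigr => i _.
rewrite embM [val xi ^+ 2]expr2 embM; ring.
Qed.

Variables (a b c d : F) (z : 'I_D -> C).
Hypothesis det1 : a * d - b * c = 1.
Hypotheses (aO : O a) (dO : O d).
Hypothesis b_even : exists2 b', codifferent F b' & b = 2 * b'.
Hypothesis zH : forall i, 0 < complex.Im (z i).

Variable n : set F.
Hypothesis n_ideal : integral_ideal n.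

(** s lies in the dual of n for the trace form, that is in the product of the
    codifferent and the inverse of n. *)
Definition ideal_dual (s : F) := forall nu, n nu -> codifferent F (nu * s).

Hypothesis c_level : forall s, ideal_dual s ->
  O (c * s) /\ exists2 q, codifferent F q & c * s * s = 2 * q.

Variables (r t w' : F) (J : C).
Hypotheses (rO : O r) (tO : O t) (w_dual : ideal_dual w') (t_congr : n (t - d ^+ 2 * r)).
Hypothesis transformJ : forall p, theta_transform P a b c d z (emb p) = J * Th P z (emb p) 0.

Lemma codiffM x y : codifferent F x -> O y -> codifferent F (x * y).
Proof. by move=> hx Oy k Ok; rewrite -mulrA; apply: hx; exact: ringOM. Qed.

Lemma codiffD x y : codifferent F x -> codifferent F y -> codifferent F (x + y).
Proof.
by move=> hx hy k Ok; rewrite mulrDl field_traceD rpredD ?hx ?hy.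
Qed.

(** exp(pi i Tr(t w xi^2)), the factor by which the translation z + t w changes
    the term of index xi of the theta series; here w = 2 w'. *)
Definition phase (xi : F) : C := cexp (ipi R * place_sum P (t * (2 * w') * xi ^+ 2)).

Lemma place_sumD x y : place_sum P (x + y) = place_sum P x + place_sum P y.
Proof. by rewrite /place_sum -big_split; apply: eq_bigr => i _; rewrite embD. Qed.

Lemma place_sum2 x : place_sum P (2 * x) = 2 * place_sum P x.
Proof. by rewrite /place_sum mulr_sumr; apply: eq_bigr => i _; rewrite embM emb_nat. Qed.

Lemma cexp_place_even x y q : x = y + 2 * q -> codifferent F q ->
  cexp (ipi R * place_sum P x) = cexp (ipi R * place_sum P y).
Proof.
move=> -> hq; rewrite place_sumD place_sum2 mulrDr cexpD.
by rewrite [X in _ * X](cexp_trace_even P (y := q)) ?mulr1 // -[q]mulr1; apply: hq; exact: ringO1.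
Qed.

Lemma ringO2 : O 2. Proof. exact: (@ringO_int F 2). Qed.

Lemma phase_periodic xi nu : O xi -> n nu -> phase (xi + nu) = phase xi.
Proof.
move=> Oxi hnu; have Onu : O nu by case: n_ideal => h _ _ _; exact: h.
apply: (cexp_place_even (q := nu * w' * (t * (2 * xi + nu)))); first by ring.
apply: codiffM; first exact: w_dual.
apply: ringOM => //; apply: ringOD => //; apply: ringOM => //; exact: ringO2.
Qed.

(** Substituting a xi turns t into a^2 t, which is r modulo n because
    (a d)^2 = (1 + b c)^2 and the terms with b c have even trace. *)
Lemma phase_transform xi : O xi -> phase (a * xi) = cexp (ipi R * place_sum P (r * (2 * w') * xi ^+ 2)).
Proof.
move=> Oxi; have [b' hb' bE] := b_even; have [Ocw _] := c_level w_dual.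
have ad : a * d = 1 + b * c by rewrite -det1; ring.
apply: (cexp_place_even (q := (t - d ^+ 2 * r) * w' * (a * a * (xi * xi)) +
   b' * (r * (c * w') * (2 * (1 + a * d)) * (xi * xi)))).
  transitivity (2 * w' * xi ^+ 2 * ((t - d ^+ 2 * r) * (a * a) + r * (a * d) ^+ 2)); first by ring.
  have -> : (a * d) ^+ 2 = 1 + b * c * (1 + a * d) by rewrite [in RHS]ad {1}ad; ring.
  by rewrite bE; ring.
apply: codiffD; apply: codiffM => //; first exact: w_dual.
- by apply: ringOM; exact: ringOM.
- apply: ringOM; last exact: ringOM.
  apply: ringOM; first exact: ringOM.
  apply: ringOM; first exact: ringO2.
  by apply: ringOD; [exact: ringO1|exact: ringOM].
Qed.

Lemma ideal_nat : exists N : nat, n N.+1%:R.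
Proof.
case: n_ideal => nO [x0 nx0 x0n] _ nM.
have [k k0 Ok] := integral_multiple (x0^-1).
have nk : n k%:~R by rewrite -[k%:~R](mulfVK x0n); apply: nM.
have : (0 < `|k|)%N by rewrite absz_gt0.
case E : `|k|%N => [//|N] _; exists N; rewrite -E.
have [kp|kn] := leP 0 k; first by rewrite -[(_)%:R]/((`|k|%N)%:Z%:~R) gez0_abs.
rewrite -[(_)%:R]/((`|k|%N)%:Z%:~R) ltz0_abs // mulrNz -mulN1r; apply: nM => //.
by apply: ringON; exact: ringO1.
Qed.

(** Both sides expand over the frequencies s of the phase, with the same
    coefficients. Only frequencies in the dual of n occur, because the phase has
    period n; for them c s is integral, and the transformed theta series at s is
    the theta series at g z and a s. So the proportionality factor J applies to
    each term. *)
Theorem theta_shift_transform :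
  Th P (fun i => mob P a b c d z i + emb (r * (2 * w')) i) (fun=> 0) 0 =
  J * Th P (fun i => z i + emb (t * (2 * w')) i) (fun=> 0) 0.
Proof.
have [nO _ nD nM] := n_ideal; have [N nN] := ideal_nat.
have mobH := mob_upper P det1 zH.
pose Phi m := phase (int_point P m).
have Phi_inv m m0 : n (int_point P m0) -> Phi (fun l => m l + m0 l) = Phi m.
  by move=> hm; rewrite /Phi int_pointD phase_periodic //; exact: int_point_int.
have per : box_periodic N Phi.
  move=> m k; apply: Phi_inv; rewrite int_pointZ mulrC; apply: nM => //; exact: int_point_int.
pose cf := fourier_coef (N := N) Phi.
have cf_dual g : cf g != 0 -> ideal_dual (torsion_point g).
  move=> cg nu hnu y Oy.
  have nuy : n (nu * y) by rewrite mulrC; apply: nM.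
  have [m mE] := int_point_surj P (nO _ nuy).
  have inv k : Phi (fun l => k l + m l) = Phi k by apply: Phi_inv; rewrite -mE.
  have [q qE] := fourier_coef_invariant per inv cg.
  move: qE; rewrite torsion_point_trace -mE => qE.
  have -> : nu * torsion_point g * y = torsion_point g * (nu * y) by ring.
  by move: qE; rewrite -(ratr_int R) => /fmorph_inj ->; exact: intr_int.
have twist := theta_fourier per.
have zside : \sum_g cf g * Th P z (emb (1 * torsion_point g)) 0 =
    Th P (fun i => z i + emb (t * (2 * w')) i) (fun=> 0) 0.
  rewrite (twist _ _ zH (ringO1 F)) Th_translate; congr tsum; apply/funext => xi.
  by rewrite mul1r.
have mobside : \sum_g cf g * Th P (mob P a b c d z) (emb (a * torsion_point g)) 0 =
    Th P (fun i => mob P a b c d z i + emb (r * (2 * w')) i) (fun=> 0) 0.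
  rewrite (twist _ _ mobH aO) Th_translate; congr tsum; apply/funext => xi.
  by rewrite phase_transform //; exact: intOP.
rewrite -zside -mobside mulr_sumr; apply: eq_bigr => g _.
have [->|cg] := eqVneq (cf g) 0; first by rewrite !mul0r mulr0.
rewrite mulrCA; congr (_ * _); rewrite mul1r -transformJ.
have gdual := cf_dual g cg; have [Ocs [q hq qE]] := c_level gdual.
have e0 : emb (torsion_point g) = fun i => (fun=> 0) i + emb (torsion_point g) i.
  by apply/funext => i; rewrite add0r.
rewrite e0 (@theta_transform_shift F R P a b c d z det1 zH (fun=> 0) (torsion_point g) (q * a)) //; first last.
- by apply: hq.
- transitivity (a * (c * torsion_point g * torsion_point g)); first by ring.
  by rewrite qE; ring.
have eL : (fun i => jfac P c d z i * 0 + emb (a * torsion_point g) i) = emb (a * torsion_point g).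
  by apply/funext => i; rewrite mulr0 add0r.
have eK : - \sum_i emb c i * jfac P c d z i * 0 ^+ 2 = 0 :> C.
  by rewrite big1 ?oppr0 // => i _; rewrite expr0n mulr0.
by rewrite eL eK.
Qed.

End LevelTransformation.

(** * The level subgroup *)
Section LevelSubgroup.
Variable F : fieldExtType rat.
Local Notation O := (ring_of_integers F).
Local Notation codiff := (codifferent F).
Implicit Types (A B : 'M[F]_2) (I J K : set F).

Lemma ideal_mul_min I J K : K 0 -> (forall x y, K x -> K y -> K (x + y)) ->
  (forall x y, I x -> J y -> K (x * y)) -> ideal_mul I J `<=` K.
Proof.
move=> K0 KD KM x [s hs ->]; elim: s hs => [|p s IH] hs; first by rewrite big_nil.
rewrite big_cons; apply: KD; last by apply: IH => q qs; apply: hs; rewrite inE qs orbT.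
by apply: KM; have [] := hs p (mem_head _ _).
Qed.

Lemma ideal_mulSl I J K : I `<=` J -> ideal_mul I K `<=` ideal_mul J K.
Proof. by move=> IJ x [s hs ->]; exists s => // p /hs[/IJ]. Qed.

Lemma codiff0 : codiff 0.
Proof. by move=> y _; rewrite mul0r field_trace0. Qed.

Variables m n : set F.
Hypotheses (n_ideal : integral_ideal n) (m_div4 : m `<=` ideal_scale 4 O).
Local Notation level := (ideal_mul m (ideal_mul n n)).

Lemma ideal0 : n 0.
Proof.
by case: n_ideal => _ [x nx _] _ nM; rewrite -(mul0r x); apply: nM => //; exact: ringO0.
Qed.

Lemma ideal_dual_codiff (s : F) : codiff s -> ideal_dual n s.
Proof.
case: n_ideal => nO _ _ _ hs nu /nO Onu; rewrite mulrC; exact: codiffM.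
Qed.

Lemma ideal_dual_mul_inv (s : F) : ideal_mul codiff (ideal_inv n) s -> ideal_dual n s.
Proof.
move: s; apply: ideal_mul_min => [nu _|x y hx hy nu hnu|x y hx hy nu hnu].
- rewrite mulr0; exact: codiff0.
- by rewrite mulrDr; apply: codiffD; [exact: hx|exact: hy].
- have -> : nu * (x * y) = x * (y * nu) by ring.
  by apply: codiffM => //; exact: hy.
Qed.

(** One factor n of the level cancels the denominator of s, the factor different
    then cancels the codifferent, the factor m contributes 4, and the second
    factor n keeps the result in n. *)
Lemma level_different_dual (x s : F) : ideal_mul level (different F) x -> ideal_dual n s ->
  exists2 y, n y & x * s = 4 * y.
Proof.
case: n_ideal => nO _ nD nM xI sD; move: x xI.
have K0 (k : F) : exists2 y, n y & 0 * k = 4 * y.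
  by exists 0; rewrite ?mul0r ?mulr0 //; exact: ideal0.
have KD (k x y : F) : (exists2 o, n o & x * k = 4 * o) -> (exists2 o, n o & y * k = 4 * o) ->
    exists2 o, n o & (x + y) * k = 4 * o.
  move=> [ox hx ex] [oy hy ey]; exists (ox + oy); first exact: nD.
  by rewrite mulrDl ex ey mulrDr.
apply: ideal_mul_min => [|x y|x del xI del_dif]; [exact: K0|exact: KD|].
rewrite -mulrA; move: x xI; apply: ideal_mul_min => [|x y|x y /m_div4 [k Ok <-]]; [exact: K0|exact: KD|].
rewrite -[_ * y * _]mulrA -[4 * k * _]mulrA => yI.
suff [y' ny' ->] : exists2 y', n y' & y * (del * s) = y'.
  by exists (k * y') => //; exact: nM.
move: y yI; apply: ideal_mul_min => [|x' y' [y1 h1 e1] [y2 h2 e2]|nu nu' hnu hnu'].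
- by exists 0; rewrite ?mul0r //; exact: ideal0.
- by exists (y1 + y2); [exact: nD|rewrite mulrDl e1 e2].
- exists (del * (nu' * s) * nu); last by ring.
  by apply: nM => //; apply: del_dif; exact: sD.
Qed.

Lemma level_pairing (c s : F) : ideal_scale 2^-1 (ideal_mul level (different F)) c ->
  ideal_dual n s -> exists2 y, n y & c * s = 2 * y.
Proof.
move=> [x xI <-] sD; have [y ny e] := level_different_dual xI sD; exists y => //.
have two0 : (2 : F) != 0.
  by rewrite -(rmorph_nat (in_alg F) 2) /= scaler_eq0 oner_eq0 orbF.
by rewrite -mulrA e (_ : 4 * y = 2 * (2 * y)) ?mulKf //; ring.
Qed.

Lemma level_pairing2 (c s s' : F) : ideal_scale 2^-1 (ideal_mul level (different F)) c ->
  ideal_dual n s -> ideal_dual n s' -> exists2 q, codiff q & c * s * s' = 2 * q.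
Proof.
move=> cL sD s'D; have [y ny ->] := level_pairing cL sD.
by exists (y * s'); [exact: s'D|rewrite mulrA].
Qed.

(** The product m n n is contained in m, hence in 4 O. *)
Lemma level_sub4 : Gamma0 level `<=` Gamma0 (ideal_scale 4 O).
Proof.
case: n_ideal => nO _ _ nM A [d1 hO hb [x xI hx]]; split => //; exists x => //.
apply: ideal_mulSl xI; apply: ideal_mul_min => [|x1 y1 [k1 O1 <-] [k2 O2 <-]|x1 y1 /m_div4[k Ok <-] yI].
- by exists 0; rewrite ?mulr0 //; exact: ringO0.
- by exists (k1 + k2); rewrite ?mulrDr //; exact: ringOD.
exists (k * y1); last by rewrite mulrA.
apply: ringOM => //; move: y1 yI; apply: ideal_mul_min => [|x2 y2|x2 y2 /nO h2 /nO h3].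
- exact: ringO0.
- exact: ringOD.
- exact: ringOM.
Qed.

Lemma det_mx2 A : \det A = A 0 0 * A 1 1 - A 0 1 * A 1 0.
Proof.
rewrite (expand_det_row _ 0) !big_ord_recl big_ord0 addr0 /cofactor !det_mx11 !mxE /=.
rewrite expr0 expr1 mul1r mulN1r mulrN.
by congr (_ - _); congr (A _ _ * A _ _); apply: val_inj.
Qed.

Lemma mulmx2E A B i j : (A *m B) i j = A i 0 * B 0 j + A i 1 * B 1 j.
Proof.
rewrite mxE !big_ord_recl big_ord0 addr0.
by congr (_ + A _ _ * B _ _); apply: val_inj.
Qed.

Lemma unipotentE (b : F) : [/\ unipotent b 0 0 = 1, unipotent b 0 1 = b,
  unipotent b 1 0 = 0 & unipotent b 1 1 = 1].
Proof. by rewrite /unipotent !mxE /= !mulr0 !mulr1 !addr0 !add0r. Qed.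

Lemma mx2P A B : A 0 0 = B 0 0 -> A 0 1 = B 0 1 -> A 1 0 = B 1 0 -> A 1 1 = B 1 1 -> A = B.
Proof.
move=> h00 h01 h10 h11; apply/matrixP => i j.
have ord2 (k : 'I_2) : k = 0 \/ k = 1.
  by case: k => [[|[|k]] hk]; [left|right|by []]; apply: val_inj.
by case: (ord2 i) => ->; case: (ord2 j) => ->.
Qed.

Lemma invmx_unipotent (b : F) : invmx (unipotent b) = unipotent (- b).
Proof.
have e : unipotent b *m unipotent (- b) = 1%:M.
  have [p00 p01 p10 p11] := unipotentE b; have [q00 q01 q10 q11] := unipotentE (- b).
  by apply: mx2P; rewrite mulmx2E ?p00 ?p01 ?p10 ?p11 ?q00 ?q01 ?q10 ?q11 !mxE /=; ring.
have [bU _] := mulmx1_unit e.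
by rewrite -[RHS](mulKmx bU) e mulmx1.
Qed.

Definition translate_conj (A : 'M[F]_2) (x y : F) := unipotent x *m A *m invmx (unipotent y).

Lemma translate_conjE A x y : let B := translate_conj A x y in
  [/\ B 0 0 = A 0 0 + x * A 1 0, B 1 0 = A 1 0, B 1 1 = A 1 1 - y * A 1 0 &
      B 0 1 = A 0 1 + x * A 1 1 - y * (A 0 0 + x * A 1 0)].
Proof.
rewrite /translate_conj invmx_unipotent /=.
have [p00 p01 p10 p11] := unipotentE x; have [q00 q01 q10 q11] := unipotentE (- y).
split; rewrite !mulmx2E ?p00 ?p01 ?p10 ?p11 ?q00 ?q01 ?q10 ?q11; ring.
Qed.

(** The lower left entry c does not change, and c w is integral. In the upper
    right entry the congruence on t and a d = 1 + b c leave multiples of b, of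
    (t - d^2 r) w and of c w^2, all in twice the codifferent. *)
Lemma level_translate_conj (A : 'M[F]_2) (r t w' : F) : Gamma0 level A -> O r -> O t ->
  ideal_dual n w' -> n (t - A 1 1 ^+ 2 * r) ->
  Gamma0 level (translate_conj A (r * (2 * w')) (t * (2 * w'))).
Proof.
move=> [d1 [aO dO] [b' hb' bE] cL] rO tO wD tn.
have [e00 e10 e11 e01] := translate_conjE A (r * (2 * w')) (t * (2 * w')).
have [nO _ _ _] := n_ideal; have O2 : O 2 := ringO2 F.
have [y /nO Oy cw] := level_pairing cL wD; have [q hq cww] := level_pairing2 cL wD wD.
have ad : A 0 0 * A 1 1 = 1 + A 0 1 * A 1 0 by rewrite -d1 det_mx2; ring.
split.
- rewrite det_mx2 e00 e01 e10 e11 -d1 det_mx2; ring.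
- rewrite e00 e11; split.
    have -> : r * (2 * w') * A 1 0 = r * (2 * (2 * y)) by rewrite -cw; ring.
    by apply: ringOD => //; do ?apply: ringOM.
  have -> : t * (2 * w') * A 1 0 = t * (2 * (2 * y)) by rewrite -cw; ring.
  by apply: ringOB => //; do ?apply: ringOM.
- rewrite e01; set nu := t - _ in tn.
  exists (b' + b' * (- (r * A 1 1 * 2 * (2 * y))) + nu * w' * (- A 0 0) + q * (- (t * r * 2 * 2))).
    apply: codiffD; last by apply: codiffM => //; apply: ringON; do ?apply: ringOM.
    apply: codiffD; last by apply: codiffM; [exact: wD|exact: ringON].
    by apply: codiffD => //; apply: codiffM => //; apply: ringON; do ?apply: ringOM.
  rewrite -cw.
  have tE : t = nu + A 1 1 ^+ 2 * r by rewrite /nu; ring.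
  have key : t * (2 * w') * A 0 0 = nu * (2 * w') * A 0 0 + r * (2 * w') * A 1 1 * (1 + A 0 1 * A 1 0).
    by rewrite -ad {1}tE; ring.
  have cww' : q * 2 = A 1 0 * w' * w' by rewrite cww; ring.
  transitivity (2 * b' + r * (2 * w') * A 1 1 - t * (2 * w') * A 0 0 - t * r * 4 * (A 1 0 * w' * w')).
    rewrite key -bE -cww'; ring.
  by rewrite -bE; ring.
- by rewrite e10.
Qed.

End LevelSubgroup.

(** * Vanishing of general Dirichlet series *)
Section DirichletSeries.
Variable R : realType.
Local Notation C := R[i].

Lemma expR_partial_le (x : R) k : 0 <= x -> \sum_(i < k) x ^+ i / i`!%:R <= expR x.
Proof.
move=> x0; have := @nondecreasing_cvgn_le R (series (exp_coeff x)).
rewrite -(big_mkord predT (fun i => x ^+ i / i`!%:R)); apply; last exact: is_cvg_series_exp_coeff.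
apply/nondecreasing_seqP => n; rewrite /series /= big_nat_recr //= lerDl.
by apply: divr_ge0; [exact: exprn_ge0|exact: ler0n].
Qed.

Lemma expR_term_le (x : R) k : 0 <= x -> x ^+ k / k`!%:R <= expR x.
Proof.
move=> x0; apply: le_trans (expR_partial_le k.+1 x0); rewrite big_ord_recr /= lerDr.
by apply: sumr_ge0 => i _; apply: divr_ge0; [exact: exprn_ge0|exact: ler0n].
Qed.

(** The remainder is dominated by the sum of the x^i / i! with i >= k, and
    rho^i <= rho^k there. The free parameter rho trades size for decay in k. *)
Lemma expR_taylor (x rho : R) k : 0 <= x -> 0 < rho -> rho <= 1 ->
  `|expR (- x) - \sum_(i < k) (- x) ^+ i / i`!%:R| <= rho ^+ k * expR (x / rho).
Proof.
move=> x0 rho0 rho1; set T := \sum_(i < k) _; set B := _ * expR _.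
have tail n : (k <= n)%N -> `|series (exp_coeff (- x)) n - T| <= B.
  move=> kn; rewrite /series /T -(big_mkord predT (fun i => (- x) ^+ i / i`!%:R)) /=.
  rewrite (big_cat_nat _ (n := k)) //=.
  rewrite addrAC subrr add0r; apply: le_trans (ler_norm_sum _ _ _) _.
  apply: (@le_trans _ _ (\sum_(k <= i < n) rho ^+ k * ((x / rho) ^+ i / i`!%:R))).
    rewrite big_nat_cond [leRHS]big_nat_cond; apply: ler_sum => i /andP[/andP[ki _] _].
    rewrite normrM normrX normrN (ger0_norm x0) ger0_norm ?invr_ge0 ?ler0n // mulrA.
    apply: ler_wpM2r; first by rewrite invr_ge0 ler0n.
    rewrite expr_div_n mulrCA -[leLHS]mulr1; apply: ler_wpM2l; first exact: exprn_ge0.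
    rewrite -exprVn -(subnKC ki) [_ ^-1 ^+ _]exprD mulrA exprVn mulfV ?mul1r; last first.
      by rewrite expf_neq0 // gt_eqF.
    by rewrite exprVn invf_ge1 ?exprn_gt0 // exprn_ile1 // ltW.
  rewrite -mulr_sumr /B; apply: ler_wpM2l; first by rewrite exprn_ge0 // ltW.
  apply: le_trans (expR_partial_le n (divr_ge0 x0 (ltW rho0))).
  rewrite -(big_mkord predT (fun i => (x / rho) ^+ i / i`!%:R)) [leRHS](big_cat_nat _ (n := k)) //=.
  rewrite lerDr; apply: sumr_ge0 => i _; apply: divr_ge0; last exact: ler0n.
  by apply: exprn_ge0; apply: divr_ge0 => //; exact: ltW.
rewrite ler_norml /expR; apply/andP; split.
  rewrite lerBrDr; apply: limr_ge; first exact: is_cvg_series_exp_coeff.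
  near=> n; have /tail : (k <= n)%N by near: n; exact: nbhs_infty_ge.
  by rewrite ler_norml lerBrDr => /andP[].
rewrite lerBlDr; apply: limr_le; first exact: is_cvg_series_exp_coeff.
near=> n; have /tail : (k <= n)%N by near: n; exact: nbhs_infty_ge.
by rewrite ler_norml lerBlDr => /andP[].
Unshelve. all: by end_near. Qed.

Lemma exprn_small (q S e : R) : 0 <= q < 1 -> 0 < e -> exists k, q ^+ k * S <= e.
Proof.
move=> /andP[q0 q1] e0.
have h : (fun k => q ^+ k * S) @ \oo --> (0 * S : R).
  by apply: cvgMl; apply: cvg_expr; rewrite ger0_norm.
have : \forall k \near \oo, q ^+ k * S <= e.
  by move/cvgr_le: h; apply; rewrite mul0r.
by move=> [k _ hk]; exists k; apply: (hk k) => /=.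
Qed.

Variables (I : choiceType) (E : I -> R).
Hypothesis E0 : forall i, 0 <= E i.
Implicit Types (b : I -> C) (s h : R).

(** A general Dirichlet series with exponents E; tcoef gives its Taylor
    coefficients at 0. *)
Definition dsum b s : C := tsum (fun i => b i * ((expR (- (E i * s)))%:C)%C).

Definition tcoef b j : C := tsum (fun i => b i * (((- E i) ^+ j / j`!%:R)%:C)%C).

Variables (h0 S : R).
Hypothesis h0_gt0 : 0 < h0.

(** Absolute convergence up to abscissa - h0, which bounds the radius of
    convergence of the Taylor series at every s >= 0 from below by h0. *)
Definition exp_bounded b := forall B : {fset I}, \sum_(i <- B) cabs (b i) * expR (E i * h0) <= S.

Lemma exp_bounded_ge0 b : exp_bounded b -> 0 <= S.
Proof. by move/(_ fset0); rewrite big_nil. Qed.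

Lemma dsum_summable b s : exp_bounded b -> 0 <= s ->
  abs_summable (fun i => b i * ((expR (- (E i * s)))%:C)%C).
Proof.
move=> bb s0; apply: (abs_summable_le _ bb) => i.
rewrite cabsM cabs_real ger0_norm ?expR_ge0 //; apply: ler_wpM2l; first exact: cabs_ge0.
rewrite ler_expR; apply: (@le_trans _ _ 0); first by rewrite oppr_le0 mulr_ge0.
by rewrite mulr_ge0 // ltW.
Qed.

Lemma tcoef_summable b j : exp_bounded b ->
  abs_summable (fun i => b i * (((- E i) ^+ j / j`!%:R)%:C)%C).
Proof.
move=> bb; apply: (@abs_summable_le _ _ _ (fun i => h0^-1 ^+ j * (cabs (b i) * expR (E i * h0))) (h0^-1 ^+ j * S)).
  move=> i; rewrite cabsM cabs_real normrM normrX normrN (ger0_norm (E0 i)) [X in _ * (_ * X)]ger0_norm ?invr_ge0 ?ler0n //.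
  rewrite [leRHS]mulrCA; apply: ler_wpM2l; first exact: cabs_ge0.
  have := @expR_term_le (E i * h0) j (mulr_ge0 (E0 i) (ltW h0_gt0)).
  rewrite exprMn => le1; rewrite exprVn ler_pdivlMl ?exprn_gt0 //.
  by rewrite mulrCA mulrA.
by move=> B; rewrite -mulr_sumr ler_wpM2l // exprn_ge0 // invr_ge0 ltW.
Qed.

Lemma dsum_taylor b k h : exp_bounded b -> 0 < h -> h <= h0 ->
  cabs (dsum b h - \sum_(j < k) ((h ^+ j)%:C)%C * tcoef b j) <= (h / h0) ^+ k * S.
Proof.
move=> bb hgt hle; have hh : 0 < h / h0 by exact: divr_gt0.
have hh1 : h / h0 <= 1 by rewrite ler_pdivrMr // mul1r.
have tsm j := tcoef_summable j bb; have sm := dsum_summable bb (ltW hgt).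
have -> : dsum b h - \sum_(j < k) ((h ^+ j)%:C)%C * tcoef b j =
    tsum (fun i => b i * ((expR (- (E i * h)))%:C)%C +
      -1 * \sum_(j < k) ((h ^+ j)%:C)%C * (b i * (((- E i) ^+ j / j`!%:R)%:C)%C)).
  have smj (j : 'I_k) : abs_summable (fun i => ((h ^+ j)%:C)%C * (b i * (((- E i) ^+ j / j`!%:R)%:C)%C)).
    exact: abs_summableZ.
  have smS : abs_summable (fun i => \sum_(j < k) ((h ^+ j)%:C)%C * (b i * (((- E i) ^+ j / j`!%:R)%:C)%C)).
    elim: (index_enum _) => [|j r IH].
      by exists 0 => B; rewrite big1 // => i _; rewrite big_nil cabs0.
    have := abs_summableD (smj j) IH; congr abs_summable; apply/funext => i.
    by rewrite big_cons.
  rewrite tsumD // ?(tsumZ _ smS); last exact: abs_summableZ.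
  rewrite tsum_fin // mulN1r; congr (_ - _); apply: eq_bigr => j _.
  by rewrite (tsumZ _ (tsm j)).
apply: (@tsum_bound_le _ _ _ (fun i => (h / h0) ^+ k * (cabs (b i) * expR (E i * h0)))); last first.
  by move=> B; rewrite -mulr_sumr ler_wpM2l // exprn_ge0 // ltW.
move=> i; rewrite mulN1r.
have -> : b i * ((expR (- (E i * h)))%:C)%C -
    \sum_(j < k) ((h ^+ j)%:C)%C * (b i * (((- E i) ^+ j / j`!%:R)%:C)%C) =
    b i * ((expR (- (E i * h)) - \sum_(j < k) (- (E i * h)) ^+ j / j`!%:R)%:C)%C.
  rewrite rmorphB rmorph_sum mulrBr mulr_sumr; congr (_ - _); apply: eq_bigr => j _ /=.
  by rewrite mulrCA -rmorphM mulrA -exprMn mulrN [h * _]mulrC.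
rewrite cabsM cabs_real mulrCA; apply: ler_wpM2l; first exact: cabs_ge0.
apply: le_trans (expR_taylor k (mulr_ge0 (E0 i) (ltW hgt)) hh hh1) _.
rewrite invf_div mulrA -[E i * h * h0]mulrAC mulfK // gt_eqF //.
Qed.

Lemma tcoef_eq0 b (e : R) : exp_bounded b -> 0 < e ->
  (forall h, 0 < h -> h < e -> dsum b h = 0) -> forall k, tcoef b k = 0.
Proof.
move=> bb e0 vanish; have S0 := exp_bounded_ge0 bb.
elim/ltn_ind => k IH; apply: cabs_lt_eq0 => eps eps0.
pose A := S / h0 ^+ k.+1; have A0 : 0 <= A by rewrite divr_ge0 // exprn_ge0 // ltW.
pose h := Num.min (e / 2) (Num.min h0 (eps / (A + 1))).
have h_gt0 : 0 < h by rewrite !lt_min divr_gt0 //= h0_gt0 divr_gt0 // ltr_wpDl.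
have h_e : h < e by apply: (@le_lt_trans _ _ (e / 2)); [rewrite ge_min lexx|lra].
have h_h0 : h <= h0 by rewrite !ge_min lexx /= orbT.
have h_eps : h * (A + 1) <= eps.
  by rewrite -ler_pdivlMr ?ltr_wpDl // !ge_min lexx !orbT.
have := dsum_taylor k.+1 bb h_gt0 h_h0; rewrite (vanish h) // big_ord_recr /= big1 => [|j _].
  rewrite !add0r cabsN cabsM cabs_real.
  have hk : 0 < h ^+ k by exact: exprn_gt0.
  rewrite gtr0_norm // => le1.
  rewrite -(ler_pM2l hk); apply: le_trans le1 _.
  rewrite expr_div_n exprSr -mulrA -mulrA; apply: ler_wpM2l; first exact: ltW.
  rewrite -mulrA [_ * S]mulrC -/A.
  apply: le_trans h_eps; apply: ler_wpM2l; first exact: ltW.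
  by rewrite lerDl.
by rewrite IH ?mulr0 // ltn_ord.
Qed.

(** All Taylor coefficients vanish, hence so does the function on the whole
    interval of convergence. *)
Lemma dsum_local b (e : R) : exp_bounded b -> 0 < e ->
  (forall h, 0 < h -> h < e -> dsum b h = 0) -> forall h, 0 < h -> h < h0 -> dsum b h = 0.
Proof.
move=> bb e0 vanish h hgt hlt; apply: cabs_lt_eq0 => eps eps0.
have q01 : 0 <= h / h0 < 1 by rewrite divr_ge0 ?ltW //= ltr_pdivrMr ?mul1r.
have [k hk] := exprn_small S q01 eps0; apply: le_trans hk.
have := dsum_taylor k bb hgt (ltW hlt); rewrite big1 ?subr0 // => j _.
by rewrite (tcoef_eq0 bb e0 vanish) mulr0.
Qed.

(** The radius h0 serves at every center, so vanishing propagates by steps of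
    h0 / 2. *)
Lemma dsum_vanish b (e : R) : exp_bounded b -> 0 < e ->
  (forall h, 0 < h -> h < e -> dsum b h = 0) -> forall h, 0 < h -> dsum b h = 0.
Proof.
move=> bb e0 vanish.
have step n : forall h, 0 < h -> h < h0 + n%:R * (h0 / 2) -> dsum b h = 0.
  elim: n => [|n IH] h hgt; first by rewrite mul0r addr0; apply: (dsum_local bb e0 vanish).
  pose s := n.+1%:R * (h0 / 2); rewrite -/s => hlt.
  have s0 : 0 < s by rewrite mulr_gt0 ?ltr0n // divr_gt0.
  have sE : s = h0 / 2 + n%:R * (h0 / 2) by rewrite /s -natr1; ring.
  have [hs|hs] := leP h s; first by apply: IH => //; rewrite sE in hs; lra.
  pose b' i := b i * ((expR (- (E i * s)))%:C)%C.
  have b'b : exp_bounded b'.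
    move=> B; apply: le_trans (bb B); apply: ler_sum => i _.
    apply: ler_wpM2r; first exact: expR_ge0.
    rewrite cabsM cabs_real ger0_norm ?expR_ge0 // ler_piMr ?cabs_ge0 //.
    by rewrite expR_le1 oppr_le0 mulr_ge0 // ltW.
  have shift u : dsum b' u = dsum b (s + u).
    congr tsum; apply/funext => i; rewrite /b' -mulrA -rmorphM /= -expRD; congr (_ * ((expR _)%:C)%C).
    ring.
  have h2 : 0 < h0 / 2 by rewrite divr_gt0.
  have := dsum_local b'b h2; rewrite -[h](subrKC s) -shift; apply.
  - by move=> u u0 ult; rewrite shift; apply: IH; [lra|rewrite sE; lra].
  - by rewrite subr_gt0.
  - lra.
move=> h hgt; have [n hn] : exists n, h < n%:R * (h0 / 2).
  exists (Num.truncn (h / (h0 / 2))).+1.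
  by rewrite -ltr_pdivrMr ?divr_gt0 // truncnS_gt.
by apply: (step n) => //; apply: (lt_trans hn); rewrite ltrDr.
Qed.

End DirichletSeries.

(** * Nonvanishing of theta values *)
Section Nonvanishing.
Variables (F : fieldExtType rat) (R : realType) (P : frame F R).
Local Notation D := (\dim {:F}).
Local Notation C := R[i].
Local Notation O := (ring_of_integers F).
Local Notation emb := (emb P).
Implicit Types (tau z : 'I_D -> C) (xi : O).

Lemma tsum_delta (I : choiceType) (i0 : I) : tsum (fun i => if i == i0 then 1 else 0 : C) = 1.
Proof.
apply: has_sum_tsum => e e0; exists [fset i0]%fset => B /fsubsetP/(_ i0 (fset11 _)) i0B.
rewrite (big_fsetD1 i0) //= eqxx big1_fset => [|i]; first by rewrite addr0 subrr cabs0.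
by rewrite !inE => /andP[/negPf-> _] _.
Qed.

(** The terms other than t i0 = 1 add up to less than 1. *)
Lemma dominant_term_neq0 (I : choiceType) (t : I -> C) (i0 : I) (Mj : I -> R) (q S : R) :
  t i0 = 1 -> 0 <= q -> (forall i, 0 <= Mj i) -> (forall i, i != i0 -> cabs (t i) <= q * Mj i) ->
  (forall B : {fset I}, \sum_(i <- B) Mj i <= S) -> q * S < 1 -> tsum t != 0.
Proof.
move=> t1 q0 M0 tM MS qS; apply/eqP => sum0.
pose t' i := if i == i0 then 0 else t i; pose dlt i : C := if i == i0 then 1 else 0.
have t'M i : cabs (t' i) <= q * Mj i.
  by rewrite /t'; case: eqP => [_|/eqP/tM//]; rewrite cabs0 mulr_ge0.
have bound (B : {fset I}) : \sum_(i <- B) q * Mj i <= q * S.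
  by rewrite -mulr_sumr ler_wpM2l.
have tE : t = fun i => dlt i + t' i.
  by apply/funext => i; rewrite /dlt /t'; case: eqP => [->|_]; rewrite ?t1 ?addr0 ?add0r.
have dlt_sum : abs_summable dlt.
  exists 1 => B; have [i0B|i0B] := boolP (i0 \in B).
    rewrite (big_fsetD1 i0) //= /dlt eqxx big1_fset => [|i]; first by rewrite addr0 cabs1.
    by rewrite !inE => /andP[/negPf-> _] _; rewrite cabs0.
  rewrite big1_fset ?ler01 // => i iB _; rewrite /dlt; case: eqP => [ii0|_]; last by rewrite cabs0.
  by move: i0B; rewrite -ii0 iB.
move: sum0; rewrite tE tsumD //; last exact: abs_summable_le bound.
rewrite tsum_delta => /(canRL (addKr _)); rewrite addr0 => tE'.
have := tsum_bound_le t'M bound; rewrite tE' cabsN cabs1 => h.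
by have := le_lt_trans h qS; rewrite ltxx.
Qed.

Lemma norm2E xi : norm2 P xi = ratr (field_trace (val xi ^+ 2)).
Proof. by rewrite (fplace_trace P); apply: eq_bigr => i _; rewrite rmorphXn. Qed.

(** norm2 xi is the trace of xi^2, a positive integer. *)
Lemma norm2_ge1 xi : val xi != 0 -> 1 <= norm2 P xi.
Proof.
move=> xi0; have /intrP[k kE] := ftrace_int P (ringOM (intOP xi) (intOP xi)).
have nE : norm2 P xi = k%:~R by rewrite norm2E expr2 kE ratr_int.
have : 0 < norm2 P xi.
  rewrite /norm2 (bigD1 (Ordinal (number_field_dim_gt0 F))) //=; apply: ltr_wpDr.
    by apply: sumr_ge0 => i _; exact: sqr_ge0.
  by rewrite exprn_even_gt0 //= fmorph_eq0.
by rewrite nE ltr0z ler1z gtz0_ge1.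
Qed.

Lemma qterm0 tau xi : val xi = 0 -> qterm P tau (fun=> 0) 0 xi = 1.
Proof.
move=> xi0; rewrite /qterm /qexp big1 => [|i _]; first by rewrite addr0 mulr0 cexp0.
by rewrite xi0 emb0 expr0n /= !(mul0r, mulr0) addr0.
Qed.

Lemma qterm_gauss_bound tau (y : R) xi : 0 < y -> (forall i, y <= complex.Im (tau i)) ->
  cabs (qterm P tau (fun=> 0) 0 xi) <= expR (- (pi * y * norm2 P xi)).
Proof.
move=> y0 hy; have c0 : cabs (0 : C) <= 0 by rewrite cabs0.
have := @qterm_bound F R P tau (fun=> 0) 0 y 0 y0 (lexx 0) hy (fun=> c0) c0 xi.
by rewrite !mulr0 mul0r addr0 expR0 mulr1.
Qed.

Definition intO0 : O := intO (ringO0 F).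

Lemma neq_intO0 xi : xi != intO0 -> val xi != 0.
Proof. by apply: contra => /eqP h; apply/eqP/val_inj. Qed.

Lemma gauss_summable (c : R) : 0 < c -> exists S : R, forall B : {fset O},
  \sum_(xi <- B) expR (- (c * norm2 P xi)) <= S.
Proof.
move=> c0; have [M M0 hM] := quad_exp_majorant P 0 c0 (@ler01 R).
have [S hS] := norm1_exp_summable P M0; exists S => B.
apply: le_trans (hS B); apply: ler_sum => xi _; apply: le_trans (hM xi).
by rewrite mul0r addr0 mulr1.
Qed.

Lemma expRN_mul_lt1 (S : R) : 0 <= S -> expR (- S) * S < 1.
Proof.
move=> S0; rewrite expRN mulrC ltr_pdivrMr ?expR_gt0 // mul1r.
by apply: (lt_le_trans _ (expR_ge1Dx S)); rewrite ltrDr.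
Qed.

Definition shift_up z (s : R) : 'I_D -> C := fun i => z i + (0 +i* s)%C.

Lemma qterm_shift_up z s xi : qterm P (shift_up z s) (fun=> 0) 0 xi =
  qterm P z (fun=> 0) 0 xi * ((expR (- (pi * norm2 P xi * s)))%:C)%C.
Proof.
have -> : ((expR (- (pi * norm2 P xi * s)))%:C)%C = cexp (((- (pi * norm2 P xi * s))%:C)%C).
  by rewrite /cexp /= cos0 sin0 mulr1.
rewrite -cexpD; congr cexp.
have -> : ((- (pi * norm2 P xi * s))%:C)%C = ipi R * \sum_i emb (val xi) i ^+ 2 * (0 +i* s)%C.
  rewrite -mulr_suml (_ : \sum_i _ = ((norm2 P xi)%:C)%C); last first.
    by rewrite /norm2 rmorph_sum; apply: eq_bigr => i _; rewrite rmorphXn.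
  by rewrite /ipi; apply/eqP; rewrite eq_complex /=; apply/andP; split; apply/eqP; ring.
rewrite -mulrDr; congr (_ * _); rewrite /qexp !addr0 -big_split; apply: eq_bigr => i _ /=.
by rewrite !mulr0 !addr0 mulrDr.
Qed.

(** Along z + i s the theta function is a Dirichlet series with exponents
    pi Tr(xi^2). Its term xi = 0 is 1 and dominates for large s, so it cannot
    vanish on an interval. *)
Lemma theta_nonzero_dense z (e : R) : (forall i, 0 < complex.Im (z i)) -> 0 < e ->
  exists s, [/\ 0 < s, s < e & Th P (shift_up z s) (fun=> 0) 0 != 0].
Proof.
move=> zH e0; apply: contrapT => none; have [y y0 hy] := Im_lower_bound zH.
pose E xi : R := pi * norm2 P xi; pose b xi := qterm P z (fun=> 0) 0 xi.
have E0 xi : 0 <= E xi by rewrite mulr_ge0 ?pi_ge0 ?norm2_ge0.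
have h0 : 0 < y / 2 by rewrite divr_gt0.
have [S hS] := gauss_summable (mulr_gt0 (pi_gt0 R) h0).
have bb : exp_bounded E (y / 2) S b.
  move=> B; apply: le_trans (hS B); apply: ler_sum => xi _.
  apply: (@le_trans _ _ (expR (- (pi * y * norm2 P xi)) * expR (E xi * (y / 2)))).
    by apply: ler_wpM2r; [exact: expR_ge0|exact: qterm_gauss_bound].
  by rewrite -expRD ler_expR /E; lra.
have vanish s : 0 < s -> s < e -> dsum E b s = 0.
  move=> s0 se; apply: contrapT => /eqP Thn0; apply: none; exists s; split=> //.
  suff -> : Th P (shift_up z s) (fun=> 0) 0 = dsum E b s by [].
  by congr tsum; apply/funext => xi; rewrite qterm_shift_up.
have S0 := exp_bounded_ge0 bb.
have pi1 : 1 <= pi :> R by have := @pi_ge2 R; lra.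
have := dsum_vanish E0 h0 bb e0 vanish (h := S + 1) (ltr_wpDl S0 ltr01).
apply/eqP; apply: (@dominant_term_neq0 _ _ intO0 (fun xi => cabs (b xi) * expR (E xi * (y / 2))) (expR (- S)) S) => //.
- rewrite /b qterm0 // mul1r /E (_ : norm2 P intO0 = 0) ?mulr0 ?mul0r ?oppr0 ?expR0 //.
  by rewrite norm2E /= expr0n field_trace0 rmorph0.
- by move=> xi; rewrite mulr_ge0 ?cabs_ge0 ?expR_ge0.
- move=> xi /neq_intO0/norm2_ge1 n1; rewrite cabsM mulrCA cabs_real ger0_norm ?expR_ge0 //.
  apply: ler_wpM2l; first exact: cabs_ge0.
  rewrite -expRD ler_expR; apply: (@le_trans _ _ (- S)); last by rewrite lerDl mulr_ge0 // ltW.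
  rewrite lerN2; apply: (@le_trans _ _ (S + 1)); first by rewrite lerDl.
  rewrite ler_peMl ?addr_ge0 // /E; apply: (le_trans n1).
  by rewrite ler_peMl // norm2_ge0.
- exact: expRN_mul_lt1.
Qed.

(** If theta vanished at all torsion points, so would its part supported on
    N O, by Fourier inversion for the indicator of N O; but for large N that part
    is dominated by the term xi = 0. *)
Lemma theta_torsion_neq0 z : (forall i, 0 < complex.Im (z i)) ->
  exists p : F, Th P z (emb p) 0 != 0.
Proof.
move=> zH; apply: contrapT => none; have [y y0 hy] := Im_lower_bound zH.
have c0 : 0 < pi * (y / 2) by rewrite mulr_gt0 ?pi_gt0 ?divr_gt0.
have [S hS] := gauss_summable c0.
have S0 : 0 <= S by have := hS fset0; rewrite big_nil.
(* Nonzero elements of N O have norm2 at least N^2 >= N. *)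
pose N := Num.truncn (S / (pi * (y / 2))).
have hN : S < (N.+1)%:R * (pi * (y / 2)) by rewrite -ltr_pdivrMr // truncnS_gt.
have N0 : N.+1%:R != 0 :> F by rewrite -(rmorph_nat (in_alg F) N.+1) /= scaler_eq0 oner_eq0 orbF pnatr_eq0.
pose phi (xi : F) : C := if `[< O (xi / N.+1%:R) >] then 1 else 0.
have per : box_periodic N (fun m => phi (int_point P m)).
  move=> m k; rewrite /phi int_pointD int_pointZ mulrDl [N.+1%:~R * _]mulrC mulfK //.
  congr (if _ then _ else _); apply: asbool_equiv_eq; split => [h|h].
    rewrite -[_ / _](addrK (int_point P k)); apply: ringOB => //; exact: int_point_int.
  by apply: ringOD => //; exact: int_point_int.
have := theta_fourier per zH (ringO1 F); rewrite big1 => [|g _]; last first.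
  apply/eqP; rewrite mulf_eq0; apply/orP; right; apply/negP => /negP Thn0; apply: none.
  by exists (1 * torsion_point P g).
move=> /esym; apply/eqP.
apply: (@dominant_term_neq0 _ _ intO0 (fun xi => expR (- (pi * (y / 2) * norm2 P xi))) (expR (- S)) S) => //.
- rewrite qterm0 // mulr1 /phi ifT //; apply/asboolP; rewrite /= mulr0 mul0r; exact: ringO0.
- move=> xi /neq_intO0 xi0; rewrite cabsM mul1r /phi; case: asboolP => [h|_]; last first.
    by rewrite cabs0 mul0r mulr_ge0 ?expR_ge0.
  rewrite cabs1 mul1r; apply: le_trans (qterm_gauss_bound xi y0 hy) _.
  rewrite -expRD ler_expR.
  have n2 : N.+1%:R <= norm2 P xi.
    have n1 : 1 <= norm2 P (intO h) by apply: norm2_ge1; rewrite /= mulf_neq0 ?invr_eq0.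
    have -> : norm2 P xi = N.+1%:R ^+ 2 * norm2 P (intO h).
      rewrite /norm2 mulr_sumr; apply: eq_bigr => i _ /=.
      rewrite -exprMn; congr (_ ^+ 2); rewrite rmorphM fmorphV /= rmorph_nat mulrCA mulfV ?mulr1 // pnatr_eq0.
    apply: (@le_trans _ _ (N.+1%:R ^+ 2)); last by rewrite ler_peMr // sqr_ge0.
    by rewrite -natrX ler_nat leq_pmulr.
  have hS2 : S <= pi * (y / 2) * norm2 P xi.
    by apply: (le_trans (ltW hN)); rewrite mulrC ler_wpM2l // ltW.
  lra.
- exact: expRN_mul_lt1.
Qed.

End Nonvanishing.

(** * The automorphy factor as a limit *)
Section PlaceSpace.
Variables (F : fieldExtType rat) (R : realType).
Local Notation C := R[i].

Lemma cvg_cabsP (T : Type) (G : set_system T) {FG : Filter G} (f : T -> R[i]^o) (l : R[i]^o) :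
  f @ G --> l <-> forall e : R, 0 < e -> \forall x \near G, cabs (f x - l) <= e.
Proof.
split=> [/cvgrPdist_le h e e0|h].
  have e0' : 0 < ((e%:C)%C : C) by rewrite ltcR.
  by apply: filterS (h _ e0') => x; rewrite distrC cabsE lecR.
apply/cvgrPdist_le => e; rewrite ltcE => /andP[/eqP ei er].
have := h _ er; apply: filterS => x hx; rewrite distrC cabsE lecE /= hx andbT.
by rewrite /= in ei *; rewrite ei.
Qed.

Lemma Ca_cvg (T : Type) (G : set_system T) {FG : Filter G} (f : T -> Ca F R) (u : Ca F R) :
  (forall v, (fun x => f x v : R[i]^o) @ G --> (u v : R[i]^o)) -> f @ G --> u.
Proof.
move=> h; apply/cvg_sup => v A /= [_ [[B Bop <-] Bu] sBA].
have : nbhs (u v : R[i]^o) B by apply: open_nbhs_nbhs.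
move/h; rewrite /= !nbhs_simpl /=; apply: filterS => x Bx; exact: sBA.
Qed.

Lemma Ca_coord_cvg (u : Ca F R) v : (fun x : Ca F R => x v : R[i]^o) @ nbhs u --> (u v : R[i]^o).
Proof. exact: (@proj_continuous _ (fun _ : place F R => R[i]^o) v u). Qed.

Lemma translate_cvg (u : Ca F R) (y : F) :
  (fun x : Ca F R => translate x y) @ nbhs u --> translate u y.
Proof.
apply: Ca_cvg => v; rewrite /translate; apply: cvgD; first exact: Ca_coord_cvg.
exact: cvg_cst.
Qed.

Lemma translateK (u : Ca F R) (y : F) : translate (translate u y) (- y) = u.
Proof. by apply/funext => v; rewrite /translate !rmorphN /= addrK. Qed.

Lemma translate_upper (u : Ca F R) (y : F) : upper_half u -> upper_half (translate u y).
Proof. by move=> h v; have := h v; rewrite /translate; case: (u v) => a b /=; rewrite addr0. Qed.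

Variable P : frame F R.

Definition coords (u : Ca F R) : 'I_(\dim {:F}) -> C := fun i => u (fplace P i).

Lemma coords_upper u : upper_half u -> forall i, 0 < complex.Im (coords u i).
Proof. by move=> h i; exact: h. Qed.

Lemma theta_coords (u : Ca F R) : theta u = Th P (coords u) (fun=> 0) 0.
Proof.
congr (summability.sum _); apply/funext => xi; congr (cexp (_ * _)).
rewrite /qexp addr0 (fsbigE (map (fplace P) (enum 'I_(\dim {:F})))) //.
- rewrite big_map big_enum_cond /=; apply: eq_big => [i|i _]; first by rewrite in_setT.
  by rewrite mulr0 addr0 /emb rmorphXn.
- by rewrite map_inj_uniq ?enum_uniq //; exact: fplace_inj.
- move=> v _ /negP; case: (fplace_surj P v) => i ->; case.
  by apply: map_f; rewrite mem_enum.
Qed.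

Lemma coords_moebius (g : 'M[F]_2) (u : Ca F R) :
  coords (moebius g u) = mob P (g 0 0) (g 0 1) (g 1 0) (g 1 1) (coords u).
Proof. by []. Qed.

Lemma coords_translate (u : Ca F R) (y : F) :
  coords (translate u y) = fun i => coords u i + emb P y i.
Proof. by []. Qed.

Lemma coords_cvg (u : Ca F R) i : (fun x => coords x i : R[i]^o) @ nbhs u --> (coords u i : R[i]^o).
Proof. exact: Ca_coord_cvg. Qed.

Lemma Th_cvg (T : Type) (G : set_system T) {FG : Filter G}
  (tau l : T -> 'I_(\dim {:F}) -> R[i]^o) (k : T -> R[i]^o) tau0 l0 (k0 : R[i]^o) :
  (forall i, 0 < complex.Im (tau0 i)) ->
  (forall i, (fun x => tau x i) @ G --> (tau0 i : R[i]^o)) ->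
  (forall i, (fun x => l x i) @ G --> (l0 i : R[i]^o)) -> k @ G --> k0 ->
  (fun x => Th P (tau x) (l x) (k x) : R[i]^o) @ G --> (Th P tau0 l0 k0 : R[i]^o).
Proof.
move=> tauH htau hl hk; apply/cvg_cabsP => e e0.
have [eta eta0 [M M0 hM]] := theta_continuous P l0 k0 tauH.
pose h := Num.min eta (e / (M + 1)).
have h0 : 0 < h by rewrite lt_min eta0 divr_gt0 // ltr_wpDl.
have hMe : M * h <= e.
  apply: (@le_trans _ _ ((M + 1) * h)); first by rewrite ler_wpM2r ?lerDl ?ltW.
  by rewrite mulrC -ler_pdivlMr ?ltr_wpDl // ge_min lexx orbT.
have n1 : \forall x \near G, forall i, cabs (tau x i - tau0 i) <= h.
  by apply: filter_forall => i; have /cvg_cabsP := htau i; exact.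
have n2 : \forall x \near G, forall i, cabs (l x i - l0 i) <= h.
  by apply: filter_forall => i; have /cvg_cabsP := hl i; exact.
have n3 : \forall x \near G, cabs (k x - k0) <= h by move/cvg_cabsP: hk; exact.
near=> x; apply: le_trans hMe; apply: hM; first exact: ltW.
- by rewrite ge_min lexx.
- by near: x.
- by near: x.
- by near: x.
Unshelve. all: by end_near. Qed.

(** The points u + i s with small s > 0 and nonzero theta value accumulate at
    u. *)
Lemma theta_within_proper (u : Ca F R) : upper_half u ->
  ProperFilter (within [set x : Ca F R | upper_half x /\ theta x != 0] (nbhs u)).
Proof.
move=> uH; apply: Build_ProperFilter_ex => B Bu.
have : (fun s : R => (fun v => u v + (0 +i* s)%C) : Ca F R) @ nbhs (0 : R) --> u.
  apply: Ca_cvg => v; apply/cvg_cabsP => e e0.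
  near=> s; rewrite addrC addKr.
  apply: le_trans (cabs_le_ReIm _) _; rewrite /= normr0 add0r.
  by near: s; have := @nbhs0_le R R^o e e0.
move=> /(_ _ Bu) /= /nbhs_ballP[e /= e0 he].
have [s [s0 se nz]] := theta_nonzero_dense P (coords_upper uH) e0.
exists (fun v => u v + (0 +i* s)%C); apply: he.
  by rewrite /ball /= sub0r normrN gtr0_norm.
split; last by rewrite theta_coords.
by move=> v; have := uH v; case: (u v) => a b /= b0; exact: addr_gt0.
Unshelve. all: by end_near. Qed.

(** Where theta vanishes, the quotient has the limit J u along the dense set of
    points at which theta is nonzero. *)
Lemma automorphy_factor_limit (g : 'M[F]_2) (u : Ca F R) (J : Ca F R -> R[i]^o) :
  upper_half u -> J @ nbhs u --> J u ->
  (\forall x \near nbhs u, upper_half x -> theta (moebius g x) = J x * theta x) ->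
  automorphy_factor g u = J u.
Proof.
move=> uH Jcvg hJ; rewrite /automorphy_factor; case: ifP => [nz|_].
  by rewrite (nbhs_singleton hJ) // mulfK.
have PF := theta_within_proper uH.
apply: cvg_lim; first exact: norm_hausdorff.
apply: cvg_trans (cvg_within_filter _ Jcvg); apply: near_eq_cvg.
apply: filterS hJ => x hx [xH nz]; rewrite hx //.
by rewrite mulfK.
Qed.

End PlaceSpace.

Section AutomorphyFactor.
Variables (F : fieldExtType rat) (R : realType) (P : frame F R).
Local Notation C := R[i].
Local Notation O := (ring_of_integers F).
Local Notation coords := (coords P).
Variables (a b c d : F).
Hypothesis det1 : a * d - b * c = 1.
Hypotheses (aO : O a) (dO : O d).
Hypothesis b_even : exists2 b', codifferent F b' & b = 2 * b'.
Hypothesis c_even : forall lam, codifferent F lam -> exists2 y, O y & c * lam = 2 * y.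

(** The factor of proportionality read off at a point p of F where the theta
    series at u does not vanish, so that it is continuous near u even if
    theta(u) = 0. *)
Definition Jfactor (p : F) (u : Ca F R) : R[i]^o :=
  theta_transform P a b c d (coords u) (emb P p) / Th P (coords u) (emb P p) 0.

Lemma Jfactor_transform p u q : upper_half u -> Th P (coords u) (emb P p) 0 != 0 ->
  theta_transform P a b c d (coords u) (emb P q) = Jfactor p u * Th P (coords u) (emb P q) 0.
Proof.
move=> uH pn0; apply: (mulfI pn0).
rewrite (theta_transform_proportional P det1 aO dO b_even c_even (coords_upper P uH) p q).
by rewrite /Jfactor mulrC mulrA [_ * (_ / _)]mulrC divfK.
Qed.

Lemma Th_torsion_cvg p (u : Ca F R) : upper_half u ->
  (fun x => Th P (coords x) (emb P p) 0 : R[i]^o) @ nbhs u --> (Th P (coords u) (emb P p) 0 : R[i]^o).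
Proof.
move=> uH; apply: Th_cvg; first exact: coords_upper.
- by move=> i; exact: coords_cvg.
- by move=> i; exact: cvg_cst.
- exact: cvg_cst.
Qed.

Lemma Jfactor_cvg p (u : Ca F R) : upper_half u -> Th P (coords u) (emb P p) 0 != 0 ->
  Jfactor p @ nbhs u --> Jfactor p u.
Proof.
move=> uH pn0.
have den_cvg i : (fun x => den P c d (coords x) i : R[i]^o) @ nbhs u --> (den P c d (coords u) i : R[i]^o).
  apply: cvgD; last exact: cvg_cst.
  by apply: cvgM; [exact: cvg_cst|exact: coords_cvg].
have jfac_cvg i : (fun x => jfac P c d (coords x) i : R[i]^o) @ nbhs u --> (jfac P c d (coords u) i : R[i]^o).
  by apply: cvgV => //; exact: (den_neq0 P det1 (coords_upper P uH)).
apply: cvgM; last by apply: cvgV => //; exact: Th_torsion_cvg.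
apply: Th_cvg; first exact: (mob_upper P det1 (coords_upper P uH)).
- move=> i; apply: cvgM; last exact: jfac_cvg.
  apply: cvgD; last exact: cvg_cst.
  by apply: cvgM; [exact: cvg_cst|exact: coords_cvg].
- by move=> i; apply: cvgM; [exact: jfac_cvg|exact: cvg_cst].
- apply: cvgN; apply: cvg_big => [|i _]; first exact: add_continuous.
  apply: cvgM; last exact: cvg_cst.
  by apply: cvgM; [exact: cvg_cst|exact: jfac_cvg].
Qed.

Lemma Jfactor_near p (u : Ca F R) : upper_half u -> Th P (coords u) (emb P p) 0 != 0 ->
  \forall x \near nbhs u, Th P (coords x) (emb P p) 0 != 0.
Proof. by move=> uH pn0; apply: (cvgr_neq0 _ (Th_torsion_cvg (p := p) uH) pn0). Qed.

Lemma theta_moebius_Jfactor p (g : 'M[F]_2) (u : Ca F R) :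
  g 0 0 = a -> g 0 1 = b -> g 1 0 = c -> g 1 1 = d ->
  upper_half u -> Th P (coords u) (emb P p) 0 != 0 ->
  theta (moebius g u) = Jfactor p u * theta u.
Proof.
move=> ga gb gc gd uH pn0; rewrite !(theta_coords P) coords_moebius ga gb gc gd.
have e0 : emb P 0 = (fun=> 0) by apply/funext => i; exact: emb0.
have := Jfactor_transform 0 uH pn0; rewrite /theta_transform e0 => <-.
have eL : (fun i => jfac P c d (coords u) i * 0) = (fun=> 0) by apply/funext => i; rewrite mulr0.
have eK : - \sum_i emb P c i * jfac P c d (coords u) i * 0 ^+ 2 = 0 :> C.
  by rewrite big1 ?oppr0 // => i _; rewrite expr0n mulr0.
by rewrite eL eK.
Qed.

End AutomorphyFactor.
(** * Invariance of the automorphy factor *)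

(** The matrix identity u(x) g = g_r u(y), up to the nonvanishing of the
    denominators. *)
Lemma moebius_translate_conj (F : fieldExtType rat) (R : realType) (P : frame F R)
    (g : 'M[F]_2) (x y : F) (u : Ca F R) : \det g = 1 -> upper_half u ->
  moebius (translate_conj g x y) (translate u y) = translate (moebius g u) x.
Proof.
rewrite det_mx2 => det1 uH; have [e00 e10 e11 e01] := translate_conjE g x y.
apply/funext => v; have [i ->] := fplace_surj P v.
have dn := den_neq0 P det1 (coords_upper P uH) i.
rewrite /moebius /translate e00 e01 e10 e11; rewrite /den /emb /coords in dn.
set a := (fplace P i (g 0 0))%:C%C; set b := (fplace P i (g 0 1))%:C%C.
set c := (fplace P i (g 1 0))%:C%C in dn *; set d := (fplace P i (g 1 1))%:C%C in dn *.
rewrite !(rmorphB, rmorphD, rmorphM) /= -/a -/b -/c -/d.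
set X := (fplace P i x)%:C%C; set Y := (fplace P i y)%:C%C.
have -> : c * (u (fplace P i) + Y) + (d - Y * c) = c * u (fplace P i) + d by ring.
rewrite -[X in _ = _ + X](mulfK dn) -mulrDl; congr (_ / _); ring.
Qed.

Theorem lemma2p5 (R : realType) (F : fieldExtType rat)
    (F_real : totally_real F R)
    (m n : set F)
    (m_ideal : integral_ideal m) (n_ideal : integral_ideal n)
    (m_div4 : m `<=` ideal_scale 4 (ring_of_integers F))
    (n_proper : n <> ring_of_integers F)
    (g : 'M[F]_2) (g_in : Gamma0 (ideal_mul m (ideal_mul n n)) g)
    (w : F)
    (w_in : ideal_scale 2 (ideal_mul (codifferent F) (ideal_inv n)) w)
    (r t : F) (r_int : ring_of_integers F r) (t_int : ring_of_integers F t)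
    (t_congr : n (t - g 1 1 ^+ 2 * r)) :
  let g_r := unipotent (r * w) *m g *m invmx (unipotent (t * w)) in
  [/\ Gamma0 (ideal_mul m (ideal_mul n n)) g_r,
      Gamma0 (ideal_mul m (ideal_mul n n)) `<=`
        Gamma0 (ideal_scale 4 (ring_of_integers F)) &
      forall z : Ca F R, upper_half z ->
        automorphy_factor g z = automorphy_factor g_r (translate z (t * w))].
Proof.
move=> g_r; have [P] := frame_exists F_real; have [w' w'_in wE] := w_in.
have n_sub : n `<=` ring_of_integers F by case: n_ideal.
have wD := ideal_dual_mul_inv w'_in.
have [detg [aO dO] [b' hb' bE] cL] := g_in.
split; first by rewrite /g_r -wE; apply: level_translate_conj.
  exact: level_sub4.
move=> z zH; have [p pn0] := theta_torsion_neq0 P (coords_upper P zH).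
have det1 : g 0 0 * g 1 1 - g 0 1 * g 1 0 = 1 by rewrite -det_mx2.
have b_even : exists2 b', codifferent F b' & g 0 1 = 2 * b' by exists b'.
have c_even lam : codifferent F lam -> exists2 y, ring_of_integers F y & g 1 0 * lam = 2 * y.
  move=> /(ideal_dual_codiff n_ideal)/(level_pairing n_ideal m_div4 cL)[y ny ->].
  by exists y => //; exact: n_sub.
have c_level s : ideal_dual n s ->
    ring_of_integers F (g 1 0 * s) /\ exists2 q, codifferent F q & g 1 0 * s * s = 2 * q.
  move=> sD; split; last exact: (level_pairing2 n_ideal m_div4 cL sD sD).
  have [y ny ->] := level_pairing n_ideal m_div4 cL sD.
  by apply: ringOM; [exact: ringO2|exact: n_sub].
pose J := Jfactor P (g 0 0) (g 0 1) (g 1 0) (g 1 1) p.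
have Jcvg : J @ nbhs z --> J z by exact: Jfactor_cvg.
have nz : \forall x \near nbhs z, Th P (coords P x) (emb P p) 0 != 0 by exact: Jfactor_near.
have -> : automorphy_factor g z = J z.
  apply: (automorphy_factor_limit P) => //; apply: filterS nz => x xp xH.
  exact: theta_moebius_Jfactor.
(* g_r is compared with the factor of g read at x - t w: both automorphy
   factors are then limits of one continuous function. *)
set y := t * w; pose J' x := J (translate x (- y)).
have back : (fun x : Ca F R => translate x (- y)) @ nbhs (translate z y) --> z.
  by rewrite -{2}[z](translateK z y); exact: translate_cvg.
have -> : J z = J' (translate z y) by rewrite /J' translateK.
apply/esym; apply: (automorphy_factor_limit P); first exact: translate_upper.
  by rewrite /J' translateK; exact: (cvg_comp _ _ back Jcvg).
have : \forall x \near nbhs (translate z y), Th P (coords P (translate x (- y))) (emb P p) 0 != 0.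
  exact: back nz.
apply: filterS => x xp xH; set u := translate x (- y) in xp.
have uH : upper_half u by exact: translate_upper.
have xE : translate u y = x by rewrite -[x](translateK x (- y)) opprK.
have transJ q : theta_transform P (g 0 0) (g 0 1) (g 1 0) (g 1 1) (coords P u) (emb P q) =
    J u * Th P (coords P u) (emb P q) 0 by exact: Jfactor_transform.
have := theta_shift_transform det1 aO dO b_even (coords_upper P uH) n_ideal c_level
  r_int t_int wD t_congr transJ.
rewrite wE -/y -coords_moebius -!coords_translate xE -!theta_coords /J' -/u => <-.
rewrite -[in LHS]xE; congr theta; exact: (moebius_translate_conj P).
Qed.
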